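(* Let $\mathcal{A}_1$ and $\mathcal{A}_2$ be non-empty arrangements of lines in $\mathbb{C}^2$ such that $$\pi_1(M(\mathcal{A}_1 \cup \mathcal{A}_2)) \cong \pi_1(M(\mathcal{A}_1)) \times \pi_1(M(\mathcal{A}_2)).$$ Then the intersection of $\mathcal{A}_1$ and $\mathcal{A}_2$ consists of $|\mathcal{A}_1| \cdot |\mathcal{A}_2|$ points of multiplicity two.
   Context: An arrangement of lines $\mathcal{A}$ in $\mathbb{C}^2$ is a finite set of distinct complex affine lines, with complement $M(\mathcal{A}) = \mathbb{C}^2 \setminus \bigcup_{H \in \mathcal{A}} H$. The intersection of $\mathcal{A}_1$ and $\mathcal{A}_2$ refers to the intersection of the plane curves $\bigcup_{H\in\mathcal{A}_1} H$ and $\bigcup_{H\in\mathcal{A}_2} H$. The multiplicity of a point is the number of lines of $\mathcal{A}_1 \cup \mathcal{A}_2$ passing through it. *)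

(* Defs.v *)
From HB Require Import structures.
From mathcomp Require Import all_boot all_order all_algebra generic_quotient.
From mathcomp Require Import complex finmap ring lra.
From mathcomp Require Import boolp classical_sets functions cardinality.
From mathcomp Require Import set_interval reals topology normedtype homotopy.

Set Implicit Arguments.
Unset Strict Implicit.
Unset Printing Implicit Defensive.

Import Order.TTheory GRing.Theory Num.Theory.
Import numFieldNormedType.Exports.

Local Open Scope classical_set_scope.
Local Open Scope ring_scope.
Local Open Scope quotient_scope.

Section unit_interval.
Variable R : realType.

Definition unit_interval : Type := set_type (`[0 : R, 1]%classic : set R).
HB.instance Definition _ := Topological.on unit_interval.
Implicit Type t : unit_interval.

Definition ui_val t : R := val t.

Lemma ui_inj : injective ui_val.
Proof. exact: val_inj. Qed.

Definition clamp_val (r : R) : R := Num.max 0 (Num.min 1 r).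

Lemma clamp_subproof r : clamp_val r \in (`[0 : R, 1]%classic : set R).
Proof.
rewrite inE/= in_itv/= /clamp_val le_max lexx/= ge_max ler01/=.
by rewrite ge_min lexx.
Qed.

(* The retraction of R onto [0, 1]. *)
Definition clamp r : unit_interval :=
  @exist _ (fun x => x \in (`[0 : R, 1]%classic : set R)) _ (clamp_subproof r).

Lemma val_clamp r : ui_val (clamp r) = clamp_val r. Proof. by []. Qed.

Lemma ui_itv t : 0 <= ui_val t <= 1.
Proof. by have := valP t; rewrite inE/= in_itv. Qed.

Lemma val_clampE r : 0 <= r <= 1 -> ui_val (clamp r) = r.
Proof.
by case/andP=> r0 r1; rewrite val_clamp /clamp_val min_r// max_r.
Qed.

Lemma clampK t : clamp (ui_val t) = t.
Proof. by apply: ui_inj; rewrite val_clampE ?ui_itv. Qed.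

Lemma ui_neq01 : clamp 0 != clamp 1.
Proof.
apply/eqP => /(congr1 ui_val); rewrite !val_clampE ?lexx ?ler01//.
by move/eqP; rewrite eq_sym oner_eq0.
Qed.

HB.instance Definition _ := isBiPointed.Build unit_interval ui_neq01.

Lemma val_zero : ui_val (zero : unit_interval) = 0.
Proof. by rewrite val_clampE// lexx ler01. Qed.

Lemma val_one : ui_val (one : unit_interval) = 1.
Proof. by rewrite val_clampE// lexx ler01. Qed.

Lemma clamp_le0 r : r <= 0 -> clamp r = zero.
Proof.
move=> r0; apply: ui_inj; rewrite val_zero val_clamp /clamp_val.
by rewrite max_l// ge_min r0 orbT.
Qed.

Lemma clamp_ge1 r : 1 <= r -> clamp r = one.
Proof.
move=> r1; apply: ui_inj; rewrite val_one val_clamp /clamp_val.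
by rewrite min_l// max_r.
Qed.

Lemma continuous_ui_val : continuous ui_val.
Proof. exact: initial_continuous. Qed.

Lemma continuous_clamp (Y : topologicalType) (u : Y -> R) :
  continuous u -> continuous (fun y => clamp (u y)).
Proof.
move=> cu; apply: (continuous_comp_initial (w := set_val)).
move=> y; rewrite /comp /=.
apply: (@continuous_max R Y (fun=> 0) (fun y => Num.min 1 (u y))).
  exact: cvg_cst.
apply: (@continuous_min R Y (fun=> 1) u); first exact: cvg_cst.
exact: cu.
Qed.

Lemma continuous_affine (Y : topologicalType) (u : Y -> R) (a b : R) :
  continuous u -> continuous (fun y => a * u y + b).
Proof.
move=> cu y; apply: cvgD; last exact: cvg_cst.
by apply: cvgM; [exact: cvg_cst|exact: cu].
Qed.

Lemma continuous_scale (Y : topologicalType) (u : Y -> R) (a : R) :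
  continuous u -> continuous (fun y => a * u y).
Proof. by move=> cu y; apply: cvgM; [exact: cvg_cst|exact: cu]. Qed.

Lemma continuous_onem (Y : topologicalType) (u : Y -> R) :
  continuous u -> continuous (fun y => 1 - u y).
Proof. by move=> cu y; apply: cvgB; [exact: cvg_cst|exact: cu]. Qed.

Lemma continuous_glue (Y Z : topologicalType) (u : Y -> R) (f g : Y -> Z) :
    continuous u -> continuous f -> continuous g ->
    (forall y, u y = 2^-1 -> f y = g y) ->
  continuous (fun y => if u y <= 2^-1 then f y else g y).
Proof.
move=> cu cf cg fg; apply/continuous_subspace_setT.
have -> : [set: Y] =
    (u @^-1` [set r | r <= 2^-1]) `|` (u @^-1` [set r | 2^-1 <= r]).
  apply/esym; rewrite -subTset => y _ /=.
  by have [h|/ltW h] := leP (u y) 2^-1; [left|right].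
apply: withinU_continuous.
- by apply: preimage_closed.
- by apply: preimage_closed.
- apply: (@subspace_eq_continuous _ _ _ f); last exact: continuous_subspaceT.
  by move=> y; rewrite inE/= => h; rewrite /from_subspace h.
- apply: (@subspace_eq_continuous _ _ _ g); last exact: continuous_subspaceT.
  move=> y; rewrite inE/= => h; rewrite /from_subspace; case: ifPn => // h'.
  by apply/esym/fg/eqP; rewrite eq_le h h'.
Qed.

End unit_interval.
Arguments ui_val {R} t : simpl never.
Arguments clamp {R}.

Section homotopy.
Variables (R : realType) (T : topologicalType).
Local Notation I := (unit_interval R).
Implicit Types p q : I -> T.

(* Homotopy relative to the endpoints x and y; continuity of H forces p and q
   to be continuous. *)
Definition path_homotopic (x y : T) p q : Prop :=
  exists H : I * I -> T,
    [/\ continuous H,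
        (forall t, H (t, zero) = p t) /\ (forall t, H (t, one) = q t)
      & (forall s, H (zero, s) = x) /\ (forall s, H (one, s) = y)].

Lemma continuous_pairI (Z : topologicalType) (f : Z -> I) (g : Z -> I) :
  continuous f -> continuous g -> continuous (fun z => (f z, g z)).
Proof. by move=> cf cg z; exact: (cvg_pair (cf z) (cg z)). Qed.

Lemma continuous_val1 : continuous (fun y : I * I => ui_val y.1 : R).
Proof.
move=> y; apply: (@continuous_comp _ _ _ fst ui_val).
  exact: cvg_fst.
exact: continuous_ui_val.
Qed.

Lemma continuous_val2 : continuous (fun y : I * I => ui_val y.2 : R).
Proof.
move=> y; apply: (@continuous_comp _ _ _ snd ui_val).
  exact: cvg_snd.
exact: continuous_ui_val.
Qed.

Lemma continuous_after (Y Z W : topologicalType) (f : Y -> Z) (g : Z -> W) :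
  continuous f -> continuous g -> continuous (fun y => g (f y)).
Proof.
move=> cf cg y; apply: (@continuous_comp _ _ _ f g); [exact: cf|exact: cg].
Qed.

Lemma continuous_pathE x y (p : {path I from x to y}) : continuous (p : I -> T).
Proof. exact: cts_fun. Qed.

Lemma reparametrize_homotopic p (phi psi : I -> I) :
    continuous p -> continuous phi -> continuous psi ->
    phi zero = psi zero -> phi one = psi one ->
  path_homotopic (p (phi zero)) (p (phi one)) (p \o phi) (p \o psi).
Proof.
move=> cp cphi cpsi e0 e1.
exists (fun y => p (clamp ((1 - ui_val y.2) * ui_val (phi y.1)
                            + ui_val y.2 * ui_val (psi y.1)))); split.
- apply: continuous_after cp; apply: continuous_clamp => y.
  apply: cvgD; apply: cvgM.
  + apply: cvgB; first exact: cvg_cst.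
    exact: continuous_val2.
  + apply: (@continuous_after _ _ _ (fun y : I * I => phi y.1) ui_val).
      apply: (@continuous_after _ _ _ fst phi) => // z; exact: cvg_fst.
    exact: continuous_ui_val.
  + exact: continuous_val2.
  + apply: (@continuous_after _ _ _ (fun y : I * I => psi y.1) ui_val).
      apply: (@continuous_after _ _ _ fst psi) => // z; exact: cvg_fst.
    exact: continuous_ui_val.
- split=> t /=.
  + by rewrite val_zero subr0 mul1r mul0r addr0 clampK.
  + by rewrite val_one subrr mul0r mul1r add0r clampK.
- by split=> t /=; rewrite -?e0 -?e1 -mulrDl subrK mul1r clampK.
Qed.

Lemma path_homotopic_refl x y (p : {path I from x to y}) :
  path_homotopic x y p p.
Proof.
have := @reparametrize_homotopic p id id (@continuous_pathE _ _ p).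
by rewrite /= path_zero path_one; apply=> // z; exact: cvg_id.
Qed.

Lemma path_homotopic_sym x y p q :
  path_homotopic x y p q -> path_homotopic x y q p.
Proof.
case=> H [cH [H0 H1] [Hx Hy]].
exists (fun y => H (y.1, clamp ((- 1) * ui_val y.2 + 1))); split.
- apply: (@continuous_after _ _ _ _ H) cH; apply: continuous_pairI.
    by move=> z; exact: cvg_fst.
  by apply: continuous_clamp; apply: continuous_affine; exact: continuous_val2.
- split=> t /=.
  + by rewrite val_zero mulr0 add0r clamp_ge1.
  + by rewrite val_one mulr1 addNr clamp_le0.
- by split=> t /=.
Qed.

Lemma path_homotopic_trans x y p q r :
  path_homotopic x y p q -> path_homotopic x y q r -> path_homotopic x y p r.
Proof.
case=> H [cH [H0 H1] [Hx Hy]] [K [cK [K0 K1] [Kx Ky]]].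
exists (fun y => if ui_val y.2 <= 2^-1 then H (y.1, clamp (2 * ui_val y.2 + 0))
                 else K (y.1, clamp (2 * ui_val y.2 + -1))); split.
- apply: (@continuous_glue R _ _ (fun y : I * I => ui_val y.2)).
  + exact: continuous_val2.
  + apply: (@continuous_after _ _ _ _ H) cH; apply: continuous_pairI.
      by move=> z; exact: cvg_fst.
    by apply: continuous_clamp; apply: continuous_affine; exact: continuous_val2.
  + apply: (@continuous_after _ _ _ _ K) cK; apply: continuous_pairI.
      by move=> z; exact: cvg_fst.
    by apply: continuous_clamp; apply: continuous_affine; exact: continuous_val2.
  + move=> [t s] /= ->; rewrite clamp_ge1 ?clamp_le0 ?K0 ?H1//; lra.
- split=> t /=.
  + by rewrite val_zero invr_ge0 ler0n mulr0 addr0 clamp_le0.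
  + rewrite val_one ifF; last by apply/negbTE; rewrite -ltNge; lra.
    by rewrite clamp_ge1 ?K1//; lra.
- by split=> t /=; case: ifP.
Qed.

Definition concat_fun p q (t : I) : T :=
  if ui_val t <= 2^-1 then p (clamp (2 * ui_val t))
  else q (clamp (2 * ui_val t - 1)).

Definition reverse_fun p (t : I) : T := p (clamp (1 - ui_val t)).

Section concat.
Variables (x y z : T) (p : {path I from x to y}) (q : {path I from y to z}).

Lemma concat_continuous : continuous (concat_fun p q).
Proof.
apply: continuous_glue.
- exact: continuous_ui_val.
- apply: (@continuous_after _ _ _ _ p) (@continuous_pathE _ _ p).
  by apply: continuous_clamp; apply: continuous_scale; exact: continuous_ui_val.
- apply: (@continuous_after _ _ _ _ q) (@continuous_pathE _ _ q).
  by apply: continuous_clamp; apply: continuous_affine; exact: continuous_ui_val.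
- move=> t ->; rewrite clamp_ge1 ?clamp_le0 ?path_zero ?path_one//; lra.
Qed.

Lemma concat_zero : concat_fun p q zero = x.
Proof.
by rewrite /concat_fun val_zero invr_ge0 ler0n mulr0 clamp_le0// path_zero.
Qed.

Lemma concat_one : concat_fun p q one = z.
Proof.
rewrite /concat_fun val_one; rewrite ifF; last by apply/negbTE; rewrite -ltNge; lra.
by rewrite clamp_ge1 ?path_one//; lra.
Qed.

HB.instance Definition _ :=
  isContinuous.Build I T (concat_fun p q) concat_continuous.
HB.instance Definition _ :=
  isPath.Build I T x z (concat_fun p q) concat_zero concat_one.

Definition concat : {path I from x to z} := concat_fun p q.

Lemma reverse_continuous : continuous (reverse_fun p).
Proof.
apply: (@continuous_after _ _ _ _ p) (@continuous_pathE _ _ p).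
by apply: continuous_clamp; apply: continuous_onem; exact: continuous_ui_val.
Qed.

Lemma reverse_zero : reverse_fun p zero = y.
Proof. by rewrite /reverse_fun val_zero subr0 clamp_ge1// path_one. Qed.

Lemma reverse_one : reverse_fun p one = x.
Proof. by rewrite /reverse_fun val_one subrr clamp_le0// path_zero. Qed.

HB.instance Definition _ :=
  isContinuous.Build I T (reverse_fun p) reverse_continuous.
HB.instance Definition _ :=
  isPath.Build I T y x (reverse_fun p) reverse_zero reverse_one.

Definition reverse : {path I from y to x} := reverse_fun p.

End concat.

Definition constant_path (x : T) : {path I from x to x} := cst x.

Lemma concat_homotopic x y z (p p' : {path I from x to y})
    (q q' : {path I from y to z}) :
  path_homotopic x y p p' -> path_homotopic y z q q' ->
  path_homotopic x z (concat p q) (concat p' q').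
Proof.
case=> H [cH [H0 H1] [Hx Hy]] [K [cK [K0 K1] [Kx Ky]]].
exists (fun y => if ui_val y.1 <= 2^-1 then H (clamp (2 * ui_val y.1 + 0), y.2)
                 else K (clamp (2 * ui_val y.1 + -1), y.2)); split.
- apply: (@continuous_glue R _ _ (fun y : I * I => ui_val y.1)).
  + exact: continuous_val1.
  + apply: (@continuous_after _ _ _ _ H) cH; apply: continuous_pairI.
      by apply: continuous_clamp; apply: continuous_affine; exact: continuous_val1.
    by move=> w; exact: cvg_snd.
  + apply: (@continuous_after _ _ _ _ K) cK; apply: continuous_pairI.
      by apply: continuous_clamp; apply: continuous_affine; exact: continuous_val1.
    by move=> w; exact: cvg_snd.
  + move=> [t s] /= ->; rewrite clamp_ge1 ?clamp_le0 ?Kx ?Hy//; lra.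
- by split=> t /=; rewrite /concat_fun addr0 ?H0 ?K0 ?H1 ?K1.
- split=> t /=.
  + by rewrite val_zero invr_ge0 ler0n mulr0 addr0 clamp_le0.
  + rewrite val_one; rewrite ifF; last by apply/negbTE; rewrite -ltNge; lra.
    by rewrite clamp_ge1//; lra.
Qed.

Lemma reverse_homotopic x y (p p' : {path I from x to y}) :
  path_homotopic x y p p' -> path_homotopic y x (reverse p) (reverse p').
Proof.
case=> H [cH [H0 H1] [Hx Hy]].
exists (fun y => H (clamp ((- 1) * ui_val y.1 + 1), y.2)); split.
- apply: (@continuous_after _ _ _ _ H) cH; apply: continuous_pairI.
    by apply: continuous_clamp; apply: continuous_affine; exact: continuous_val1.
  by move=> w; exact: cvg_snd.
- by split=> t /=; rewrite /reverse_fun mulN1r addrC ?H0 ?H1.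
- split=> t /=.
  + by rewrite val_zero mulr0 add0r clamp_ge1.
  + by rewrite val_one mulr1 addNr clamp_le0.
Qed.

Lemma reparametrize_path x y a b (p : {path I from x to y}) (phi psi : I -> I)
    (f g : I -> T) :
    continuous phi -> continuous psi ->
    phi zero = psi zero -> phi one = psi one ->
    p (phi zero) = a -> p (phi one) = b ->
    f =1 p \o phi -> g =1 p \o psi ->
  path_homotopic a b f g.
Proof.
move=> cphi cpsi e0 e1 <- <- /funext -> /funext ->.
exact: reparametrize_homotopic (@continuous_pathE _ _ p) _ _ _ _.
Qed.

Lemma continuous_idI : continuous (fun t : I => t).
Proof. by move=> t; exact: cvg_id. Qed.

Lemma concat1p x y (p : {path I from x to y}) :
  path_homotopic x y (concat (constant_path x) p) p.
Proof.
apply: (@reparametrize_path x y _ _ p (fun t => clamp (2 * ui_val t + -1)) id) => //.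
- by apply: continuous_clamp; apply: continuous_affine; exact: continuous_ui_val.
- exact: continuous_idI.
- by rewrite val_zero clamp_le0//; lra.
- by rewrite val_one clamp_ge1//; lra.
- by rewrite val_zero clamp_le0 ?path_zero//; lra.
- by rewrite val_one clamp_ge1 ?path_one//; lra.
- move=> t /=; rewrite /concat_fun; case: ifPn => // h.
  by rewrite (@clamp_le0 _ (2 * ui_val t + -1)) ?path_zero//; lra.
Qed.

Lemma concatp1 x y (p : {path I from x to y}) :
  path_homotopic x y (concat p (constant_path y)) p.
Proof.
apply: (@reparametrize_path x y _ _ p (fun t => clamp (2 * ui_val t + 0)) id) => //.
- by apply: continuous_clamp; apply: continuous_affine; exact: continuous_ui_val.
- exact: continuous_idI.
- by rewrite val_zero clamp_le0//; lra.
- by rewrite val_one clamp_ge1//; lra.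
- by rewrite val_zero clamp_le0 ?path_zero//; lra.
- by rewrite val_one clamp_ge1 ?path_one//; lra.
- move=> t /=; rewrite /concat_fun; case: ifPn => h; first by rewrite addr0.
  rewrite (@clamp_ge1 _ (2 * ui_val t + 0)) ?path_one//; move: h; rewrite -ltNge; lra.
Qed.

Lemma concatpV x y (p : {path I from x to y}) :
  path_homotopic x x (concat p (reverse p)) (constant_path x).
Proof.
apply: (@reparametrize_path x y _ _ p
  (fun t => clamp (Num.min (2 * ui_val t + 0) (- 2 * ui_val t + 2))) (fun=> zero)).
- apply: continuous_clamp => t; apply: (@continuous_min R I);
  by apply: continuous_affine; exact: continuous_ui_val.
- exact: cst_continuous.
- by rewrite val_zero clamp_le0// ge_min; apply/orP; left; lra.
- by rewrite val_one clamp_le0// ge_min; apply/orP; right; lra.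
- by rewrite val_zero clamp_le0 ?path_zero// ge_min; apply/orP; left; lra.
- by rewrite val_one clamp_le0 ?path_zero// ge_min; apply/orP; right; lra.
- move=> t /=; rewrite /concat_fun /reverse_fun; case: ifPn => h.
    by rewrite min_l ?addr0//; lra.
  have /andP[t0 t1] := ui_itv t; rewrite -ltNge in h.
  rewrite min_r ?val_clampE//; [|by apply/andP; split; lra|lra].
  by congr (p (clamp _)); lra.
- by move=> t /=; rewrite path_zero.
Qed.

Lemma concatVp x y (p : {path I from x to y}) :
  path_homotopic y y (concat (reverse p) p) (constant_path y).
Proof.
apply: (@reparametrize_path x y _ _ p
  (fun t => clamp (Num.max (- 2 * ui_val t + 1) (2 * ui_val t + -1))) (fun=> one)).
- apply: continuous_clamp => t; apply: (@continuous_max R I);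
  by apply: continuous_affine; exact: continuous_ui_val.
- exact: cst_continuous.
- by rewrite val_zero clamp_ge1// le_max; apply/orP; left; lra.
- by rewrite val_one clamp_ge1// le_max; apply/orP; right; lra.
- by rewrite val_zero clamp_ge1 ?path_one// le_max; apply/orP; left; lra.
- by rewrite val_one clamp_ge1 ?path_one// le_max; apply/orP; right; lra.
- move=> t /=; rewrite /concat_fun /reverse_fun.
  have /andP[t0 t1] := ui_itv t; case: ifPn => h.
    rewrite max_l ?val_clampE//; [|by apply/andP; split; lra|lra].
    by congr (p (clamp _)); lra.
  rewrite -ltNge in h.
  by rewrite max_r//; lra.
- by move=> t /=; rewrite path_one.
Qed.

Lemma concatA x y z w (p : {path I from x to y}) (q : {path I from y to z})
    (r : {path I from z to w}) :
  path_homotopic x w (concat p (concat q r)) (concat (concat p q) r).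
Proof.
apply: path_homotopic_sym.
apply: (@reparametrize_path x w _ _ (concat p (concat q r))
  (fun t => clamp (Num.min (2 * ui_val t + 0)
                     (Num.min (1 * ui_val t + 4^-1) (2^-1 * ui_val t + 2^-1)))) id) => //.
- apply: continuous_clamp => t; apply: (@continuous_min R I).
    by apply: continuous_affine; exact: continuous_ui_val.
  apply: (@continuous_min R I);
    by apply: continuous_affine; exact: continuous_ui_val.
- exact: continuous_idI.
- by rewrite val_zero clamp_le0// ge_min; apply/orP; left; lra.
- rewrite val_one clamp_ge1// !le_min; apply/and3P; split; lra.
- by rewrite val_zero clamp_le0 ?path_zero// ge_min; apply/orP; left; lra.
- rewrite val_one clamp_ge1 ?path_one// !le_min; apply/and3P; split; lra.
move=> t; have /andP[t0 t1] := ui_itv t; rewrite /= /concat_fun.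
have [h|h] := leP (ui_val t) 2^-1.
  rewrite (val_clampE (r := 2 * ui_val t)); last by apply/andP; split; lra.
  have [k|k] := leP (2 * ui_val t) 2^-1.
    have -> : Num.min (2 * ui_val t + 0) (Num.min (1 * ui_val t + 4^-1)
        (2^-1 * ui_val t + 2^-1)) = 2 * ui_val t.
      by rewrite min_l ?addr0// le_min; apply/andP; split; lra.
    by rewrite val_clampE ?k//; apply/andP; split; lra.
  have -> : Num.min (2 * ui_val t + 0) (Num.min (1 * ui_val t + 4^-1)
      (2^-1 * ui_val t + 2^-1)) = ui_val t + 4^-1.
    rewrite (min_l (y := 2^-1 * ui_val t + 2^-1)); last lra.
    by rewrite mul1r min_r//; lra.
  rewrite val_clampE; last by apply/andP; split; lra.
  case: ifPn => [k'|_]; first by exfalso; lra.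
  rewrite val_clampE; last by apply/andP; split; lra.
  case: ifPn => [_|/negP k']; last by exfalso; apply: k'; lra.
  by congr (q (clamp _)); lra.
have -> : Num.min (2 * ui_val t + 0) (Num.min (1 * ui_val t + 4^-1)
    (2^-1 * ui_val t + 2^-1)) = 2^-1 * ui_val t + 2^-1.
  rewrite (min_r (y := 2^-1 * ui_val t + 2^-1)); last lra.
  by rewrite min_r//; lra.
rewrite val_clampE; last by apply/andP; split; lra.
case: ifPn => [k'|_]; first by exfalso; lra.
rewrite val_clampE; last by apply/andP; split; lra.
case: ifPn => [k'|_]; first by exfalso; lra.
by congr (r (clamp _)); lra.
Qed.

End homotopy.

Section fundamental_group.
Variables (R : realType) (T : topologicalType) (x : T).
Local Notation loop := {path (unit_interval R) from x to x}.

Definition loop_homotopic (p q : loop) : bool := `[< path_homotopic x x p q >].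

Lemma loop_homotopic_equiv : equiv_class_of loop_homotopic.
Proof.
split.
- by move=> p; apply/asboolP/path_homotopic_refl.
- by move=> p q; apply: asbool_equiv_eq; split; exact: path_homotopic_sym.
- move=> q p r /asboolP pq /asboolP qr; apply/asboolP.
  exact: path_homotopic_trans pq qr.
Qed.

Definition loop_equiv := EquivRelPack loop_homotopic_equiv.

Definition fundamental_group : Type := {eq_quot loop_equiv}.
HB.instance Definition _ := Choice.on fundamental_group.

Definition loop_class (p : loop) : fundamental_group :=
  \pi_{eq_quot loop_equiv} p.

Lemma loop_classP p q : loop_class p = loop_class q <-> path_homotopic x x p q.
Proof. by split=> [/eqmodP/asboolP|h]; last exact/eqmodP/asboolP. Qed.

Definition loop_repr (a : fundamental_group) : loop :=
  repr (a : {eq_quot loop_equiv}).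

Lemma loop_reprK a : loop_class (loop_repr a) = a.
Proof. exact: reprK. Qed.

Definition pi1_one : fundamental_group := loop_class (constant_path R x).
Definition pi1_mul (a b : fundamental_group) : fundamental_group :=
  loop_class (concat (loop_repr a) (loop_repr b)).
Definition pi1_inv (a : fundamental_group) : fundamental_group :=
  loop_class (reverse (loop_repr a)).

Lemma pi1_mulE p q :
  pi1_mul (loop_class p) (loop_class q) = loop_class (concat p q).
Proof.
by apply/loop_classP/concat_homotopic; apply/loop_classP; rewrite loop_reprK.
Qed.

Lemma pi1_invE p : pi1_inv (loop_class p) = loop_class (reverse p).
Proof.
by apply/loop_classP/reverse_homotopic; apply/loop_classP; rewrite loop_reprK.
Qed.

Lemma pi1_mulA : associative pi1_mul.
Proof.
move=> a b c; rewrite -(loop_reprK a) -(loop_reprK b) -(loop_reprK c) !pi1_mulE.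
exact/loop_classP/concatA.
Qed.

Lemma pi1_mul1 : left_id pi1_one pi1_mul.
Proof.
by move=> a; rewrite -(loop_reprK a) pi1_mulE; exact/loop_classP/concat1p.
Qed.

Lemma pi1_mulr1 : right_id pi1_one pi1_mul.
Proof.
by move=> a; rewrite -(loop_reprK a) pi1_mulE; exact/loop_classP/concatp1.
Qed.

Lemma pi1_mulV : left_inverse pi1_one pi1_inv pi1_mul.
Proof.
move=> a; rewrite -(loop_reprK a) pi1_invE pi1_mulE.
exact/loop_classP/concatVp.
Qed.

Lemma pi1_mulrV : right_inverse pi1_one pi1_inv pi1_mul.
Proof.
move=> a; rewrite -(loop_reprK a) pi1_invE pi1_mulE.
exact/loop_classP/concatpV.
Qed.

HB.instance Definition _ := isGroup.Build fundamental_group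
  pi1_mulA pi1_mul1 pi1_mulr1 pi1_mulV pi1_mulrV.

End fundamental_group.
Arguments fundamental_group R {T} x.

(* A multiplicative map between groups preserves 1 and inverses. *)
Definition group_isomorphic (G H : groupType) : Prop :=
  exists f : {multiplicative G -> H}, bijective f.

(* The topology of the norm of R[i]; the library only provides it on R[i]^o. *)
HB.instance Definition _ (R : realType) := PseudoPointedMetric.copy R[i] R[i]^o.

Section line_arrangement.
Variable R : realType.
Local Notation C2 := (R[i] * R[i])%type.
Implicit Types (H : set C2) (A : {fset set C2}) (z : C2).

Definition is_line H : Prop := exists a b c : R[i],
  (a, b) <> (0, 0) /\ H = [set z | a * z.1 + b * z.2 = c].

Definition line_arrangement A : Prop := forall H, H \in A -> is_line H.

Definition curve A : set C2 := \bigcup_(H in [set` A]) H.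

Definition complement A : set C2 := ~` curve A.

Definition multiplicity A z : nat := #|` [fset H in A | z \in H]%fset|.

End line_arrangement.

(* Main.v *)
Require Import Defs.
From HB Require Import structures.
From mathcomp Require Import all_boot all_order all_algebra.
From mathcomp Require Import complex finmap ring lra.
From mathcomp Require Import boolp classical_sets functions cardinality.
From mathcomp Require Import set_interval reals topology normedtype homotopy.

(** The theorem compares two ways of counting intersection points through the
    fundamental group.  For an arrangement A with complement M, let a_H(g) be
    the winding number of the loop g about the line H.  A commuting pair g, h
    in the fundamental group G of M gives the antisymmetric form
      X(H, H') = a_H(g) a_H'(h) - a_H(h) a_H'(g),
    the value of the cup products of the classes a_H on the torus spanned by g
    and h.  The span of these forms has dimension b2(A), the sum over the
    intersection points of the multiplicity minus one.

    Upper bound.  X(H, H') vanishes when H and H' are parallel, and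
    X(H, H') = X(H, H'') + X(H'', H') when the three lines are concurrent.
    Both follow from the vanishing of one cup product on the plane punctured at
    0 and 1 ([winding_commute]), which is proved with a transport in the
    Heisenberg group ([commuting_relation], [commute_parallel],
    [commute_concurrent]).  So X is determined by the b2(A) coordinates (H, H')
    in which H' is the line of least rank through the intersection point
    ([basic_pairs], [basic_determine]).

    Lower bound.  Around an intersection point there are explicit tori
    ([torus]) whose forms are dual to these coordinates, and in a product of
    two groups the loops of one factor commute with the loops of the other.

    To compare the groups of an abstract isomorphism one must know that the
    winding numbers span all the homomorphisms from G to a field
    ([hom_decomposition]).  Such a homomorphism is turned into an additive
    cocycle on the pairs of points joined by a segment in M, and the cocycle is
    decomposed by convexity arguments: it has a potential on the points from
    which the ray in a fixed generic direction misses the lines, and it jumps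
    by the value of the meridian of H when the cut of H is crossed
    ([cocycle_decomposition]).

    The two bounds give b2(A1) + b2(A2) + |A1| |A2| <= b2(A1 u A2)
    ([rank_inequality]).  Ranking the lines of A1 before the others, each basic
    pair of the union is a basic pair of A1, a basic pair of A2, or consists of
    a line of A2 and a line of A1; so equality holds, every pair in A2 x A1 is
    basic, and this forces each such pair to meet in a double point
    ([basic_pairs_split], [transversal]).  Winding numbers and all other
    topological invariants are holonomies of local cocycles along paths, which
    replaces the theory of coverings. *)

Set Implicit Arguments.
Unset Strict Implicit.
Unset Printing Implicit Defensive.

Import Order.TTheory GRing.Theory Num.Theory.
Import numFieldNormedType.Exports.

Local Open Scope classical_set_scope.
Local Open Scope ring_scope.

(** * Continuity of complex-valued maps *)

Section ContinuousOperations.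
Variable R : realType.
Local Notation C := R[i].
Variable Y : topologicalType.

Lemma continuousR_add (f g : Y -> R) : continuous f -> continuous g ->
  continuous (fun y => f y + g y).
Proof. by move=> cf cg y; apply: cvgD; [exact: cf|exact: cg]. Qed.
Lemma continuousR_mul (f g : Y -> R) : continuous f -> continuous g ->
  continuous (fun y => f y * g y).
Proof. by move=> cf cg y; apply: cvgM; [exact: cf|exact: cg]. Qed.
Lemma continuousC_add (f g : Y -> C) : continuous f -> continuous g ->
  continuous (fun y => f y + g y).
Proof. move=> cf cg y; exact: (@cvgD C C^o _ _ _ _ _ _ _ (cf y) (cg y)). Qed.
Lemma continuousC_mul (f g : Y -> C) : continuous f -> continuous g ->
  continuous (fun y => f y * g y).
Proof. move=> cf cg y. exact: (@cvgM C _ _ _ _ _ _ _ (cf y) (cg y)). Qed.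
Lemma continuousC_inv (f : Y -> C) : continuous f -> (forall y, f y != 0) ->
  continuous (fun y => (f y)^-1).
Proof. move=> cf f0 y. exact: (@cvgV C _ _ _ _ _ (f0 y) (cf y)). Qed.
Lemma continuous_identity : continuous (fun y : Y => y).
Proof. by move=> y; exact: cvg_id. Qed.
Lemma continuous_paired (Z W : topologicalType) (f : Y -> Z) (g : Y -> W) :
  continuous f -> continuous g -> continuous (fun y => (f y, g y)).
Proof. by move=> cf cg y; exact: (cvg_pair (cf y) (cg y)). Qed.

End ContinuousOperations.

Section ComplexContinuity.
Variable R : realType.
Local Notation C := R[i].

Lemma continuous_Re : continuous (@complex.Re R : C -> R).
Proof.
move=> z; apply: (proj2 (@cvgrPdist_lt R R C _ (nbhs_filter z) _ _)) => e e0.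
apply: (proj2 (nbhs_ballP z _)); exists (e%:C)%C; first by rewrite /= ltcR.
move=> w h.
have : (`|complex.Re (z - w)|%:C < e%:C)%C.
  apply: le_lt_trans (normc_ge_Re _) _; exact: h.
by rewrite ltcR; case: (z) (w) => [a b] [c d].
Qed.
Lemma continuous_of_real : continuous (fun r : R => r%:C%C).
Proof.
move=> r; apply/(@cvg_ballP C C) => e.
case: e => a b; rewrite ltcE /= => /andP[/eqP -> a0].
have : nbhs r (ball r a) by apply: nbhsx_ballx.
apply: filterS => s h. rewrite /ball /= /ball_ /=.
have -> : (r%:C - s%:C = (r - s)%:C)%C by rewrite rmorphB.
rewrite normc_def /= expr0n addr0 sqrtr_sqr. rewrite ltcR. exact: h.
Qed.

Lemma continuous_Im : continuous (@complex.Im R : C -> R).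
Proof.
have -> : @complex.Im R = (fun z : C => complex.Re (- 'i%C * z)).
  by apply/funext => -[a b] /=; rewrite oppr0 mul0r mulN1r sub0r opprK.
move=> z; apply: (@continuous_comp _ _ _ (fun z : C => - 'i%C * z)); last exact: continuous_Re.
by apply: (@continuousC_mul R C (fun=> - 'i%C) id); [exact: cst_continuous|move=> ?; exact: cvg_id].
Qed.

Variable Y : topologicalType.
Lemma continuous_Re_after (f : Y -> C) : continuous f -> continuous (fun y => complex.Re (f y)).
Proof. by move=> cf; apply: continuous_after cf continuous_Re. Qed.
Lemma continuous_Complex (f g : Y -> R) : continuous f -> continuous g ->
  continuous (fun y => (f y +i* g y)%C).
Proof.
move=> cf cg.
have -> : (fun y => (f y +i* g y)%C) = (fun y => (f y)%:C%C + 'i%C * (g y)%:C%C).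
  by apply/funext => y; rewrite [LHS]complexE.
apply: continuousC_add; first by apply: continuous_after cf continuous_of_real.
by apply: continuousC_mul; [exact: cst_continuous|apply: continuous_after cg continuous_of_real].
Qed.
End ComplexContinuity.

(** * Induction along the unit interval *)

Section UnitInterval.
Variable R : realType.
Local Notation I := (unit_interval R).

Lemma clamp_continuous : continuous (@clamp R).
Proof. by apply: continuous_clamp => z; exact: cvg_id. Qed.

Lemma nbhs_ui_ball (t : I) (V : set I) : nbhs t V ->
  exists2 e : R, 0 < e & forall s : I, `|ui_val t - ui_val s| < e -> V s.
Proof.
move=> Vt; have : nbhs (ui_val t) (clamp @^-1` V).
  by apply: clamp_continuous; rewrite clampK.
move/nbhs_ballP => [e /= e0 h]; exists e => // s sh.
by rewrite -(clampK s); apply: h.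
Qed.

Lemma nbhs_ui (t : I) (e : R) : 0 < e -> nbhs t [set s : I | `|ui_val t - ui_val s| < e].
Proof.
move=> e0; apply: (@continuous_ui_val R t [set r | `|ui_val t - r| < e]).
exact: nbhsx_ballx.
Qed.

(** Connectedness of the interval in the form of an induction principle, so that
    local-to-global arguments along a path need no subdivision. *)
Lemma unit_interval_ind (P : I -> Prop) : P zero ->
  (forall t : I, exists2 V : set I, nbhs t V & forall s s', V s -> V s' -> P s -> P s') ->
  forall t, P t.
Proof.
move=> P0 loc.
pose B := [set r : R | P (clamp r)].
have oB (Q : I -> Prop) : (forall t : I, exists2 V : set I, nbhs t V & forall s s', V s ->
  V s' -> Q s -> Q s') ->
    open [set r : R | Q (clamp r)].
  move=> locQ; rewrite openE => r /= Qr; rewrite /interior.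
  have [V Vr h] := locQ (clamp r).
  have := @clamp_continuous r V Vr; apply: filterS => s Vs.
  by apply: (h (clamp r)) => //; exact: nbhs_singleton.
have eB : `[0:R,1]%classic `&` B = `[0:R,1]%classic.
  apply: (@segment_connected R 0 1).
  - by exists 0; split; rewrite /= ?in_itv /= ?lexx ?ler01.
  - by exists B => //; exact: oB.
  - exists B => //; rewrite -(setCK B); apply: open_closedC.
    apply: (oB (fun t => ~ P t)) => t.
    by have [V Vt h] := loc t; exists V => // s s' Vs Vs' nP Ps'; apply: nP; exact: h Ps'.
move=> t; rewrite -(clampK t).
have : `[0:R,1]%classic (ui_val t) by rewrite /= in_itv /=; exact: ui_itv.
by rewrite -eB => -[].
Qed.
End UnitInterval.

(** * Parallel transport of local cocycles *)

Section Transport.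
Variables (R : realType) (X : topologicalType) (N : Type).
Local Notation I := (unit_interval R).
Variable c : X -> X -> N -> N.

(** A transport carries values from x to y for x and y close together.  Only its
    germ along the diagonal matters: c is a total function, arbitrary far away. *)
Definition cocycle_at (x : X) : Prop := exists2 V : set X, nbhs x V &
  (forall y n, V y -> c y y n = n) /\
  (forall y y' y'' n, V y -> V y' -> V y'' -> c y' y'' (c y y' n) = c y y'' n).

Definition parallel_at (p : I -> X) (u : I -> N) (t : I) : Prop :=
  exists2 V : set I, nbhs t V &
    forall s s', V s -> V s' -> u s' = c (p s) (p s') (u s).

Definition parallel p u := forall t, parallel_at p u t.

Lemma parallel_unique p u w : parallel p u -> parallel p w ->
  u zero = w zero -> forall t, u t = w t.
Proof.
move=> pu pw uw0; apply: unit_interval_ind => // t.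
have [V Vt hV] := pu t; have [W Wt hW] := pw t.
exists (V `&` W); first exact: filterI.
move=> s s' [Vs Ws] [Vs' Ws'] us; rewrite (hV s s')// (hW s s')//.
by rewrite us.
Qed.

(** Near a point where c is a cocycle, a section u given up to time s continues
    as the map sending r to c (p s) (p r) (u s); hence the property of having a
    section up to time t spreads, and [unit_interval_ind] applies. *)
Lemma parallel_exists p n : continuous p -> (forall t, cocycle_at (p t)) ->
  exists u, parallel p u /\ u zero = n.
Proof.
move=> cp coc.
pose P (t : I) := exists u : I -> N, u zero = n /\ forall s : I, ui_val s <= ui_val t ->
  exists2 V : set I, nbhs s V & forall r r', V r -> V r' ->
    ui_val r <= ui_val t -> ui_val r' <= ui_val t -> u r' = c (p r) (p r') (u r).
suff /(_ one) [u [u0 hu]] : forall t, P t.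
  exists u; split=> // t; have [|V Vt hV] := hu t.
    by rewrite val_one; case/andP: (ui_itv t).
  exists V => // s s' Vs Vs'; apply: hV => //; rewrite val_one.
    by case/andP: (ui_itv s).
  by case/andP: (ui_itv s').
apply: unit_interval_ind.
  exists (fun=> n); split=> // s s0.
  exists setT; first exact: filterT.
  have eq0 (r : I) : ui_val r <= ui_val (zero : I) -> r = zero.
    rewrite val_zero => r0; apply: ui_inj; rewrite val_zero; apply/eqP.
    by rewrite eq_le r0; case/andP: (ui_itv r).
  move=> r r' _ _ /eq0 -> /eq0 ->.
  by have [V /nbhs_singleton V0 [h _]] := coc zero; rewrite h.
move=> t; have [V Vt [Vid Vcoc]] := coc t.
have [e e0 he] := nbhs_ui_ball (cp t V Vt).
exists [set s : I | `|ui_val t - ui_val s| < e]; first exact: nbhs_ui.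
move=> s s' /= es es' [u [u0 hu]].
have [les|lts] := leP (ui_val s') (ui_val s).
  exists u; split=> // r rs'; have [|W Wr hW] := hu r; first exact: le_trans les.
  by exists W => // r1 r2 W1 W2 h1 h2; apply: hW => //; exact: le_trans les.
have inV (r : I) : ui_val s <= ui_val r -> ui_val r <= ui_val s' -> V (p r).
  move=> sr rs'; apply: he; move: es es'; rewrite !ltr_norml => /andP[? ?] /andP[? ?].
  by apply/andP; split; lra.
have Vs : V (p s) by apply: inV => //; exact: ltW.
exists (fun r => if ui_val r <= ui_val s then u r else c (p s) (p r) (u s)); split.
  by rewrite val_zero; case/andP: (ui_itv s) => ->.
move=> r rs'.
have [lt_rs|lt_sr|eq_rs] := ltgtP (ui_val r) (ui_val s).
- have [|W Wr hW] := hu r; first exact: ltW.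
  exists (W `&` [set q : I | `|ui_val r - ui_val q| < ui_val s - ui_val r]).
    by apply: filterI => //; apply: nbhs_ui; rewrite subr_gt0.
  have aux (q : I) : `|ui_val r - ui_val q| < ui_val s - ui_val r -> ui_val q <= ui_val s.
    by rewrite ltr_norml => /andP[? ?]; lra.
  move=> q q' [Wq /= /aux qs] [Wq' /= /aux qs'] _ _; rewrite qs qs'.
  exact: hW.
- exists [set q : I | `|ui_val r - ui_val q| < ui_val r - ui_val s].
    by apply: nbhs_ui; rewrite subr_gt0.
  have aux (q : I) : `|ui_val r - ui_val q| < ui_val r - ui_val s -> ui_val s < ui_val q.
    by rewrite ltr_norml => /andP[? ?]; lra.
  move=> q q' /= /aux qs /aux qs' qt qt'; rewrite !leNgt qs qs' /=.
  by rewrite Vcoc//; apply: inV => //; exact: ltW.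
- have -> : r = s by exact: ui_inj.
  have [|W Ws hW] := hu s; first exact: lexx.
  have nV : nbhs s [set q : I | `|ui_val t - ui_val q| < e].
    have -> : [set q : I | `|ui_val t - ui_val q| < e] =
      ui_val @^-1` (ball (ui_val t) e) by [].
    apply: continuous_ui_val; apply: open_nbhs_nbhs; split => //.
    exact: ball_open.
  exists (W `&` [set q : I | `|ui_val t - ui_val q| < e]).
    exact: filterI.
  move=> q q' [Wq /= eq] [Wq' /= eq'] _ _.
  have Vq := he _ eq; have Vq' := he _ eq'.
  have Wss : W s by exact: nbhs_singleton.
  have [qs|sq] := leP (ui_val q) (ui_val s);
    have [qs'|sq'] := leP (ui_val q') (ui_val s).
  + exact: hW.
  + by rewrite (hW q s)// Vcoc.
  + by rewrite Vcoc// (hW s q').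
  + by rewrite Vcoc.
Qed.

Definition holonomy (p : I -> X) (n : N) : N :=
  if pselect (exists m, exists u, [/\ parallel p u, u zero = n & u one = m])
    is left h then projT1 (cid h) else n.

Lemma holonomyE p u : parallel p u -> holonomy p (u zero) = u one.
Proof.
move=> pu; rewrite /holonomy; case: pselect => [h|[]]; last by exists (u one), u.
by case: (cid h) => m /= [w [pw w0 <-]]; exact: parallel_unique.
Qed.

Lemma holonomy_section p n : continuous p -> (forall t, cocycle_at (p t)) ->
  exists u, [/\ parallel p u, u zero = n & u one = holonomy p n].
Proof.
by move=> cp coc; have [u [pu u0]] := parallel_exists n cp coc; exists u;
  rewrite -(holonomyE pu) u0.
Qed.

Lemma parallel_at_comp p u (phi : I -> I) t : {for t, continuous phi} ->
  parallel_at p u (phi t) -> parallel_at (p \o phi) (u \o phi) t.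
Proof.
move=> cphi [V Vt hV]; exists (phi @^-1` V); first exact: cphi.
by move=> s s' Vs Vs' /=; exact: hV.
Qed.

Lemma parallel_at_ext p p' u u' (t : I) : (\forall s \near t, p s = p' s /\ u s = u' s) ->
  parallel_at p u t -> parallel_at p' u' t.
Proof.
move=> h [V Vt hV]; exists (V `&` [set s | p s = p' s /\ u s = u' s]).
  exact: filterI.
by move=> s s' [Vs [<- <-]] [Vs' [<- <-]]; exact: hV.
Qed.
End Transport.

Section TransportHomotopy.
Variables (R : realType) (X : topologicalType) (N : Type).
Local Notation I := (unit_interval R).
Variable c : X -> X -> N -> N.
Local Notation holonomy := (@holonomy R X N c).

Definition glue (u w : I -> N) (t : I) : N :=
  if ui_val t <= 2^-1 then u (clamp (2 * ui_val t))
  else w (clamp (2 * ui_val t - 1)).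

Lemma parallel_concat (p q : I -> X) (u w : I -> N) : p one = q zero -> u one = w zero ->
    cocycle_at c (p one) -> continuous p -> continuous q ->
    parallel c p u -> parallel c q w ->
  parallel c (concat_fun p q) (glue u w).
Proof.
move=> pq uw [V Vx [_ Vcoc]] cp cq pu qw t.
have c1 : continuous (fun t : I => clamp (2 * ui_val t) : I).
  by apply: continuous_clamp; apply: continuous_scale; exact: continuous_ui_val.
have c2 : continuous (fun t : I => clamp (2 * ui_val t - 1) : I).
  by apply: continuous_clamp; apply: continuous_affine; exact: continuous_ui_val.
have [lt|lt|eqt] := ltgtP (ui_val t) 2^-1.
- apply: parallel_at_ext (parallel_at_comp (@c1 t) (pu _)).
  apply: filterS (nbhs_ui t (_ : 0 < 2^-1 - ui_val t)); last by rewrite subr_gt0.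
  move=> s /=; rewrite ltr_norml /concat_fun /glue => /andP[? ?].
  by case: ifPn => // /negP []; lra.
- apply: parallel_at_ext (parallel_at_comp (@c2 t) (qw _)).
  apply: filterS (nbhs_ui t (_ : 0 < ui_val t - 2^-1)); last by rewrite subr_gt0.
  move=> s /=; rewrite ltr_norml /concat_fun /glue => /andP[? ?].
  by rewrite !ifF//; apply/negbTE; rewrite -ltNge; lra.
have e1 : clamp (2 * ui_val t) = one :> I by rewrite eqt clamp_ge1//; lra.
have e2 : clamp (2 * ui_val t - 1) = zero :> I by rewrite eqt clamp_le0//; lra.
have [V1 V1t h1] := pu one; have [V2 V2t h2] := qw zero.
have n1 : nbhs t [set s : I | V1 (clamp (2 * ui_val s)) /\ V (p (clamp (2 * ui_val s)))].
  have nn : nbhs (one : I) (V1 `&` p @^-1` V) by apply: filterI => //; exact: cp.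
  by rewrite -e1 in nn; exact: (c1 t _ nn).
have n2 : nbhs t [set s : I | V2 (clamp (2 * ui_val s - 1)) /\ V (q (clamp (2 * ui_val s - 1)))].
  have nn : nbhs (zero : I) (V2 `&` q @^-1` V).
    by apply: filterI => //; apply: cq; rewrite -pq.
  by rewrite -e2 in nn; exact: (c2 t _ nn).
have V11 : V1 one by exact: nbhs_singleton.
have V20 : V2 zero by exact: nbhs_singleton.
have Vp1 : V (p one) by exact: nbhs_singleton.
exists ([set s : I | V1 (clamp (2 * ui_val s)) /\ V (p (clamp (2 * ui_val s)))] `&`
  [set s : I | V2 (clamp (2 * ui_val s - 1)) /\ V (q (clamp (2 * ui_val s - 1)))]).
  exact: filterI.
move=> s s' [/= [s1 s2] [s3 s4]] [/= [s1' s2'] [s3' s4']]; rewrite /concat_fun /glue.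
case: ifP => _; case: ifP => _.
- exact: h1.
- by rewrite (h1 _ _ V11 s1') uw (h2 _ _ s3 V20) -pq Vcoc.
- by rewrite (h2 _ _ V20 s3') -uw (h1 _ _ s1 V11) -pq Vcoc.
- exact: h2.
Qed.

Lemma holonomy_concat p q n : p one = q zero -> continuous p -> continuous q ->
  (forall t, cocycle_at c (p t)) -> (forall t, cocycle_at c (q t)) ->
  holonomy (concat_fun p q) n = holonomy q (holonomy p n).
Proof.
move=> pq cp cq cocp cocq.
have [u [pu u0 u1]] := holonomy_section n cp cocp.
have [w [qw w0 w1]] := holonomy_section (holonomy p n) cq cocq.
have pc := parallel_concat pq (etrans u1 (esym w0)) (cocp one) cp cq pu qw.
have := holonomyE pc.
have -> : glue u w zero = n.
  by rewrite /glue val_zero invr_ge0 ler0n mulr0 clamp_le0.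
move=> ->; rewrite /glue val_one ifF; last by apply/negbTE; rewrite -ltNge; lra.
by rewrite clamp_ge1//; lra.
Qed.

Lemma unit_interval_compact : compact [set: I].
Proof.
have -> : [set: I] = clamp @` `[0:R,1]%classic.
  apply/seteqP; split=> // t _; exists (ui_val t); last exact: clampK.
  by rewrite /= in_itv /=; exact: ui_itv.
apply: continuous_compact; last exact: segment_compact.
by apply: continuous_subspaceT; exact: clamp_continuous.
Qed.

(** Carrying a section of one path of a homotopy across to a nearby path gives a
    section of the latter; by compactness of the interval, one neighbourhood of
    s0 serves for all times t. *)
Lemma parallel_nudge (H : I * I -> X) (s0 : I) : continuous H ->
    (forall t, cocycle_at c (H (t, s0))) ->
  \forall s \near s0, forall u, parallel c (fun t => H (t, s0)) u ->
    parallel c (fun t => H (t, s)) (fun t => c (H (t, s0)) (H (t, s)) (u t)).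
Proof.
move=> cH coc.
(* At time t the transports from path s0 to path s commute with the transports along the paths. *)
pose P (s t : I) := exists2 V : set I, nbhs t V & forall r r' n, V r -> V r' ->
  c (H (r', s0)) (H (r', s)) (c (H (r, s0)) (H (r', s0)) n) =
  c (H (r, s)) (H (r', s)) (c (H (r, s0)) (H (r, s)) n).
have : \forall s \near s0, [set: I] `<=` P s.
  apply: (proj1 (@compact_near_coveringP _ [set: I]) unit_interval_compact I (nbhs s0) P) => t _.
  have [V Vx [_ Vcoc]] := coc t.
  have [[T S] /= [Tt Ss] TS] := cH (t, s0) V Vx.
  exists (T°, S) => /=.
    by split=> //; apply: nbhs_interior.
  move=> [r s] /= [Tr Ss']; exists T => // r1 r2 n T1 T2.
  have S0 : S s0 by exact: nbhs_singleton.
  have h a b : T a -> S b -> V (H (a, b)) by move=> Ta Sb; exact: (TS (a, b)).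
  by rewrite !Vcoc//; exact: h.
apply: filterS => s hs u pu t.
have [V Vt hV] := hs t Logic.I; have [W Wt hW] := pu t.
exists (V `&` W); first exact: filterI.
by move=> r r' [Vr Wr] [Vr' Wr'] /=; rewrite -hV// -hW.
Qed.

(** By [parallel_nudge] the holonomy is locally constant along the homotopy: at
    the fixed ends the transport from one path to the next is the identity. *)
Lemma holonomy_fixed_ends (H : I * I -> X) x y n : continuous H ->
    (forall z, cocycle_at c (H z)) ->
    (forall s, H (zero, s) = x) -> (forall s, H (one, s) = y) ->
  holonomy (fun t => H (t, zero)) n = holonomy (fun t => H (t, one)) n.
Proof.
move=> cH coc H0 H1.
suff : forall s, holonomy (fun t => H (t, s)) n = holonomy (fun t => H (t, zero)) n by move->.
have cHs s : continuous (fun t => H (t, s)).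
  apply: continuous_after cH; apply: continuous_paired;
    [exact: continuous_identity|exact: cst_continuous].
apply: (@unit_interval_ind R (fun s => holonomy (fun t => H (t,
  s)) n = holonomy (fun t => H (t, zero)) n)) => // s0.
have nr := parallel_nudge cH (fun t => coc (t, s0)).
eexists; first exact: nr.
suff E s : (forall u, parallel c (fun t => H (t, s0)) u ->
    parallel c (fun t => H (t, s)) (fun t => c (H (t, s0)) (H (t, s)) (u t))) ->
    holonomy (fun t => H (t, s)) n = holonomy (fun t => H (t, s0)) n.
  by move=> s s' /= /E -> /E ->.
move=> hs.
have [u [pu u0 u1]] := holonomy_section n (cHs s0) (fun t => coc (t, s0)).
have := holonomyE (hs _ pu); rewrite /= !H0 !H1 u0 u1.
have [V /nbhs_singleton Vx [Vid _]] := coc (zero, s0).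
have [W /nbhs_singleton Wx [Wid _]] := coc (one, s0).
by rewrite H0 in Vx; rewrite H1 in Wx; rewrite Vid// Wid.
Qed.
End TransportHomotopy.

Section AdditiveTransport.
Variables (R : realType) (X : topologicalType) (N : zmodType).
Local Notation I := (unit_interval R).
Variable k : X -> X -> N.
(** The holonomy of 0 under these translations is the period of k along a path. *)
Definition translate (x y : X) (n : N) : N := n + k x y.

Lemma parallel_translate (p : I -> X) u m : parallel translate p u ->
  parallel translate p (fun t => m + u t).
Proof.
move=> pu t; have [V Vt hV] := pu t; exists V => // s s' Vs Vs'.
by rewrite (hV s s')// /translate addrA.
Qed.

Lemma holonomy_translate (p : I -> X) n : continuous p -> (forall t, cocycle_at translate (p t)) ->
  holonomy translate p n = n + holonomy translate p 0.
Proof.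
move=> cp coc; have [u [pu u0 u1]] := holonomy_section 0 cp coc.
by have := holonomyE (parallel_translate n pu); rewrite /= u0 u1 addr0.
Qed.

(** The two ends move together, so that the transports at the ends are the same
    element, and it cancels because the group is abelian. *)
Lemma holonomy_free_homotopy (H : I * I -> X) : continuous H ->
    (forall z, cocycle_at translate (H z)) ->
    (forall s, H (zero, s) = H (one, s)) ->
  holonomy translate (fun t => H (t, zero)) 0 = holonomy translate (fun t => H (t, one)) 0.
Proof.
move=> cH coc H01.
suff : forall s, holonomy translate (fun t => H (t,
  s)) 0 = holonomy translate (fun t => H (t, zero)) 0 by move->.
have cHs s : continuous (fun t => H (t, s)).
  apply: continuous_after cH; apply: continuous_paired;
    [exact: continuous_identity|exact: cst_continuous].
apply: (@unit_interval_ind R (fun s => holonomy translate (fun t => H (t, s)) 0 =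
  holonomy translate (fun t => H (t, zero)) 0)) => // s0.
have nr := parallel_nudge cH (fun t => coc (t, s0)).
eexists; first exact: nr.
suff E s : (forall u, parallel translate (fun t => H (t, s0)) u ->
    parallel translate (fun t => H (t, s)) (fun t => translate (H (t, s0)) (H (t, s)) (u t))) ->
    holonomy translate (fun t => H (t, s)) 0 = holonomy translate (fun t => H (t, s0)) 0.
  by move=> s s' /= /E -> /E ->.
move=> hs.
have [u [pu u0 u1]] := holonomy_section 0 (cHs s0) (fun t => coc (t, s0)).
have := holonomyE (hs _ pu); rewrite /= u0 u1 holonomy_translate// {1 3}/translate -H01 add0r addrC.
by rewrite (H01 s); move/addIr.
Qed.
End AdditiveTransport.

Section HolHomotopic.
Variables (R : realType) (X Y : topologicalType) (N : Type).
Local Notation I := (unit_interval R).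
Variable c : X -> X -> N -> N.

Lemma holonomy_homotopic (F : Y -> X) x y p q n : continuous F ->
    (forall z, cocycle_at c (F z)) -> @path_homotopic R Y x y p q ->
  holonomy c (F \o p) n = holonomy c (F \o q) n.
Proof.
move=> cF coc [H [cH [H0 H1] [Hx Hy]]].
have <- : (fun t => F (H (t, zero))) = F \o p by apply/funext => t /=; rewrite H0.
have <- : (fun t => F (H (t, one))) = F \o q by apply/funext => t /=; rewrite H1.
apply: (@holonomy_fixed_ends R X N c (F \o H) (F x) (F y)).
- exact: continuous_after cH cF.
- by move=> z; exact: coc.
- by move=> s /=; rewrite Hx.
- by move=> s /=; rewrite Hy.
Qed.

(** Both paths are images of paths of the square with the same ends, and the
    square is convex. *)
Lemma diag_homotopic (T : I * I -> Y) : continuous T ->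
  path_homotopic (T (zero, zero)) (T (one, one)) (fun t => T (t, t))
    (concat_fun (fun t => T (t, zero)) (fun t => T (one, t))).
Proof.
move=> cT.
exists (fun z => T (clamp ((1 - ui_val z.2) * ui_val z.1 + ui_val z.2 * (2 * ui_val z.1)),
  clamp ((1 - ui_val z.2) * ui_val z.1 + ui_val z.2 * (2 * ui_val z.1 + -1)))); split.
- apply: continuous_after cT; apply: continuous_paired; apply: continuous_clamp;
  (apply: continuousR_add; apply: continuousR_mul;
    [|exact: continuous_val1|exact: continuous_val2|];
   [by apply: continuous_onem; exact: continuous_val2|]).
    by apply: continuous_scale; exact: continuous_val1.
  by apply: continuous_affine; exact: continuous_val1.
- split=> t /=.
    by rewrite val_zero subr0 !mul1r !mul0r !addr0 clampK.
  rewrite val_one subrr !mul0r !mul1r !add0r /concat_fun; case: ifPn => h.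
    by congr (T (_, _)); apply: clamp_le0; lra.
  rewrite -ltNge in h.
  by congr (T (_, _)); apply: clamp_ge1; lra.
- split=> s /=; have /andP[s0 s1] := ui_itv s.
    by rewrite val_zero !mulr0 !add0r mulrN1 !clamp_le0// oppr_le0.
  by rewrite val_one; congr (T (_, _)); apply: clamp_ge1; lra.
Qed.
End HolHomotopic.

(** * Winding numbers *)

Section Winding.
Variables (R : realType) (K : fieldType).
Local Notation I := (unit_interval R).
Local Notation C := R[i].
Local Notation Re := (@complex.Re R).
Local Notation Im := (@complex.Im R).

(** The signed number of crossings of the cut along the negative real axis,
    counted positively from the upper to the lower side, between two nearby
    points. *)
Definition slit (z z' : C) : K :=
  if (Re z < 0) && (Re z' < 0) then (Im z' < 0)%R%:R - (Im z < 0)%R%:R else 0.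

(** For z nonzero, the open half-plane containing z which comes first among the
    upper, lower, right and left ones; so it meets the negative real axis only if z
    is on this axis. *)
Definition side (z w : C) : bool :=
  if 0 < Im z then 0 < Im w else if Im z < 0 then Im w < 0
  else if 0 < Re z then 0 < Re w else Re w < 0.

Lemma side_refl z : z != 0 -> side z z.
Proof.
rewrite /side => z0; case: ltgtP => // i0; case: ltgtP => // r0.
by move: z0; rewrite eq_complex /= -i0 r0 !eqxx.
Qed.

Lemma slitxx z : slit z z = 0.
Proof. by rewrite /slit subrr if_same. Qed.

(** On the upper, lower and right half-planes the crossing number is 0; on the
    left one it is the coboundary of the indicator of the lower side. *)
Lemma slit_side z w w' w'' : side z w -> side z w' -> side z w'' ->
  slit w w' + slit w' w'' = slit w w''.
Proof.
rewrite /side /slit; case: ifP => _.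
  by move=> h h' h''; rewrite !ltNge !(ltW h) !(ltW h') !(ltW h'') /= subrr !if_same addr0.
case: ifP => _; first by move=> -> -> ->; rewrite subrr !if_same addr0.
case: ifP => _; first by move=> h h' h''; rewrite !ltNge !(ltW h) !(ltW h') !(ltW h'') /= addr0.
move=> -> -> -> /=; ring.
Qed.

Lemma side_open z u : side z u -> nbhs u [set w | side z w].
Proof.
have oI : open [set r : R | 0 < r] by exact: open_gt.
have oI' : open [set r : R | r < 0] by exact: open_lt.
have nb (f : C -> R) (A : set R) : continuous f -> open A -> A (f u) -> nbhs u (f @^-1` A).
  by move=> cf oA Az; apply: cf; exact: open_nbhs_nbhs.
rewrite /side; case: (0 < Im z) => h; first exact: (nb _ _ (@continuous_Im R) oI).
case: (Im z < 0) h => h; first exact: (nb _ _ (@continuous_Im R) oI').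
case: (0 < Re z) h => h; first exact: (nb _ _ (@continuous_Re R) oI).
exact: (nb _ _ (@continuous_Re R) oI').
Qed.

Lemma nbhs_side z : z != 0 -> nbhs z [set w | side z w].
Proof. by move=> /side_refl; exact: side_open. Qed.

Lemma side_convex z u w (t : R) : 0 <= t <= 1 -> side z u -> side z w ->
  side z ((1 - t%:C%C) * u + t%:C%C * w).
Proof.
have pos (a b : R) : 0 <= t <= 1 -> 0 < a -> 0 < b -> 0 < (1 - t) * a + t * b.
  move=> /andP[t0 t1] a0 b0; have [->|tn0] := eqVneq t 0; first by rewrite subr0 mul1r mul0r addr0.
  by apply: ltr_wpDl; [rewrite mulr_ge0 ?subr_ge0// ltW|rewrite mulr_gt0// lt0r tn0].
move=> t01; have posI := pos _ _ t01; case: u w => [a b] [a' b']; rewrite /side /=.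
case: (0 < Im z) => [h h'|].
  by have := posI b b' h h'; lra.
case: (Im z < 0) => [|].
  by rewrite -oppr_gt0 -(oppr_gt0 b') => h h'; have := posI _ _ h h'; lra.
case: (0 < Re z) => [h h'|]; first by have := posI a a' h h'; lra.
by rewrite -oppr_gt0 -(oppr_gt0 a') => h h'; have := posI _ _ h h'; lra.
Qed.

Lemma slit_cocycle z : z != 0 -> cocycle_at (translate slit) z.
Proof.
move=> z0; exists [set w | side z w]; first exact: nbhs_side.
split=> [w n _|w w' w'' n h h' h'']; first by rewrite /translate slitxx addr0.
by rewrite /translate -addrA (slit_side h).
Qed.

(** The winding number about 0, as the period of the crossing cocycle. *)
Definition winding (g : I -> C) : K := holonomy (translate slit) g 0.

Lemma winding_concat (g h : I -> C) : continuous g -> continuous h -> g one = h zero ->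
    (forall t, g t != 0) -> (forall t, h t != 0) ->
  winding (concat_fun g h) = winding g + winding h.
Proof.
move=> cg ch gh g0 h0.
have cog t := slit_cocycle (g0 t); have coh t := slit_cocycle (h0 t).
rewrite /winding (holonomy_concat 0 gh cg ch cog coh).
exact: (holonomy_translate _ ch coh).
Qed.

Lemma winding_free (H : I * I -> C) : continuous H -> (forall z, H z != 0) ->
    (forall s, H (zero, s) = H (one, s)) ->
  winding (fun t => H (t, zero)) = winding (fun t => H (t, one)).
Proof. by move=> cH H0 H01; apply: holonomy_free_homotopy => // z; exact: slit_cocycle. Qed.

Lemma winding_right g : (forall t, 0 < Re (g t)) -> winding g = 0.
Proof.
move=> g0; have pu : parallel (translate slit) g (fun=> 0).
  move=> t; exists setT; first exact: filterT.
  by move=> s s' _ _; rewrite /translate /slit ltNge (ltW (g0 s)) /= addr0.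
exact: (holonomyE pu).
Qed.

(** The segment from 1 to a, bent to the side of a so as to avoid 0. *)
Lemma punctured_path (a : C) : a != 0 ->
  exists g : I -> C, [/\ continuous g, g zero = 1, g one = a & forall t, g t != 0].
Proof.
move=> a0; pose k : R := if Im a < 0 then -1 else 1.
exists (fun t => ((1 - ui_val t + ui_val t * Re a)
   +i* (ui_val t * Im a + k * (ui_val t * (1 - ui_val t))))%C); split.
- have cv := @continuous_ui_val R.
  apply: continuous_Complex; apply: continuousR_add.
  + exact: continuous_onem.
  + by apply: continuousR_mul => //; exact: cst_continuous.
  + by apply: continuousR_mul => //; exact: cst_continuous.
  + apply: continuousR_mul; first exact: cst_continuous.
    exact: (continuousR_mul cv (continuous_onem cv)).
- by rewrite val_zero; apply/eqP; rewrite eq_complex /=; apply/andP; split; apply/eqP; ring.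
- by rewrite val_one; apply/eqP; rewrite eq_complex /=; apply/andP; split; apply/eqP; ring.
move=> t; have /andP[t0 t1] := ui_itv t.
have [->|tn0] := eqVneq (ui_val t) 0.
  by rewrite eq_complex /= subr0 !mul0r addr0 oner_eq0.
have [->|tn1] := eqVneq (ui_val t) 1.
  rewrite subrr !mul1r mulr0 add0r addr0.
  by move: a0; rewrite !eq_complex.
have {tn0}t0 : 0 < ui_val t by rewrite lt_neqAle eq_sym tn0.
have {tn1}t1 : ui_val t < 1 by rewrite lt_neqAle tn1.
rewrite eq_complex /= negb_and; apply/orP; right; rewrite /k; case: ltP => h.
  by rewrite lt_eqF//; nra.
by rewrite gt_eqF//; nra.
Qed.

(** Multiplication by a is joined to the identity by a path in the punctured
    plane. *)
Lemma winding_scale (a : C) (g : I -> C) : a != 0 -> continuous g -> (forall t, g t != 0) ->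
  g zero = g one -> winding (fun t => a * g t) = winding g.
Proof.
move=> a0 cg g0 g01; have [tau [ct t0 t1 tn0]] := punctured_path a0.
have -> : winding g = winding (fun t => tau zero * g t).
  by congr winding; apply/funext => t; rewrite t0 mul1r.
rewrite -t1; symmetry.
apply: (winding_free (H := fun z => tau z.2 * g z.1)).
- apply: continuousC_mul; first by apply: continuous_after ct; move=> z; exact: cvg_snd.
  by apply: continuous_after cg; move=> z; exact: cvg_fst.
- by move=> z; rewrite mulf_neq0.
- by move=> s /=; rewrite g01.
Qed.

Lemma winding_halfplane (w : C) (g : I -> C) : continuous g -> g zero = g one ->
  (forall t, 0 < Re (w * g t)) -> winding g = 0.
Proof.
move=> cg g01 h.
have nz t : (w != 0) && (g t != 0).
  rewrite -negb_or -mulf_eq0; apply/negP => /eqP e; have := h t.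
  by rewrite e ltxx.
have /andP[w0 _] := nz zero.
rewrite -(winding_scale w0 cg)//; first exact: winding_right.
by move=> t; case/andP: (nz t).
Qed.

(** The product is the diagonal of the map sending (t, s) to g t * h s, hence
    homotopic to a multiple of g followed by a multiple of h. *)
Lemma winding_mul (g h : I -> C) : continuous g -> continuous h ->
  (forall t, g t != 0) -> (forall t, h t != 0) -> g zero = g one -> h zero = h one ->
  winding (fun t => g t * h t) = winding g + winding h.
Proof.
move=> cg ch g0 h0 g01 h01.
pose F (z : I * I) := g z.1 * h z.2.
have cF : continuous F.
  apply: continuousC_mul; first by apply: continuous_after cg; move=> z; exact: cvg_fst.
  by apply: continuous_after ch; move=> z; exact: cvg_snd.
have F0 z : F z != 0 by rewrite mulf_neq0.
have := holonomy_homotopic 0 cF (fun z =>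
  slit_cocycle (F0 z)) (diag_homotopic (@continuous_identity _)).
rewrite -[LHS]/(winding (fun t => g t * h t)) => ->.
have -> : F \o concat_fun (fun t : I => (t, zero)) (fun t => (one, t)) =
   concat_fun (fun t => g t * h zero) (fun t => g one * h t).
  by apply/funext => t; rewrite /F /concat_fun /=; case: ifP.
rewrite -[LHS]/(winding _) winding_concat.
- rewrite (_ : (fun t => g t * h zero) = (fun t => h zero * g t)); last first.
    by apply/funext => t; rewrite mulrC.
  by rewrite !winding_scale.
- exact: (continuousC_mul cg (@cst_continuous _ _ (h zero))).
- exact: (continuousC_mul (@cst_continuous _ _ (g one)) ch).
- by rewrite h01.
- by move=> t; rewrite mulf_neq0.
- by move=> t; rewrite mulf_neq0.
Qed.

Lemma winding_cst (a : C) : a != 0 -> winding (fun=> a) = 0.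
Proof.
move=> a0; apply: (@winding_halfplane (a^-1)) => //; first exact: cst_continuous.
by move=> _; rewrite mulVf//= ltr01.
Qed.

Lemma winding_div (g h : I -> C) : continuous g -> continuous h ->
  (forall t, g t != 0) -> (forall t, h t != 0) -> g zero = g one -> h zero = h one ->
  winding (fun t => g t / h t) = winding g - winding h.
Proof.
move=> cg ch g0 h0 g01 h01.
have q0 t : g t / h t != 0 by rewrite mulf_neq0// invr_eq0.
have q01 : g zero / h zero = g one / h one by rewrite g01 h01.
have := winding_mul (continuousC_mul cg (continuousC_inv ch h0)) ch q0 h0 q01 h01.
have -> : (fun t => g t / h t * h t) = g by apply/funext => t; rewrite divfK.
by move=> ->; rewrite addrK.
Qed.

(** A polynomial loop playing the role of the unit circle: it is real only at the
    times 0, 1/2 and 1, where its value is 1, -1 and 1. *)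
Definition turn (t : I) : C :=
  let r := ui_val t in ((8 * (r - 2^-1) ^+ 2 - 1) +i* (r * (1 - r) * (1 - 2 * r)))%C.

Lemma turn_continuous : continuous turn.
Proof.
have cv := @continuous_ui_val R.
apply: continuous_Complex.
  apply: continuousR_add; last exact: cst_continuous.
  apply: continuousR_mul; first exact: cst_continuous.
  apply: continuousR_mul; apply: continuousR_add => //; exact: cst_continuous.
apply: continuousR_mul; first exact: (continuousR_mul cv (continuous_onem cv)).
by apply: continuous_onem; apply: continuous_scale.
Qed.

Lemma turn01 : turn zero = turn one.
Proof.
by rewrite /turn val_zero val_one; congr Complex; field.
Qed.

Lemma turn_neq0 t : turn t != 0.
Proof.
rewrite eq_complex /= negb_and; have /andP[t0 t1] := ui_itv t.
have [->|n0] := eqVneq (ui_val t) 0; first by apply/orP; left; rewrite gt_eqF//; lra.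
have [->|n1] := eqVneq (ui_val t) 1; first by apply/orP; left; rewrite gt_eqF//; lra.
have [->|n2] := eqVneq (ui_val t) 2^-1; first by apply/orP; left; rewrite lt_eqF//; lra.
apply/orP; right; rewrite !mulf_neq0//; first by rewrite subr_eq0 eq_sym.
by apply: contra n2 => /eqP h; apply/eqP; lra.
Qed.

Lemma turn_lt2 t : (-2 < Re (turn t) < 2) && (-2 < Im (turn t) < 2).
Proof.
rewrite /=; have /andP[t0 t1] := ui_itv t; set r := ui_val t in t0 t1 *.
have m0 : 0 <= r * (1 - r) by rewrite mulr_ge0// subr_ge0.
have m1 : 0 <= (r - 2^-1) * (r - 2^-1) by rewrite -expr2 sqr_ge0.
have m2 : 0 <= r * (1 - r) * r by rewrite mulr_ge0.
have m3 : 0 <= r * (1 - r) * (1 - r) by rewrite mulr_ge0// subr_ge0.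
by apply/andP; split; apply/andP; split; nra.
Qed.

Lemma winding_turn : winding turn = 1.
Proof.
(* The loop crosses the cut once, downwards, at time 1/2. *)
pose u (t : I) : K := (2^-1 < ui_val t)%R%:R.
have pu : parallel (translate slit) turn u.
  move=> t; have /andP[t0 t1] := ui_itv t.
  have ineg (s : I) : Re (turn s) < 0 -> (Im (turn s) < 0) = (2^-1 < ui_val s).
    rewrite /turn /=; have /andP[] := ui_itv s; move: (ui_val s) => r s0 s1 h.
    have hm : 1 < 8 * (r * (1 - r)) by move: h; rewrite expr2; lra.
    have r0 : 0 < r * (1 - r) by lra.
    rewrite pmulr_rlt0// subr_lt0.
    by apply/idP/idP; lra.
  have [et|/negP nt] := boolP (Re (turn t) < 0).
    exists (turn @^-1` (Re @^-1` [set r | r < 0])).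
      apply: turn_continuous; apply: continuous_Re; apply: open_nbhs_nbhs; split => //;
        exact: open_lt.
    move=> s s' /= hs hs'; rewrite /translate /slit hs hs' /= !ineg//.
    by rewrite /u; ring.
  have [lt|lt|eqt] := ltgtP (ui_val t) 2^-1.
  - exists [set s : I | `|ui_val t - ui_val s| < 2^-1 - ui_val t].
      by apply: nbhs_ui; rewrite subr_gt0.
    move=> s s'; rewrite /= !ltr_norml => /andP[? ?] /andP[? ?].
    have us : (2^-1 < ui_val s) = false by apply/negbTE; rewrite -leNgt; lra.
    have us' : (2^-1 < ui_val s') = false by apply/negbTE; rewrite -leNgt; lra.
    rewrite /u us us' /translate /slit; case: ifP => [/andP[h h']|]; last by rewrite addr0.
    by rewrite !ineg// us us' subrr addr0.
  - exists [set s : I | `|ui_val t - ui_val s| < ui_val t - 2^-1].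
      by apply: nbhs_ui; rewrite subr_gt0.
    move=> s s'; rewrite /= !ltr_norml => /andP[? ?] /andP[? ?].
    have us : (2^-1 < ui_val s) by lra.
    have us' : (2^-1 < ui_val s') by lra.
    rewrite /u us us' /translate /slit; case: ifP => [/andP[h h']|]; last by rewrite addr0.
    by rewrite !ineg// us us' subrr addr0.
  - by exfalso; apply: nt; rewrite /turn /= eqt; lra.
have := holonomyE pu; rewrite /u val_zero val_one.
have -> : (2^-1 < 0 :> R) = false by apply/negbTE; rewrite -leNgt; lra.
have -> : (2^-1 < 1 :> R) by lra.
by [].
Qed.
End Winding.

(** * A Heisenberg transport on the plane punctured at two points *)

Section Heisenberg.
Variables (R : realType) (K : fieldType).
Local Notation I := (unit_interval R).
Local Notation C := R[i].
Local Notation Re := (@complex.Re R).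
Local Notation slitK := (@slit R K).
Local Notation winding := (@winding R K).

(** Right translation in the group of triples with the product
      (a, b, h) (a', b', h') = (a + a', b + b', h + h' + a b').
    The first two coordinates count the crossings of the cuts going from 0 to
    the left and from 1 to the right; the third is an iterated integral, which
    makes the cup product of the two counts a coboundary. *)
Definition heisenberg (z z' : C) (n : K * K * K) : K * K * K :=
  (n.1.1 + slitK z z', n.1.2 + slitK (1 - z) (1 - z'),
   n.2 + n.1.1 * slitK (1 - z) (1 - z')).

Lemma continuous_onem_complex (Y : topologicalType) (f : Y -> C) :
  continuous f -> continuous (fun y => 1 - f y).
Proof.
move=> cf; have -> : (fun y => 1 - f y) = (fun y => 1 + (-1) * f y).
  by apply/funext => y; rewrite mulN1r.
exact: (continuousC_add (@cst_continuous _ C 1) (continuousC_mul (@cst_continuous _ C (-1)) cf)).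
Qed.

(** The two cuts are disjoint, so near a given point one of the two crossing
    numbers vanishes, and with it the cross term of the third coordinate. *)
Lemma heisenberg_cocycle z : z != 0 -> 1 - z != 0 -> cocycle_at heisenberg z.
Proof.
move=> z0 z1.
have [V0 V0z hV0] : exists2 V : set C, nbhs z V & forall w w' w'', V w -> V w' -> V w'' ->
    slitK w w' * slitK (1 - w') (1 - w'') = 0.
  have [lt1|ge1] := ltP (Re z) 1.
    exists (Re @^-1` [set r | r < 1]).
      by apply: continuous_Re; apply: open_nbhs_nbhs; split => //; exact: open_lt.
    move=> [a b] [a' b'] [a'' b''] /= _ h' _; rewrite [X in _ * X]/slit /=.
    by rewrite ifF ?mulr0//; apply/negbTE; rewrite negb_and -!leNgt; apply/orP; left; lra.
  exists (Re @^-1` [set r | 0 < r]).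
    apply: continuous_Re; apply: open_nbhs_nbhs; split; first exact: open_gt.
    by apply: lt_le_trans ge1.
  move=> [a b] [a' b'] [a'' b''] /= h _ _; rewrite [X in X * _]/slit /=.
  by rewrite ltNge (ltW h) mul0r.
exists ([set w | side z w] `&` [set w | side (1 - z) (1 - w)] `&` V0).
  apply: filterI => //; apply: filterI; first exact: nbhs_side.
  exact: (@continuous_onem_complex C id (@continuous_identity C) z _ (nbhs_side z1)).
split=> [w [[a b] h] _|w w' w'' [[a b] h] [[s1 s2] s3] [[s1' s2'] s3'] [[s1'' s2''] s3'']].
  by rewrite /heisenberg /= !slitxx mulr0 !addr0.
rewrite /heisenberg /=; have e := slit_side K s2 s2' s2''; have e' := slit_side K s1 s1' s1''.
rewrite -e -e'; congr (_, _, _); rewrite ?addrA//.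
by rewrite mulrDl (hV0 _ _ _ s3 s3' s3''); ring.
Qed.

(** Left translations of the group commute with the transport, hence map sections
    to sections. *)
Lemma holonomy_heisenberg (p : I -> C) (n : K * K * K) : continuous p ->
    (forall t, p t != 0) -> (forall t, 1 - p t != 0) ->
  holonomy heisenberg p n = (n.1.1 + winding p, n.1.2 + winding (fun t => 1 - p t),
    n.2 + n.1.1 * winding (fun t => 1 - p t) + (holonomy heisenberg p (0, 0, 0)).2).
Proof.
move=> cp p0 p1; have coc t := heisenberg_cocycle (p0 t) (p1 t).
have [u [pu u0 u1]] := holonomy_section (0, 0, 0) cp coc.
have pa : parallel (translate slitK) p (fun t => (u t).1.1).
  move=> t; have [V Vt hV] := pu t; exists V => // s s' Vs Vs'.
  by rewrite (hV s s').
have pb : parallel (translate slitK) (fun t => 1 - p t) (fun t => (u t).1.2).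
  move=> t; have [V Vt hV] := pu t; exists V => // s s' Vs Vs'.
  by rewrite (hV s s').
have ea : (u one).1.1 = winding p by rewrite -(holonomyE pa) u0.
have eb : (u one).1.2 = winding (fun t => 1 - p t) by rewrite -(holonomyE pb) u0.
(* the product of n with the section starting at the identity *)
pose w t := (n.1.1 + (u t).1.1, n.1.2 + (u t).1.2, n.2 + n.1.1 * (u t).1.2 + (u t).2).
have pw : parallel heisenberg p w.
  move=> t; have [V Vt hV] := pu t; exists V => // s s' Vs Vs'.
  rewrite /w (hV s s')// /heisenberg /=; congr (_, _, _); ring.
have := holonomyE pw; rewrite {1}/w u0 /= mulr0 !addr0.
move=> e; rewrite -u1 -ea -eb -[RHS]/(w one) -e.
by case: n @w pw e => [[]].
Qed.

(** Compare the third coordinates of the holonomies along the two products. *)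
Lemma winding_commute (Y : topologicalType) (F : Y -> C) (y : Y) (p q : I -> Y) :
    continuous F -> (forall z, F z != 0) -> (forall z, 1 - F z != 0) ->
    continuous p -> continuous q -> p zero = y -> p one = y -> q zero = y -> q one = y ->
    path_homotopic y y (concat_fun p q) (concat_fun q p) ->
  winding (F \o p) * winding (fun t => 1 - F (q t)) =
  winding (F \o q) * winding (fun t => 1 - F (p t)).
Proof.
move=> cF F0 F1 cp cq p0 p1 q0 q1 pq.
have coc z := heisenberg_cocycle (F0 z) (F1 z).
have cFp : continuous (F \o p) := continuous_after cp cF.
have cFq : continuous (F \o q) := continuous_after cq cF.
have := holonomy_homotopic (0, 0, 0) cF coc pq.
have e (f g : I -> Y) : F \o concat_fun f g = concat_fun (F \o f) (F \o g).
  by apply/funext => t; rewrite /concat_fun /=; case: ifP.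
rewrite !e.
have epq : (F \o p) one = (F \o q) zero by rewrite /= p1 q0.
have eqp : (F \o q) one = (F \o p) zero by rewrite /= q1 p0.
have cocp (t : I) := coc (p t); have cocq (t : I) := coc (q t).
rewrite (holonomy_concat _ epq cFp cFq cocp cocq) (holonomy_concat _ eqp cFq cFp cocq cocp).
have hp n : holonomy heisenberg (F \o p) n = _ :=
  holonomy_heisenberg n cFp (fun t => F0 (p t)) (fun t => F1 (p t)).
have hq n : holonomy heisenberg (F \o q) n = _ :=
  holonomy_heisenberg n cFq (fun t => F0 (q t)) (fun t => F1 (q t)).
rewrite [in LHS]hq [in RHS]hp [in LHS]hp [in RHS]hq /=.
move=> /(congr1 snd) /=; set h1 := (holonomy _ _ _).2; set h2 := (holonomy _ _ _).2.
rewrite !add0r !mul0r !add0r; set a := (X in h1 + X + h2); set b := (X in h2 + X + h1) => eq.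
rewrite -[LHS]/a -[RHS]/b.
have -> : a = h1 + a + h2 - (h1 + h2) by ring.
by rewrite eq; ring.
Qed.
End Heisenberg.

(** * Half-planes, affine forms and general position *)

Section Generic.
Variable R : realType.
Local Notation C := R[i].
Local Notation Re := (@complex.Re R).
Local Notation Im := (@complex.Im R).

Lemma small_forall (E : finType) (P : E -> R -> Prop) :
  (forall i, exists2 e, 0 < e & forall x, 0 < x -> x < e -> P i x) ->
  exists2 e, 0 < e & forall x, 0 < x -> x < e -> forall i, P i x.
Proof.
move=> h; have /choice[f hf] i : exists e, 0 < e /\ forall x, 0 < x -> x < e -> P i x.
  by have [e e0 he] := h i; exists e.
exists (\big[Num.min/1]_i f i).
  by elim/big_ind: _ => // [x y x0 y0|i _]; [rewrite lt_min x0|case: (hf i)].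
move=> x x0 xlt i; have [_] := hf i; apply=> //; apply: lt_le_trans xlt _.
by rewrite (bigD1 i)//= ge_min lexx.
Qed.

Lemma affine_small (E : finType) (a b : E -> R) : (forall k, a k != 0 \/ b k != 0) ->
  exists2 e, 0 < e & forall x, 0 < x -> x < e -> forall k, a k + b k * x != 0.
Proof.
move=> ab; apply: small_forall => k.
have [a0|a0] := eqVneq (a k) 0.
  exists 1 => // x x0 _; rewrite a0 add0r mulf_neq0//; last exact: lt0r_neq0.
  by case: (ab k) => //; rewrite a0 eqxx.
have b1 : 0 < `|b k| + 1 by rewrite ltr_wpDl.
exists (`|a k| / (`|b k| + 1)); first by rewrite divr_gt0// normr_gt0.
move=> x x0; rewrite ltr_pdivlMr// => hx; apply/negP => /eqP e.
have {}e : `|a k| = `|b k| * x.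
  by move: e => /eqP; rewrite addr_eq0 => /eqP ->; rewrite normrN normrM (gtr0_norm x0).
by move: hx; rewrite e; nra.
Qed.

Lemma affine_avoid (E : finType) (a b : E -> R) : (forall k, a k != 0 \/ b k != 0) ->
  exists x, forall k, a k + b k * x != 0.
Proof.
by move=> /affine_small [e e0 h]; exists (e / 2) => k; apply: h; lra.
Qed.

Lemma complex_neq0 (z : C) : z != 0 -> Re z != 0 \/ Im z != 0.
Proof. by rewrite eq_complex negb_and => /orP. Qed.

Lemma affine_avoidC (E : finType) (a b : E -> C) : (forall k, a k != 0 \/ b k != 0) ->
  exists x : R, forall k, a k + b k * x%:C%C != 0.
Proof.
move=> ab.
have /choice[f hf] k : exists f : bool,
    (if f then Re else Im) (a k) != 0 \/ (if f then Re else Im) (b k) != 0.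
  by case: (ab k) => /complex_neq0 [h|h]; [exists true; left|exists false; left|
     exists true; right|exists false; right].
have [x hx] := affine_avoid hf; exists x => k; apply: contra (hx k) => /eqP e.
apply/eqP; have := congr1 (if f k then Re else Im) e.
by case: (a k) (b k) => [a1 a2] [b1 b2]; case: (f k) => /=; lra.
Qed.

Lemma side_half (z : C) : z != 0 -> exists w : C, forall u, side z u -> 0 < Re (w * u).
Proof.
move=> z0; rewrite /side.
case: (0 < Im z); first by exists (- 'i%C) => -[a b] /=; lra.
case: (Im z < 0); first by exists 'i%C => -[a b] /=; lra.
case: (0 < Re z); first by exists 1 => -[a b] /=; lra.
by exists (-1) => -[a b] /=; lra.
Qed.

Lemma nonzero_half (z : C) : z != 0 -> exists w : C, 0 < Re (w * z).
Proof. by move=> z0; have [w hw] := side_half z0; exists w; apply: hw; exact: side_refl. Qed.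

Definition bounded_by (B : R) (z : C) := `|Re z| <= B /\ `|Im z| <= B.

Lemma bounded_mul B B' (z z' : C) : bounded_by B z -> bounded_by B' z' ->
  bounded_by (B * B' + B * B') (z * z').
Proof.
move=> [r i] [r' i']; have h (a b : R) : `|a| <= B -> `|b| <= B' -> `|a * b| <= B * B'.
  by move=> ha hb; rewrite normrM; apply: ler_pM.
case: z z' r i r' i' => [a b] [a' b'] /= r i r' i'; split=> /=.
  by apply: le_trans (ler_normB _ _) _; apply: lerD; exact: h.
by apply: le_trans (ler_normD _ _) _; apply: lerD; exact: h.
Qed.

Lemma bounded_add B B' (z z' : C) : bounded_by B z -> bounded_by B' z' ->
  bounded_by (B + B') (z + z').
Proof.
case: z z' => [a b] [a' b'] [/= r i] [/= r' i']; split=> /=;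
  by apply: le_trans (ler_normD _ _) _; apply: lerD.
Qed.

Lemma bounded_self (z : C) : bounded_by (`|Re z| + `|Im z|) z.
Proof. by split; rewrite ?lerDl ?lerDr. Qed.

Lemma halfplane_perturb (w z : C) (m B : R) : 0 < m -> m <= Re (w * z) ->
  exists2 e0 : R, 0 < e0 &
    forall e, 0 < e -> e < e0 -> forall u, bounded_by B u -> 0 < Re (w * (z + e%:C%C * u)).
Proof.
move=> m0 hm.
pose M := (`|Re w| + `|Im w|) * `|B| + 1.
have M0 : 0 < M by rewrite ltr_wpDl// mulr_ge0// addr_ge0.
exists (m / M); first exact: divr_gt0.
move=> e e0; rewrite ltr_pdivlMr// => he u [u1 u2].
have -> : Re (w * (z + e%:C%C * u)) = Re (w * z) + e * (Re w * Re u - Im w * Im u).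
  by case: (w) (z) (u) => [? ?] [? ?] [? ?] /=; ring.
have B0 : B <= `|B| by exact: ler_norm.
have : `|Re w * Re u - Im w * Im u| <= (`|Re w| + `|Im w|) * `|B|.
  apply: le_trans (ler_normB _ _) _; rewrite !normrM mulrDl; apply: lerD;
    by apply: ler_wpM2l => //; apply: le_trans B0.
rewrite ler_norml => /andP[lo _].
have : - (e * M) < e * (Re w * Re u - Im w * Im u).
  by rewrite -mulrN ltr_pM2l//; apply: lt_le_trans lo; rewrite ltrN2 /M ltrDl.
by move: (Re (w * z)) hm => q hm; move: (e * M) (e * _) he => ? ? ? ?; lra.
Qed.

Lemma small_perturb (z : C) (B : R) : z != 0 -> exists w : C, exists2 e0 : R, 0 < e0 &
  forall e, 0 < e -> e < e0 -> forall u, bounded_by B u -> 0 < Re (w * (z + e%:C%C * u)).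
Proof.
by move=> /nonzero_half [w hw]; exists w; exact: halfplane_perturb hw (lexx _).
Qed.

Lemma Re_combo (w a b : C) (t : R) : 0 <= t <= 1 -> 0 < Re (w * a) -> 0 < Re (w * b) ->
  0 < Re (w * ((1 - t%:C%C) * a + t%:C%C * b)).
Proof.
move=> /andP[t0 t1] ha hb.
have -> : Re (w * ((1 - t%:C%C) * a + t%:C%C * b)) = (1 - t) * Re (w * a) + t * Re (w * b).
  by case: (w) (a) (b) => [? ?] [? ?] [? ?] /=; ring.
have [->|tn0] := eqVneq t 0; first by rewrite subr0 mul1r mul0r addr0.
by apply: ltr_wpDl; [rewrite mulr_ge0 ?subr_ge0// ltW|rewrite mulr_gt0// lt0r tn0].
Qed.

Definition aff (l : C * C * C) (z : C * C) : C := l.1.1 * z.1 + l.1.2 * z.2 + l.2.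

Lemma continuous_aff l : continuous (aff l).
Proof.
apply: (@continuousC_add _ _ (fun z => l.1.1 * z.1 + l.1.2 * z.2) (fun=> l.2));
  last exact: cst_continuous.
apply: (@continuousC_add _ _ (fun z : C * C => l.1.1 * z.1) (fun z => l.1.2 * z.2)).
  by apply: (continuousC_mul (@cst_continuous _ C l.1.1)) => z; exact: cvg_fst.
by apply: (continuousC_mul (@cst_continuous _ C l.1.2)) => z; exact: cvg_snd.
Qed.

Definition combo (z w : (C * C)%type) (t : C) : (C * C)%type :=
  ((1 - t) * z.1 + t * w.1, (1 - t) * z.2 + t * w.2).

Lemma aff_combo (f : C * C * C) (z w : (C * C)%type) (t : C) :
  aff f (combo z w t) = (1 - t) * aff f z + t * aff f w.
Proof. by rewrite /aff /combo /=; ring. Qed.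

Lemma combo0 (z w : (C * C)%type) : combo z w 0 = z.
Proof. by rewrite /combo subr0 !mul1r !mul0r !addr0; case: z. Qed.
Lemma combo1 (z w : (C * C)%type) : combo z w 1 = w.
Proof. by rewrite /combo subrr !mul1r !mul0r !add0r; case: w. Qed.
Lemma combo_same (z : (C * C)%type) t : combo z z t = z.
Proof. by rewrite /combo -!mulrDl !subrK !mul1r; case: z. Qed.

Lemma continuous_combo (Y : topologicalType) (f g : Y -> (C * C)%type) (u : Y -> C) :
  continuous f -> continuous g -> continuous u -> continuous (fun y => combo (f y) (g y) (u y)).
Proof.
move=> cf cg cu; have c1 := continuous_onem_complex cu.
have f1 : continuous (fun y => (f y).1) by apply: continuous_after cf _ => ?; exact: cvg_fst.
have f2 : continuous (fun y => (f y).2) by apply: continuous_after cf _ => ?; exact: cvg_snd.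
have g1 : continuous (fun y => (g y).1) by apply: continuous_after cg _ => ?; exact: cvg_fst.
have g2 : continuous (fun y => (g y).2) by apply: continuous_after cg _ => ?; exact: cvg_snd.
exact: continuous_paired (continuousC_add (continuousC_mul c1 f1) (continuousC_mul cu g1))
  (continuousC_add (continuousC_mul c1 f2) (continuousC_mul cu g2)).
Qed.

Definition rescale (u : C) (p : C * C * C) := (u * p.1.1, u * p.1.2, u * p.2).

Lemma aff_rescale (u : C) (p : C * C * C) (z : C * C) : aff (rescale u p) z = u * aff p z.
Proof. by rewrite /aff /rescale /=; ring. Qed.

Definition proportional (p q : C * C * C) := exists u : C, q = rescale u p.

Lemma generic_direction (E : finType) (l : E -> C * C * C) :
  (forall k, (l k).1 != (0, 0)) -> exists d : C * C, forall k,
    (l k).1.1 * d.1 + (l k).1.2 * d.2 != 0.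
Proof.
move=> l0; have l0' k : (l k).1.1 != 0 \/ (l k).1.2 != 0.
  by have := l0 k; case: (l k).1 => a b; rewrite xpair_eqE negb_and => /orP.
have [x hx] := affine_avoidC l0'.
by exists (1, x%:C%C) => k /=; rewrite mulr1.
Qed.

Lemma nbhs_line (y d : C * C) (N : set (C * C)) : nbhs y N ->
  exists2 e : R, 0 < e & forall x : R, 0 < x -> x < e -> N (y.1 + x%:C%C * d.1, y.2 + x%:C%C * d.2).
Proof.
move=> Ny; pose f (x : R) := (y.1 + x%:C%C * d.1, y.2 + x%:C%C * d.2).
have cf : continuous f.
  apply: continuous_paired.
    exact: (continuousC_add (@cst_continuous _ C y.1) (continuousC_mul
      (@continuous_of_real R) (@cst_continuous _ C d.1))).
  exact: (continuousC_add (@cst_continuous _ C y.2) (continuousC_mul (@continuous_of_real R)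
    (@cst_continuous _ C d.2))).
have : nbhs (0 : R) (f @^-1` N).
  apply: cf; rewrite /f !mul0r !addr0; by case: (y) Ny.
move=> /nbhs_ballP [e /= e0 he]; exists e => // x x0 xe; apply: he.
by rewrite /ball /= sub0r normrN gtr0_norm.
Qed.

(** Along a real line through y in the direction (1 + i s) d, where d is generic
    for the linear parts and s is generic, the imaginary parts are affine and
    not identically zero. *)
Lemma generic_nbhs (E : finType) (l : E -> C * C * C) (y : C * C) (N : set (C * C)) :
    (forall k, (l k).1 != (0, 0)) -> nbhs y N ->
  exists2 w, N w & forall k, Im (aff (l k) w) != 0.
Proof.
move=> l0 Ny; have [d hd] := generic_direction l0.
pose m k := (l k).1.1 * d.1 + (l k).1.2 * d.2.
have [s hs] := @affine_avoid E (fun k => Im (m k)) (fun k => Re (m k))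
   (fun k => match complex_neq0 (hd k) with or_introl h => or_intror h | or_intror h =>
     or_introl h end).
have [e1 e10 h1] := nbhs_line ((1 +i* s)%C * d.1, (1 +i* s)%C * d.2) Ny.
have [e2 e20 h2] := @affine_small E (fun k => Im (aff (l k) y)) (fun k => Im (m k) + Re (m k) * s)
   (fun k => or_intror (hs k)).
pose x := Num.min e1 e2 / 2.
have x0 : 0 < Num.min e1 e2 by rewrite lt_min e10.
have lex : x < Num.min e1 e2 by rewrite /x; lra.
eexists; first by apply: (h1 x); [rewrite divr_gt0|apply: lt_le_trans lex _; rewrite ge_min lexx].
move=> k; have := h2 x (divr_gt0 x0 (ltr0n _ 2)).
have -> : x < e2 by apply: lt_le_trans lex _; rewrite ge_min lexx orbT.
move=> /(_ isT k); congr (_ != 0); rewrite /m /aff /=.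
case: (l k) => [[[a1 a2] [b1 b2]] [c1 c2]]; case: (y) (d) => [[y1 y2] [y3 y4]] [[d1 d2] [d3 d4]].
by rewrite /=; ring.
Qed.

(** The complex line through two points meets each of the other lines at one
    value of the parameter at most, and the arcs s + i k s (1 - s) with distinct
    k have only their ends in common; so some arc avoids all these values. *)
Lemma punctured_segment (E : finType) (P : pred E) (a b : E -> C) :
    (forall j, P j -> a j != 0) -> (forall j, P j -> b j != 0) ->
  exists tau : unit_interval R -> C, [/\ continuous tau, tau zero = 0, tau one = 1 &
    forall t j, P j -> (1 - tau t) * a j + tau t * b j != 0].
Proof.
(* the parameter at which the affine function from a j to b j vanishes *)
move=> a0 b0; pose be j := a j / (a j - b j).
have c0 j : Im (be j) != 0 \/
    (if Im (be j) == 0 then 1 else - (Re (be j) * (1 - Re (be j)))) != 0.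
  by case: eqP => _; [right; rewrite oner_eq0|left].
have [k hk] := affine_avoid c0.
exists (fun t => (ui_val t +i* (k * (ui_val t * (1 - ui_val t))))%C); split.
- have cv := @continuous_ui_val R; apply: (continuous_Complex cv).
  exact: (continuousR_mul (@cst_continuous _ _ k) (continuousR_mul cv (continuous_onem cv))).
- by rewrite val_zero; congr Complex; ring.
- by rewrite val_one; congr Complex; ring.
move=> t j Pj; apply/negP => /eqP e; set tau := (_ +i* _)%C in e.
have ab : a j - b j != 0.
  apply/negP => /eqP /subr0_eq ab; move/eqP: e; apply/negP.
  by rewrite -ab -mulrDl subrK mul1r a0.
have etau : tau = be j.
  apply: (mulIf ab); rewrite /be divfK//; apply: subr0_eq; rewrite -[RHS]oppr0 -e; ring.
have [r i] : Re (be j) = ui_val t /\ Im (be j) = k * (ui_val t * (1 - ui_val t)).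
  by rewrite -etau.
have := hk j; rewrite r; case: (Im (be j) =P 0) => [i0|_]; last by rewrite i mulNr mulrC subrr eqxx.
rewrite i0 add0r mul1r; apply/negP; rewrite negbK.
move: i0; rewrite i => /eqP; rewrite mulf_eq0 => /orP[//|]; rewrite mulf_eq0 subr_eq0.
move=> /orP[/eqP t0|/eqP t1].
  have : be j == 0 by rewrite eq_complex r i t0 mul0r mulr0 !eqxx.
  by rewrite /be mulf_eq0 invr_eq0 (negbTE ab) orbF (negbTE (a0 _ Pj)).
have : be j == 1 by rewrite eq_complex r i -t1 subrr !mulr0 !eqxx.
rewrite /be -subr_eq0 -[X in _ - X](mulfV ab) -mulrBl mulf_eq0 invr_eq0 (negbTE ab) orbF.
by rewrite opprB addrC subrK (negbTE (b0 _ Pj)).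
Qed.
End Generic.

(** * Additive cocycles on the complement of an arrangement *)

Section Decomposition.
Variables (R : realType) (K : fieldType) (E : finType).
Local Notation C := R[i].
Local Notation Re := (@complex.Re R).
Local Notation Im := (@complex.Im R).
Local Notation C2 := (C * C)%type.
Variables (l : E -> C * C * C) (v : C2) (c : C2 -> C2 -> K).
Local Notation L i := (aff (l i)).
Hypothesis l_v : forall i, (l i).1.1 * v.1 + (l i).1.2 * v.2 = 1.
Hypothesis l_parallel : forall i j, i != j -> (l i).1 = (l j).1 -> Im ((l i).2 - (l j).2) != 0.

(** For each line, the values of its form on P lie in an open half-plane which
    does not contain 0.  The convex hull of P then misses the arrangement: this is
    the form in which convexity is used. *)
Definition together (P : set C2) :=
  forall i, exists w : C, forall y, P y -> 0 < Re (w * L i y).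
Hypothesis cP : forall P : set C2, together P -> forall y y' y'',
  P y -> P y' -> P y'' -> c y y' + c y' y'' = c y y''.

Lemma c_refl P y : together P -> P y -> c y y = 0.
Proof. by move=> tP Py; apply: (addrI (c y y)); rewrite addr0 (cP tP). Qed.

Lemma c_anti P y y' : together P -> P y -> P y' -> c y' y = - c y y'.
Proof.
by move=> tP Py Py'; apply/eqP; rewrite -addr_eq0 (cP tP)// (c_refl tP).
Qed.

Lemma Re_addr (z : C) (r : R) : Re (z + r%:C%C) = Re z + r.
Proof. by case: z. Qed.

Definition shift (z : C2) (t : C) : C2 := (z.1 + t * v.1, z.2 + t * v.2).

Lemma L_shift i z t : L i (shift z t) = L i z + t.
Proof.
rewrite /aff /shift /= -[in RHS](mulr1 t) -(l_v i); ring.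
Qed.

Lemma shift_shift z s t : shift (shift z s) t = shift z (s + t).
Proof. by rewrite /shift /=; congr (_, _); ring. Qed.

(** A convex neighbourhood of y in the complement, on which each crossing number
    is a coboundary. *)
Definition cell (y : C2) : set C2 := [set z | forall i, side (L i y) (L i z)].

Lemma cell_together y : (forall i, L i y != 0) -> together (cell y).
Proof.
by move=> y0 i; have [w hw] := side_half (y0 i); exists w => z /(_ i); exact: hw.
Qed.

Lemma cell_refl y : (forall i, L i y != 0) -> cell y y.
Proof. by move=> y0 i; exact: side_refl. Qed.

Lemma nbhs_cell y : (forall i, L i y != 0) -> nbhs y (cell y).
Proof.
move=> y0; have sn i : nbhs y (fun z => side (L i y) (L i z)).
  exact: (@continuous_aff R (l i) y _ (nbhs_side (y0 i))).
exact: filter_forall sn.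
Qed.

(** Neither point is on the cut, and both lie in a half-plane which misses the
    cut and is stable under translation by positive reals. *)
Definition aligned (z z' : C) := [\/ 0 < Im z /\ 0 < Im z',
  Im z < 0 /\ Im z' < 0 | 0 < Re z /\ 0 < Re z'].

Definition cosided (z z' : C2) := forall i, aligned (L i z) (L i z').

Let far (z : C2) : R := \sum_i `|Re (L i z)| + 1.
Lemma farP z i (t : R) : far z <= t -> 0 < Re (L i z) + t.
Proof.
move=> h; have : `|Re (L i z)| < t.
  apply: lt_le_trans h; rewrite /far (bigD1 i)//= -addrA ltrDl.
  by apply: ltr_wpDl => //; apply: sumr_ge0.
by rewrite ltr_norml => /andP[? _]; lra.
Qed.

Lemma far_gt0 z : 0 < far z.
Proof. by apply: ltr_wpDl => //; apply: sumr_ge0. Qed.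

Let far_base : C2 := shift (0, 0) (far (0, 0))%:C%C.
Lemma far_baseP i : 0 < Re (L i far_base).
Proof. by rewrite L_shift Re_addr; exact: farP. Qed.

(** The value of c along the ray from z in the direction v, continued by a
    segment in the region where all the forms have positive real part.  Since
    all the linear parts take the value 1 on v, the ray misses line i exactly when
    L i z is not a nonpositive real. *)
Definition potential (z : C2) : K := c z (shift z (far z)%:C%C) + c (shift z (far z)%:C%C) far_base.

Lemma far_together : together [set y | forall i, 0 < Re (L i y)].
Proof. by move=> i; exists 1 => y /(_ i); rewrite mul1r. Qed.

Lemma flow_together z z' : cosided z z' ->
  together [set y | exists2 t : R, 0 <= t & y = shift z t%:C%C \/ y = shift z' t%:C%C].
Proof.
move=> zz i; case: (zz i) => -[h h'].
- exists (- 'i%C) => _ [t t0 [->|->]]; rewrite L_shift;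
    by case: (L i _) h h' => a b; case: (L i _) => a' b' /= ? ?; lra.
- exists 'i%C => _ [t t0 [->|->]]; rewrite L_shift;
    by case: (L i _) h h' => a b; case: (L i _) => a' b' /= ? ?; lra.
- exists 1 => _ [t t0 [->|->]]; rewrite L_shift mul1r;
    by case: (L i _) h h' => a b; case: (L i _) => a' b' /= ? ?; lra.
Qed.

Lemma shift0 z : shift z 0 = z.
Proof. by rewrite /shift !mul0r !addr0; case: z. Qed.

(** The part of a longer ray beyond time t stays in the far region, which is
    convex. *)
Lemma potentialE z (t : R) : cosided z z -> 0 <= t -> (forall i, 0 < Re (L i z) + t) ->
  potential z = c z (shift z t%:C%C) + c (shift z t%:C%C) far_base.
Proof.
move=> zz t0 ht; have tP := flow_together zz.
set P := [set y | _] in tP.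
have Ps (s : R) : 0 <= s -> P (shift z s%:C%C) by move=> s0; exists s => //; left.
have Pz : P z by have := Ps 0 (lexx _); rewrite shift0.
rewrite /potential -(cP tP Pz (Ps _ t0) (Ps _ (ltW (far_gt0 z)))) -addrA.
congr (_ + _); apply: (cP far_together) => i /=; last exact: far_baseP.
  by rewrite L_shift Re_addr; exact: ht.
by rewrite L_shift Re_addr; exact: farP.
Qed.

Lemma cosidedxx z z' : cosided z z' -> cosided z z.
Proof.
by move=> h i; case: (h i) => -[? ?]; [constructor 1|constructor 2|constructor 3].
Qed.
Lemma cosidedC z z' : cosided z z' -> cosided z' z.
Proof.
by move=> h i; case: (h i) => -[? ?]; [constructor 1|constructor 2|constructor 3].
Qed.

(** The parallelogram swept by the segment from z to z' in the direction v misses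
    the lines. *)
Lemma potential_cosided z z' : cosided z z' -> c z z' = potential z - potential z'.
Proof.
move=> zz; have tP := flow_together zz; set P := [set y | _] in tP.
pose t := far z + far z'.
have t0 : 0 <= t by rewrite addr_ge0// ltW// far_gt0.
have fz : far z <= t by rewrite lerDl ltW// far_gt0.
have fz' : far z' <= t by rewrite lerDr ltW// far_gt0.
rewrite (potentialE (cosidedxx zz) t0) ?(potentialE (cosidedxx (cosidedC zz)) t0);
  [|by move=> i; exact: farP..].
have Pz : P z by exists 0 => //; left; rewrite shift0.
have Pz' : P z' by exists 0 => //; right; rewrite shift0.
have Pzt : P (shift z t%:C%C) by exists t => //; left.
have Pzt' : P (shift z' t%:C%C) by exists t => //; right.
have Ww (y : C2) : far y <= t -> forall i, 0 < Re (L i (shift y t%:C%C)).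
  by move=> fy i; rewrite L_shift Re_addr; exact: farP.
have e1 := cP tP Pz Pz' Pzt'.
have e2 := cP tP Pz Pzt Pzt'.
have e3 := cP far_together (Ww z fz) (Ww z' fz') far_baseP.
rewrite -e3; apply: (addIr (c z' (shift z' t%:C%C))); rewrite e1 -e2; ring.
Qed.

(** Counterclockwise from the upper left, so that the first edge of the square
    crosses the cut from the upper to the lower side. *)
Definition corner (k : 'I_4) : C :=
  nth 0 [:: (-1 +i* 1)%C; (-1 +i* -1)%C; (1 +i* -1)%C; (1 +i* 1)%C] k.
Let k0 : 'I_4 := inord 0. Let k1 : 'I_4 := inord 1.
Let k2 : 'I_4 := inord 2. Let k3 : 'I_4 := inord 3.

Lemma cornerE : (corner k0 = (-1 +i* 1)%C) * (corner k1 = (-1 +i* -1)%C) *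
  (corner k2 = (1 +i* -1)%C) * (corner k3 = (1 +i* 1)%C).
Proof. by rewrite /corner /k0 /k1 /k2 /k3 !inordK. Qed.

Definition vertex (h : C2) (e : R) (k : 'I_4) : C2 := shift h (e%:C%C * corner k).
(** The meridian of a line at its point h, as the boundary of a square in the
    complex line through h with direction v. *)
Definition square_holonomy (h : C2) (e : R) : K :=
  c (vertex h e k0) (vertex h e k1) + c (vertex h e k1) (vertex h e k2) +
  c (vertex h e k2) (vertex h e k3) + c (vertex h e k3) (vertex h e k0).

(** The four quadrilaterals between corresponding edges of the two squares miss
    the lines, so the contributions of the sides joining their vertices cancel. *)
Lemma square_holonomy_eq i h e h' e' : L i h = 0 -> L i h' = 0 -> 0 < e -> 0 < e' ->
    (forall j, j != i -> exists w : C, forall k : 'I_4,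
      0 < Re (w * (L j h + e%:C%C * corner k)) /\ 0 < Re (w * (L j h' + e'%:C%C * corner k))) ->
  square_holonomy h e = square_holonomy h' e'.
Proof.
move=> h0 h0' e0 e0' hw.
pose D k := c (vertex h e k) (vertex h' e' k).
suff edge k k' (w : C) : 0 < Re (w * corner k) -> 0 < Re (w * corner k') ->
    c (vertex h e k) (vertex h e k') = D k + c (vertex h' e' k) (vertex h' e' k') - D k'.
  rewrite /square_holonomy (edge k0 k1 (-1)) ?(edge k1 k2 'i%C) ?(edge k2 k3 1) ?(edge k3 k0
    (- 'i%C));
    first (by ring); rewrite cornerE /=; lra.
move=> wk wk'.
pose P : set C2 := [set y | [\/ y = vertex h e k,
  y = vertex h e k' | y = vertex h' e' k \/ y = vertex h' e' k']].
have scale (r : R) (z : C) : 0 < r -> 0 < Re (w * z) -> 0 < Re (w * (r%:C%C * z)).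
  move=> r0; rewrite mulrCA; case: (w * z) => a b /= h1; rewrite mul0r subr0; exact: mulr_gt0.
have tP : together P.
  move=> j; have [->|ji] := eqVneq j i.
    exists w => y [->|->|[->|->]]; rewrite L_shift ?h0 ?h0' add0r; exact: scale.
  have [w' hw'] := hw j ji; exists w' => y [->|->|[->|->]]; rewrite L_shift;
    by case: (hw' k); case: (hw' k').
have p1 : P (vertex h e k) by constructor 1.
have p2 : P (vertex h e k') by constructor 2.
have p3 : P (vertex h' e' k) by constructor 3; left.
have p4 : P (vertex h' e' k') by constructor 3; right.
rewrite -(cP tP p1 p3 p2) -(cP tP p3 p4 p2) (c_anti tP p2 p4) /D; ring.
Qed.

Lemma corner_le1 k : bounded_by 1 (corner k).
Proof.
by rewrite /bounded_by /corner; case: k => [[|[|[|[|?]]]] hk] //=; rewrite ?normrN !normr1.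
Qed.

Definition meridian_is (h : C2) (k : K) := exists2 e0, 0 < e0 &
  forall e : R, 0 < e -> e < e0 -> square_holonomy h e = k.

Lemma meridian_path i (h : unit_interval R -> C2) k : continuous h ->
    (forall t, L i (h t) = 0) -> (forall t j, j != i -> L j (h t) != 0) ->
  meridian_is (h zero) k -> forall t, meridian_is (h t) k.
Proof.
move=> ch hi hj h0; apply: (@unit_interval_ind R (fun t => meridian_is (h t) k)) => // t.
have /choice[w hw] j : exists w : C, j != i -> 0 < Re (w * L j (h t)).
  have [ji|ji] := boolP (j != i); last by exists 0.
  by have [w hw] := nonzero_half (hj t j ji); exists w.
pose m j := Re (w j * L j (h t)).
have nb j : nbhs t (fun s => j != i -> m j / 2 < Re (w j * L j (h s))).
  have [ji|ji] := boolP (j != i); last by apply: filterE.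
  have cf : continuous (fun s => Re (w j * L j (h s))).
    exact: (continuous_Re_after (continuousC_mul (@cst_continuous _ C (w j))
      (continuous_after ch (@continuous_aff R (l j))))).
  have : nbhs t ((fun s => Re (w j * L j (h s))) @^-1` [set r | m j / 2 < r]).
    apply: cf; apply: open_nbhs_nbhs; split; first exact: open_gt.
    by have := hw j ji; rewrite /m /=; lra.
  by apply: filterS.
exists [set s | forall j, j != i -> m j / 2 < Re (w j * L j (h s))]; first exact: filter_forall nb.
move=> s s' hs hs' [e0 e00 he0].
have small (r : unit_interval R) : (forall j, j != i -> m j / 2 < Re (w j * L j (h r))) ->
  exists2 e1, 0 < e1 & forall e, 0 < e -> e < e1 -> forall j, j != i -> forall k : 'I_4,
    0 < Re (w j * (L j (h r) + e%:C%C * corner k)).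
  move=> hr; apply: small_forall => j; have [ji|ji] := boolP (j != i); last by exists 1.
  have m0 : 0 < m j / 2 by rewrite divr_gt0//; exact: hw.
  have [e1 e10 he1] := halfplane_perturb 1 m0 (ltW (hr j ji)).
  by exists e1 => // e p0 pe _ k'; apply: he1 => //; exact: corner_le1.
have [e1 e10 he1] := small s hs; have [e2 e20 he2] := small s' hs'.
exists (Num.min e0 (Num.min e1 e2)); first by rewrite !lt_min e00 e10.
move=> e ep; rewrite !lt_min => /and3P[l0 l1 l2]; rewrite -(he0 e ep l0).
apply: (square_holonomy_eq (hi s') (hi s) ep ep) => j ji; exists (w j) => k'.
by split; [exact: he2|exact: he1].
Qed.

Lemma meridian_exists i h : L i h = 0 -> (forall j, j != i -> L j h != 0) ->
  exists k, meridian_is h k.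
Proof.
move=> hi hj.
have /choice[w hw] j : exists w : C, j != i -> 0 < Re (w * L j h).
  have [ji|ji] := boolP (j != i); last by exists 0.
  by have [w hw] := nonzero_half (hj j ji); exists w.
have [e1 e10 he1] : exists2 e1, 0 < e1 & forall e, 0 < e -> e < e1 -> forall j, j != i ->
    forall k : 'I_4, 0 < Re (w j * (L j h + e%:C%C * corner k)).
  apply: small_forall => j; have [ji|ji] := boolP (j != i); last by exists 1.
  have [e1 e10 he1] := halfplane_perturb 1 (hw j ji) (lexx _).
  by exists e1 => // e p0 pe _ k'; apply: he1 => //; exact: corner_le1.
exists (square_holonomy h (e1 / 2)), e1 => // e ep el.
have h0 : 0 < e1 / 2 by lra. have h1 : e1 / 2 < e1 by lra.
apply: (square_holonomy_eq hi hi ep h0) => j ji; exists (w j) => k'.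
by split; apply: he1.
Qed.

(** A line minus its intersections with the other lines is path connected, and
    the meridian is locally constant along it. *)
Lemma meridian_const i : exists k, forall h, L i h = 0 -> (forall j, j != i -> L j h != 0) ->
  meridian_is h k.
Proof.
have [[h0 [hi hj]]|none] := pselect (exists h, L i h = 0 /\ forall j, j != i -> L j h != 0);
  last first.
  by exists 0 => h hi hj; exfalso; apply: none; exists h.
have [k hk] := meridian_exists hi hj; exists k => h hi' hj'.
have [tau [ct t0 t1 tn]] := @punctured_segment R E (fun j => j != i) (fun j =>
  L j h0) (fun j => L j h) hj hj'.
have := @meridian_path i (fun t =>
  combo h0 h (tau t)) k (continuous_combo (@cst_continuous _ _ h0)
  (@cst_continuous _ _ h) ct) _ _ _ one.
rewrite t1 t0 combo0 combo1; apply=> // [t|t j ji]; rewrite aff_combo;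
  first by rewrite hi hi' !mulr0 addr0.
exact: tn.
Qed.

(** The ray from q in the direction v misses line i. *)
Definition offslit i (q : C2) := (Im (L i q) != 0) || (0 < Re (L i q)).

Lemma off_aligned i q z z' : offslit i q -> side (L i q) (L i z) -> side (L i q) (L i z') ->
  aligned (L i z) (L i z').
Proof.
rewrite /offslit /side; case: (ltgtP (Im (L i q)) 0) => /= _.
- by move=> _ ? ?; constructor 2.
- by move=> _ ? ?; constructor 1.
- by move=> -> ? ?; constructor 3.
Qed.

Lemma slit_aligned (z z' : C) : aligned z z' ->
  slit K z z' = 0.
Proof.
rewrite /slit => -[[h h']|[h h']|[h h']].
- by rewrite !ltNge !(ltW h) !(ltW h') /= subrr if_same.
- by rewrite h h' subrr if_same.
- by rewrite !ltNge !(ltW h).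
Qed.

Variable m : E -> K.
Hypothesis mP : forall i h, L i h = 0 -> (forall j, j != i -> L j h != 0) -> meridian_is h (m i).

(** The part of c that is not a coboundary. *)
Definition jump (z z' : C2) : K := \sum_i m i * slit K (L i z) (L i z').

(** The rays from the two points bound a strip which contains one point of the
    arrangement, the point h of line i met by the ray from q.  Outside a small
    square around h the strip is cut into pieces which miss the lines, so the
    only defect is the meridian at h. *)
Lemma cross_slit i q : (forall j, L j q != 0) -> ~~ offslit i q ->
    (forall j, j != i -> offslit j q) -> forall z z', cell q z -> cell q z' ->
  0 < Im (L i z) -> Im (L i z') < 0 -> c z z' = potential z - potential z' + m i.
Proof.
move=> q0 oi oj z z' Vz Vz' iz iz'.
have [iq rq] : Im (L i q) = 0 /\ Re (L i q) < 0.
  move: oi; rewrite /offslit negb_or negbK => /andP[/eqP i0 r0]; split=> //.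
  by have [] := complex_neq0 (q0 i); rewrite ?i0 ?eqxx// lt_neqAle => ->; rewrite leNgt.
have sidei w : side (L i q) w = (Re w < 0).
  by rewrite /side iq ltxx ltNge (ltW rq).
pose t := - Re (L i q); have t0 : 0 < t by rewrite oppr_gt0.
have eq : L i q = (- t)%:C%C by rewrite /t opprK; case: (L i q) iq => a b /= ->.
pose h := shift q t%:C%C.
have hi : L i h = 0 by rewrite L_shift eq rmorphN addNr.
have hj j : j != i -> L j h != 0.
  move=> /oj; rewrite L_shift eq_complex negb_and /offslit; case: (L j q) => a b /=.
  by rewrite addr0 => /orP[->|a0]; [rewrite orbT|rewrite gt_eqF// addr_gt0].
have [e0 e00 he0] := mP hi hj.
have [e1 e10 he1] : exists2 e1, 0 < e1 & forall e, 0 < e -> e < e1 -> forall j, j != i ->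
    Im (L j q) != 0 -> e < `|Im (L j q)|.
  apply: small_forall => j; have [ij|ij] := eqVneq (Im (L j q)) 0.
    by exists 1 => // x _ _ _; rewrite eqxx.
  by exists `|Im (L j q)|; rewrite ?normr_gt0.
(* The square stays above q, computes the meridian, and misses the other lines. *)
pose e := Num.min t (Num.min e0 e1) / 2.
have ep : 0 < e by rewrite /e divr_gt0// !lt_min t0 e00.
have et : e < Num.min t (Num.min e0 e1).
  by rewrite /e ltr_pdivrMr// mulr_natr mulr2n ltrDl !lt_min t0 e00.
move: et; rewrite !lt_min => /and3P[et ee0 ee1].
have {he1}eI j : j != i -> Im (L j q) != 0 -> e < `|Im (L j q)| by exact: he1.
have {he0}SQ : square_holonomy h e = m i by exact: he0.
have strip j (r s : R) : j != i -> - e <= s -> s <= e -> 0 <= r ->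
    side (L j q) (L j (shift q (r +i* s)%C)).
  move=> ji s1 s2 r0; rewrite L_shift.
  have := eI j ji; have := oj j ji; rewrite /offslit /side.
  case: (L j q) => a b /=; case: (ltgtP b 0) => //= b0.
  - by move=> _ /(_ isT); rewrite ltr0_norm// => ?; lra.
  - by move=> _ /(_ isT); rewrite gtr0_norm// => ?; lra.
  - by move=> a0 _; rewrite a0; lra.
have qi (r s : R) : L i (shift q (r +i* s)%C) = ((r - t) +i* s)%C.
  by rewrite L_shift eq; congr Complex => /=; ring.
have sqE k : vertex h e k = shift q ((t + e * Re (corner k)) +i* (e * Im (corner k)))%C.
  rewrite /vertex /h shift_shift; congr shift; case: (corner k) => x y /=.
  by congr Complex => /=; ring.
have [[[E0 E1] E2] E3] := cornerE.
have {E0} E0 : vertex h e k0 = shift q ((t - e) +i* e)%C by rewrite sqE E0 /= mulrN1 mulr1.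
have {E1} E1 : vertex h e k1 = shift q ((t - e) +i* (- e))%C by rewrite sqE E1 /= mulrN1.
have {E2} E2 : vertex h e k2 = shift q ((t + e) +i* (- e))%C by rewrite sqE E2 /= mulrN1 mulr1.
have {E3} E3 : vertex h e k3 = shift q ((t + e) +i* e)%C by rewrite sqE E3 /= mulr1.
(* the bottom of the strip, just above and just below the cut *)
pose a := shift q (0 +i* e)%C; pose b := shift q (0 +i* (- e))%C.
have ne : - e <= e by lra.
have le0 : 0 <= e by exact: ltW.
have te : 0 <= t - e by lra.
have te' : 0 <= t + e by lra.
have cos (r s r' s' : R) : - e <= s -> s <= e -> 0 <= r -> - e <= s' -> s' <= e -> 0 <= r' ->
    [\/ 0 < s /\ 0 < s', s < 0 /\ s' < 0 | t < r /\ t < r'] ->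
    cosided (shift q (r +i* s)%C) (shift q (r' +i* s')%C).
  move=> h1 h2 h3 h1' h2' h3' hi' j; have [->|ji] := eqVneq j i.
    rewrite !qi /aligned /=; case: hi' => -[? ?]; [constructor 1|constructor 2|constructor 3] => //.
    by split; lra.
  by apply: off_aligned (oj j ji) _ _; exact: strip.
have cosz (w : C2) (s : R) : cell q w -> - e <= s -> s <= e ->
    (0 < Im (L i w) /\ 0 < s) \/ (Im (L i w) < 0 /\ s < 0) ->
    cosided w (shift q (0 +i* s)%C).
  move=> Vw s1 s2 hs j; have [->|ji] := eqVneq j i.
    by rewrite qi /aligned /=; case: hs => -[? ?]; [constructor 1|constructor 2].
  by apply: off_aligned (oj j ji) (Vw j) _; exact: strip.
have Va : cell q a.
  move=> j; have [->|ji] := eqVneq j i; last exact: strip.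
  by rewrite sidei qi /=; lra.
have Vb : cell q b.
  move=> j; have [->|ji] := eqVneq j i; last by apply: strip => //; lra.
  by rewrite sidei qi /=; lra.
have tV := cell_together q0.
have za : c z a = potential z - potential a.
  by apply: potential_cosided; apply: cosz => //; left.
have bz : c z' b = potential z' - potential b.
  by apply: potential_cosided; apply: cosz => //; right; split=> //; lra.
have a1 : c a (vertex h e k0) = potential a - potential (vertex h e k0).
  by apply: potential_cosided; rewrite E0; apply: cos => //; constructor 1.
have b1 : c b (vertex h e k1) = potential b - potential (vertex h e k1).
  by apply: potential_cosided; rewrite E1; apply: cos => //; try lra; constructor 2; split; lra.
have c12 : c (vertex h e k1) (vertex h e k2) = potential (vertex h e k1) - potential
  (vertex h e k2).
  by apply: potential_cosided; rewrite E1 E2; apply: cos => //; try lra; constructor 2; split; lra.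
have c23 : c (vertex h e k2) (vertex h e k3) = potential (vertex h e k2) - potential
  (vertex h e k3).
  by apply: potential_cosided; rewrite E2 E3; apply: cos => //; try lra; constructor 3; split; lra.
have c30 : c (vertex h e k3) (vertex h e k0) = potential (vertex h e k3) - potential
  (vertex h e k0).
  by apply: potential_cosided; rewrite E3 E0; apply: cos => //; constructor 1.
pose P : set C2 := [set y | exists2 r : R, 0 <= r /\ r < t & exists2 s : R, - e <= s /\ s <= e &
  y = shift q (r +i* s)%C].
have tP : together P.
  move=> j; have [->|ji] := eqVneq j i.
    by exists (-1) => _ [r [r0 r1] [s _ ->]]; rewrite qi /=; lra.
  have [w hw] := side_half (q0 j); exists w => _ [r [r0 r1] [s [s0 s1] ->]]; apply: hw.
  exact: strip.
have Pa : P a by exists 0 => //; exists e.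
have Pb : P b by exists 0 => //; exists (- e).
have P0 : P (vertex h e k0) by rewrite E0; exists (t - e); [lra|exists e].
have P1 : P (vertex h e k1) by rewrite E1; exists (t - e); [lra|exists (- e)].
have cab := cP tP Pa P0 Pb; have c0b := cP tP P0 P1 Pb.
have c1b := c_anti tP Pb P1.
have czb := cP tV Vz Va Vb; have czz := cP tV Vz Vb Vz'.
have cbz := c_anti tV Vz' Vb.
move: SQ; rewrite /square_holonomy c12 c23 c30 => SQ.
rewrite -czz -czb cbz za bz -cab a1 -c0b c1b b1 -SQ; ring.
Qed.

(** The point q is on at most one cut.  If it is on one, the only new case is
    that of two points on opposite sides of it, which is [cross_slit]. *)
Lemma local_jump q : (forall j, L j q != 0) ->
    (forall i j, i != j -> offslit i q || offslit j q) ->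
    forall z z', cell q z -> cell q z' -> (forall i, Im (L i z) != 0) ->
      (forall i, Im (L i z') != 0) ->
  c z z' = potential z - potential z' + jump z z'.
Proof.
move=> q0 dq z z' Vz Vz' Uz Uz'.
have [i oi|all] := pickP (fun i => ~~ offslit i q); last first.
  have cz : cosided z z'.
    by move=> i; apply: off_aligned (Vz i) (Vz' i); move/negbFE: (all i).
  rewrite (potential_cosided cz) /jump big1 ?addr0// => i _.
  by rewrite slit_aligned ?mulr0//; exact: cz.
have oj j : j != i -> offslit j q by move=> /dq; rewrite (negbTE oi) orbF.
have ez j : j != i -> aligned (L j z) (L j z').
  by move=> ji; apply: off_aligned (oj j ji) (Vz j) (Vz' j).
have [iq rq] : Im (L i q) = 0 /\ Re (L i q) < 0.
  move: oi; rewrite /offslit negb_or negbK => /andP[/eqP i0 r0]; split=> //.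
  by have [] := complex_neq0 (q0 i); rewrite ?i0 ?eqxx// lt_neqAle => ->; rewrite leNgt.
have sidei w : side (L i q) w = (Re w < 0).
  by rewrite /side iq ltxx ltNge (ltW rq).
rewrite /jump (bigD1 i)//= big1 ?addr0; last first.
  by move=> j ji; rewrite slit_aligned ?mulr0//; exact: ez.
rewrite {1}/slit; have := Vz i; have := Vz' i; rewrite !sidei => -> -> /=.
have [iz|iz|iz] := ltgtP (Im (L i z)) 0; last by move: (Uz i); rewrite iz eqxx.
  have [iz'|iz'|iz'] := ltgtP (Im (L i z')) 0; last by move: (Uz' i); rewrite iz' eqxx.
    rewrite subrr mulr0 addr0; apply: potential_cosided => j.
    by have [->|/ez//] := eqVneq j i; constructor 2.
  have tV := cell_together q0.
  rewrite (c_anti tV Vz' Vz) (cross_slit q0 oi oj Vz' Vz)//= mulr0n mulr1n; ring.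
have [iz'|iz'|iz'] := ltgtP (Im (L i z')) 0; last by move: (Uz' i); rewrite iz' eqxx.
  rewrite (cross_slit q0 oi oj Vz Vz')//= mulr0n mulr1n; ring.
rewrite subrr mulr0 addr0; apply: potential_cosided => j.
by have [->|/ez//] := eqVneq j i; constructor 1.
Qed.

Lemma jump_cell y z z' z'' : cell y z -> cell y z' -> cell y z'' ->
  jump z z' + jump z' z'' = jump z z''.
Proof.
move=> h h' h''; rewrite /jump -big_split /=; apply: eq_bigr => i _.
by rewrite -mulrDr (slit_side K (h i) (h' i) (h'' i)).
Qed.

Lemma cell_open y z : cell y z -> nbhs z (cell y).
Proof.
move=> yz; have sn i : nbhs z (fun w => side (L i y) (L i w)).
  exact: (@continuous_aff R (l i) z _ (side_open (yz i))).
exact: filter_forall sn.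
Qed.

Lemma aff_dir i : (l i).1 != (0, 0).
Proof.
apply/negP => /eqP e; have := l_v i; rewrite e /= !mul0r addr0 => /esym /eqP.
by rewrite oner_eq0.
Qed.

(** Points at which no form is real are dense, so the identity spreads from the
    cell of one point of the segment to the next by [local_jump]. *)
Lemma segment_jump y z w : (forall i, L i y != 0) -> cell y z -> cell y w ->
    (forall i, Im (L i z) != 0) -> (forall i, Im (L i w) != 0) ->
    (forall t : R, 0 <= t <= 1 -> forall i j, i != j ->
      offslit i (combo z w t%:C%C) || offslit j (combo z w t%:C%C)) ->
  c z w = potential z - potential w + jump z w.
Proof.
move=> y0 Vz Vw Uz Uw dbl.
have tV := cell_together y0.
pose q (t : unit_interval R) := combo z w (ui_val t)%:C%C.
have cq : continuous q.
  exact: (continuous_combo (@cst_continuous _ _ z) (@cst_continuous _ _ w) (continuous_after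
    (@continuous_ui_val R) (@continuous_of_real R))).
have Vq t : cell y (q t).
  by move=> i; rewrite /q aff_combo; apply: side_convex => //; exact: ui_itv.
have qn0 t i : L i (q t) != 0.
  apply/negP => /eqP e; have [w' /(_ _ (Vq t))] := tV i.
  by rewrite e mulr0 ltxx.
pose P t := exists2 N : set C2, nbhs (q t) N & forall x, N x -> cell y x ->
  (forall i, Im (L i x) != 0) -> c z x = potential z - potential x + jump z x.
have q_zero : q zero = z.
  by rewrite /q val_zero combo0.
have q_one : q one = w.
  by rewrite /q val_one combo1.
suff /(_ one) [N] : forall t, P t.
  by rewrite q_one => /nbhs_singleton Nw h; exact: h.
apply: unit_interval_ind => [|t].
  exists (cell z); first by rewrite q_zero; apply: nbhs_cell => i; rewrite -q_zero.
  move=> x zx Vx Ux; apply: (@local_jump z) => //.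
  - by move=> i; rewrite -q_zero.
  - by move=> i j ij; rewrite /offslit (Uz i).
  - by apply: cell_refl => i; rewrite -q_zero.
exists (q @^-1` cell (q t)); first by apply: cq; apply: nbhs_cell; exact: qn0.
move=> s s' /= hs hs' [N Ns hN].
exists (cell (q t)); first exact: cell_open.
move=> x tx Vx Ux.
have [x1 [[N1 t1] V1] U1] := @generic_nbhs R E l (q s) (N `&` cell (q t) `&` cell y) aff_dir
  (filterI (filterI Ns (cell_open hs)) (cell_open (Vq s))).
rewrite -(cP tV Vz V1 Vx) (hN x1)// (local_jump (qn0 t) _ t1 tx)//.
  by rewrite -(jump_cell Vz V1 Vx); ring.
by move=> i j ij; apply: dbl => //; exact: ui_itv.
Qed.

(** Two cuts of parallel lines are disjoint, by the choice of v, and the cuts of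
    two lines that meet intersect in a subset of a real plane of codimension 2.
    A generic point w of the cell is joined to z and to z' by segments which
    avoid all these planes. *)
Lemma cell_jump y z z' : (forall i, L i y != 0) -> cell y z -> cell y z' ->
    (forall i, Im (L i z) != 0) -> (forall i, Im (L i z') != 0) ->
  c z z' = potential z - potential z' + jump z z'.
Proof.
move=> y0 Vz Vz' Uz Uz'.
have tV := cell_together y0.
(* The imaginary part of this form vanishes at x and wherever the forms of i and j
   are both real; if it is not 0 at w, no such point is on the segment from x to w. *)
pose lam (x : C2) (ij : E * E) : C * C * C :=
  let a := (Im (L ij.1 x))%:C%C in let b := (Im (L ij.2 x))%:C%C in
  (a * (l ij.2).1.1 - b * (l ij.1).1.1, a * (l ij.2).1.2 - b * (l ij.1).1.2,
   a * (l ij.2).2 - b * (l ij.1).2).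
(* A constant form cannot be made nonreal by moving w; it is replaced by a harmless one. *)
pose fam (k : (E * E) + (E * E) + E) : C * C * C :=
  match k with
  | inl (inl ij) => if (lam z ij).1 == (0, 0) then (1, 0, 0) else lam z ij
  | inl (inr ij) => if (lam z' ij).1 == (0, 0) then (1, 0, 0) else lam z' ij
  | inr i => l i
  end.
have fam0 k : (fam k).1 != (0, 0).
  have one0 : ((1, 0) : C * C) != (0, 0) by rewrite xpair_eqE oner_eq0.
  case: k => [[ij|ij]|i] /=; last exact: aff_dir.
    by case: ifP => // ->.
  by case: ifP => // ->.
have [w Vw Uw] := generic_nbhs fam0 (nbhs_cell y0).
have wU i : Im (L i w) != 0 by exact: (Uw (inr i)).
have lamE x ij u : aff (lam x ij) u =
    (Im (L ij.1 x))%:C%C * L ij.2 u - (Im (L ij.2 x))%:C%C * L ij.1 u.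
  by rewrite /lam /aff /=; ring.
have Imr (r : R) (u : C) : Im (r%:C%C * u) = r * Im u.
  by case: u => a b /=; rewrite mul0r addr0.
have ImB (u u' : C) : Im (u - u') = Im u - Im u' by case: u u' => [? ?] [? ?].
have ImD (u u' : C) : Im (u + u') = Im u + Im u' by case: u u' => [? ?] [? ?].
have key x : (forall i, Im (L i x) != 0) ->
    (forall ij, Im (aff (if (lam x ij).1 == (0, 0) then (1, 0, 0) else lam x ij) w) != 0) ->
    forall t : R, 0 <= t <= 1 -> forall i j, i != j ->
      offslit i (combo x w t%:C%C) || offslit j (combo x w t%:C%C).
  move=> Ux hw t t01 i j ij; apply/negPn/negP; rewrite negb_or /offslit !negb_or !negbK.
  move=> /andP[/andP[/eqP qi _] /andP[/eqP qj _]].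
  set q := combo x w _ in qi qj.
  have q0 : Im (aff (lam x (i, j)) q) = 0 by rewrite lamE ImB !Imr /= qi qj !mulr0 subr0.
  have x0 : Im (aff (lam x (i, j)) x) = 0 by rewrite lamE ImB !Imr /= mulrC subrr.
  have := hw (i, j); case: ((lam x (i, j)).1 =P (0, 0)) => [e _|_ wn0].
    have /= [e1 e2] : (lam x (i, j)).1.1 = 0 /\ (lam x (i, j)).1.2 = 0 by rewrite e.
    move/subr0_eq: e1 => e1; move/subr0_eq: e2 => e2.
    have ab : Im (L i x) = Im (L j x).
      have := l_v j; move/(congr1 (fun r => (Im (L i x))%:C%C * r)).
      rewrite mulrDr !mulrA e1 e2 -!mulrA -mulrDr l_v !mulr1.
      by move=> /complexI.
    have a0 : (Im (L i x))%:C%C != 0 by rewrite eq_complex /= eqxx andbT.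
    rewrite -ab in e1 e2.
    have eij : (l i).1 = (l j).1.
      by move/(mulfI a0): e1; move/(mulfI a0): e2; case: (l i).1 (l j).1 => [? ?] [? ?] /= -> ->.
    move/eqP: q0; rewrite /aff e /= !mul0r !add0r -ab -mulrBr Imr mulf_eq0 (negbTE (Ux i)) /=.
    by apply/negP; apply: l_parallel; rewrite 1?eq_sym.
  have : Im (aff (lam x (i, j)) q) =
      (1 - t) * Im (aff (lam x (i, j)) x) + t * Im (aff (lam x (i, j)) w).
    rewrite -!Imr -ImD; congr Im; rewrite /q /combo /aff /=; ring.
  rewrite q0 x0 mulr0 add0r => /esym /eqP; rewrite mulf_eq0 (negbTE wn0) orbF => /eqP t0.
  move: qi; rewrite /q t0 combo0 => /eqP.
  by apply/negP; exact: Ux.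
have hz ij := Uw (inl (inl ij)); have hz' ij := Uw (inl (inr ij)).
have e1 := segment_jump y0 Vz Vw Uz wU (key z Uz hz).
have e2 := segment_jump y0 Vz' Vw Uz' wU (key z' Uz' hz').
rewrite -(cP tV Vz Vw Vz') (c_anti tV Vz' Vw) e1 e2 -(jump_cell Vz Vw Vz').
have -> : jump w z' = - jump z' w.
  apply/eqP; rewrite -addr_eq0 (jump_cell Vw Vz' Vw) /jump big1// => i _.
  by rewrite slitxx mulr0.
ring.
Qed.

(** The potential is extended to the points on the cuts by the values of c on a
    segment to a nearby point at which no form is real. *)
Lemma cell_potential : exists d : C2 -> K, forall y, (forall i, L i y != 0) ->
  forall y' y'', cell y y' -> cell y y'' -> c y' y'' = d y' - d y'' + jump y' y''.
Proof.
have /choice[g hg] y : exists z, (forall i, L i y != 0) -> cell y z /\ forall i, Im (L i z) != 0.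
  have [y0|ny0] := pselect (forall i, L i y != 0); last by exists y.
  by have [w Vw Uw] := generic_nbhs aff_dir (nbhs_cell y0); exists w.
exists (fun y => c y (g y) - jump y (g y) + potential (g y)) => y y0.
have tV := cell_together y0.
have n0 y' : cell y y' -> forall i, L i y' != 0.
  move=> h i; apply/negP => /eqP e; have [w' /(_ _ h)] := tV i.
  by rewrite e mulr0 ltxx.
suff dE y' z : cell y y' -> cell y z -> (forall i, Im (L i z) != 0) ->
    c y' (g y') - jump y' (g y') + potential (g y') = c y' z - jump y' z + potential z.
  move=> y' y'' Vy' Vy''; have [z Vz Uz] := generic_nbhs aff_dir (nbhs_cell y0).
  rewrite (dE y' z)// (dE y'' z)// -(cP tV Vy' Vz Vy'') (c_anti tV Vy'' Vz).
  rewrite -(jump_cell Vy' Vz Vy'').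
  have -> : jump z y'' = - jump y'' z.
    apply/eqP; rewrite -addr_eq0 (jump_cell Vz Vy'' Vz) /jump big1// => i _.
    by rewrite slitxx mulr0.
  ring.
move=> Vy' Vz Uz; have [Vg Ug] := hg y' (n0 _ Vy').
have y'0 := n0 _ Vy'.
have [z1 [V1 V1'] U1] := generic_nbhs aff_dir (filterI (cell_open Vy') (nbhs_cell y'0)).
have tV' := cell_together y'0; have Vy'' := cell_refl y'0.
rewrite -(cP tV' Vy'' V1' Vg) -(jump_cell Vy'' V1' Vg) (cell_jump y'0 V1' Vg)//.
rewrite -(cP tV Vy' V1 Vz) -(jump_cell Vy' V1 Vz) (cell_jump y0 V1 Vz)//.
ring.
Qed.
End Decomposition.

(** The first cohomology of the complement: up to a coboundary, an additive
    cocycle is a combination of the crossing numbers, whose coefficients are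
    its meridians. *)
Theorem cocycle_decomposition (R : realType) (K : fieldType) (E : finType)
    (l : E -> R[i] * R[i] * R[i]) (v : R[i] * R[i]) (c : R[i] * R[i] -> R[i] * R[i] -> K) :
    (forall i, (l i).1.1 * v.1 + (l i).1.2 * v.2 = 1) ->
    (forall i j, i != j -> (l i).1 = (l j).1 -> complex.Im ((l i).2 - (l j).2) != 0) ->
    (forall P : set (R[i] * R[i]), together l P -> forall y y' y'',
      P y -> P y' -> P y'' -> c y y' + c y' y'' = c y y'') ->
  exists m d, forall y, (forall i, aff (l i) y != 0) ->
    forall y' y'', cell l y y' -> cell l y y'' ->
    c y' y'' = d y' - d y'' + \sum_i m i * slit K (aff (l i) y') (aff (l i) y'').
Proof.
move=> l_v l_parallel cP; have /choice[m hm] := meridian_const l_v cP.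
have [d hd] := cell_potential l_v l_parallel cP hm.
by exists m, d.
Qed.

(** * Loops and their winding numbers *)

Section Paths.
Variables (R : realType).
Local Notation I := (unit_interval R).

Section PathOf.
Variables (X : topologicalType) (x y : X) (g : I -> X).
Hypotheses (cg : continuous g) (g0 : g zero = x) (g1 : g one = y).
Definition path_fun of continuous g & g zero = x & g one = y := g.
HB.instance Definition _ := isContinuous.Build I X (path_fun cg g0 g1) cg.
HB.instance Definition _ := isPath.Build I X x y (path_fun cg g0 g1) g0 g1.
(** Paths are structures inferred from a function; this packs a function with
    explicit proofs. *)
Definition path_of : {path I from x to y} := path_fun cg g0 g1.
Lemma path_ofE : (path_of : I -> X) = g. Proof. by []. Qed.
End PathOf.

Section Subtype.
Variables (T : topologicalType) (S : set T).
Lemma val_continuous : continuous (val : S -> T).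
Proof. exact: initial_continuous. Qed.

Lemma corestrict (Y : topologicalType) (f : Y -> T) : continuous f -> (forall y, S (f y)) ->
  exists g : Y -> S, continuous g /\ forall y, val (g y) = f y.
Proof.
move=> cf fS; exists (fun y => @exist _ (fun x => x \in S) (f y) (mem_set (fS y))); split=> //.
apply: (continuous_comp_initial (w := set_val)) => y; exact: cf.
Qed.
End Subtype.
End Paths.

Section Lasso.
Variables (R : realType) (X : topologicalType) (x : X).
Local Notation I := (unit_interval R).
Local Notation homotopic := (@path_homotopic R X).

(** Closing up paths by fixed paths from x turns a homomorphism from the
    fundamental group into an additive function of paths, by [lassoM]. *)
Definition lasso (y y' : X) (g : {path I from x to y}) (q : {path I from y to y'})
    (g' : {path I from x to y'}) : fundamental_group R x :=
  loop_class (concat (concat g q) (reverse g')).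

Lemma lasso_homotopic y y' (g : {path I from x to y}) (q q' : {path I from y to y'})
    (g' : {path I from x to y'}) : homotopic y y' q q' -> lasso g q g' = lasso g q' g'.
Proof.
move=> qq'; apply/loop_classP; apply: concat_homotopic; last exact: path_homotopic_refl.
by apply: concat_homotopic => //; exact: path_homotopic_refl.
Qed.

Lemma lassoM y y' y'' (g : {path I from x to y}) (q : {path I from y to y'})
    (g' : {path I from x to y'}) (q' : {path I from y' to y''}) (g'' : {path I from x to y''}) :
  (lasso g q g' * lasso g' q' g'')%g = lasso g (concat q q') g''.
Proof.
rewrite [LHS]pi1_mulE; apply/loop_classP.
have refl (a b : X) (p : {path I from a to b}) := path_homotopic_refl p.
apply: path_homotopic_trans (concatA _ _ _) _.
apply: concat_homotopic (refl _ _ _).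
apply: path_homotopic_trans (path_homotopic_sym (concatA _ _ _)) _.
apply: path_homotopic_trans (path_homotopic_sym (concatA _ _ _)) _.
apply: concat_homotopic (refl _ _ _) _.
apply: concat_homotopic (refl _ _ _) _.
apply: path_homotopic_trans (concatA _ _ _) _.
apply: path_homotopic_trans (concat_homotopic (concatVp _) (refl _ _ _)) _.
exact: concat1p.
Qed.
End Lasso.

Section LoopWinding.
Variables (R : realType) (K : fieldType) (X : topologicalType) (x : X).
Local Notation I := (unit_interval R).
Local Notation C := R[i].
Implicit Types F G H : X -> C.

Definition loop_winding F (a : fundamental_group R x) : K := winding K (F \o loop_repr a).

Lemma winding_homotopic F y y' p q : continuous F -> (forall z, F z != 0) ->
  @path_homotopic R X y y' p q -> winding K (F \o p) = winding K (F \o q).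
Proof.
move=> cF F0; exact: (holonomy_homotopic 0 cF (fun z => slit_cocycle K (F0 z))).
Qed.

Lemma loop_windingE F (p : {path I from x to x}) : continuous F -> (forall z, F z != 0) ->
  loop_winding F (loop_class p) = winding K (F \o p).
Proof.
move=> cF F0; apply: (winding_homotopic cF F0 (y := x) (y' := x)).
by apply/loop_classP; exact: loop_reprK.
Qed.

Lemma winding_concat_path F y y' y'' (p : {path I from y to y'}) (q : {path I from y' to y''}) :
  continuous F -> (forall z, F z != 0) ->
  winding K (F \o concat p q) = winding K (F \o p) + winding K (F \o q).
Proof.
move=> cF F0; rewrite -winding_concat.
- congr winding; apply/funext => t; rewrite /= /concat_fun.
  by rewrite (fun_if F).
- exact: continuous_after (@continuous_pathE _ _ _ _ p) cF.
- exact: continuous_after (@continuous_pathE _ _ _ _ q) cF.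
- by rewrite /= path_one path_zero.
- by move=> t; exact: F0.
- by move=> t; exact: F0.
Qed.

Lemma loop_windingM F (a b : fundamental_group R x) : continuous F -> (forall z, F z != 0) ->
  loop_winding F (a * b)%g = loop_winding F a + loop_winding F b.
Proof.
move=> cF F0; rewrite [X in loop_winding F X = _](_ : _ = loop_class (concat (loop_repr a)
  (loop_repr b)))//.
by rewrite loop_windingE// winding_concat_path.
Qed.

(** The winding numbers along g and along its reverse cancel. *)
Lemma loop_winding_lasso F y (g : {path I from x to y}) (q : {path I from y to y}) :
  continuous F -> (forall z, F z != 0) ->
  loop_winding F (lasso g q g) = winding K (F \o q).
Proof.
move=> cF F0; rewrite loop_windingE// !winding_concat_path//.
have := winding_homotopic cF F0 (concatpV g); rewrite winding_concat_path//.
have -> : winding K (F \o constant_path R x) = 0.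
  by rewrite -(winding_cst K (F0 x)).
move=> h; rewrite addrAC h add0r //.
Qed.

Lemma loop_winding_scale F (u : C) a : u != 0 -> continuous F -> (forall z, F z != 0) ->
  loop_winding (fun z => u * F z) a = loop_winding F a.
Proof.
move=> u0 cF F0; apply: (winding_scale K u0).
- exact: continuous_after (@continuous_pathE _ _ _ _ _) cF.
- by move=> t; exact: F0.
- by rewrite /= path_one path_zero.
Qed.

Lemma loop_winding_cst (u : C) a : u != 0 -> loop_winding (fun=> u) a = 0.
Proof. by move=> u0; exact: winding_cst. Qed.

(** The quotient F / H maps X to the plane punctured at 0 and 1, and 1 - F / H is
    G / H; so this is [winding_commute] for the quotient. *)
Lemma commuting_relation F G H a b : continuous F -> continuous G -> continuous H ->
    (forall z, F z != 0) -> (forall z, G z != 0) -> (forall z, H z != 0) ->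
    (forall z, F z + G z = H z) -> (a * b = b * a)%g ->
  (loop_winding F a - loop_winding H a) * (loop_winding G b - loop_winding H b) =
  (loop_winding F b - loop_winding H b) * (loop_winding G a - loop_winding H a).
Proof.
move=> cF cG cH F0 G0 H0 FGH ab.
pose q z := F z / H z.
have cq : continuous q := continuousC_mul cF (continuousC_inv cH H0).
have q0 z : q z != 0 by rewrite mulf_neq0// invr_eq0.
have q1 z : 1 - q z = G z / H z.
  by rewrite /q -(mulfV (H0 z)) -mulrBl -FGH addrC addKr.
have q10 z : 1 - q z != 0 by rewrite q1 mulf_neq0// invr_eq0.
have cl (p : {path I from x to x}) (f : X -> C) (cf : continuous f) : continuous (f \o p).
  exact: continuous_after (@continuous_pathE _ _ _ _ p) cf.
have lp (p : {path I from x to x}) (f : X -> C) : f (p zero) = f (p one).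
  by rewrite path_zero path_one.
have e1 (p : {path I from x to x}) : winding K (q \o p) = winding K (F \o p) - winding K (H \o p).
  exact: (winding_div K (cl p F cF) (cl p H cH) (fun t => F0 _) (fun t => H0 _) (lp p F) (lp p H)).
have e2 (p : {path I from x to x}) : winding K (fun t =>
  1 - q (p t)) = winding K (G \o p) - winding K (H \o p).
  rewrite -(winding_div K (cl p G cG) (cl p H cH) (fun t => G0 _) (fun t =>
    H0 _) (lp p G) (lp p H)).
  by congr winding; apply/funext => t; rewrite q1.
rewrite /loop_winding -!e1 -!e2.
apply: (@winding_commute R K X q x (loop_repr a) (loop_repr b)) => //.
- exact: continuous_pathE.
- exact: continuous_pathE.
- exact: path_zero.
- exact: path_one.
- exact: path_zero.
- exact: path_one.
by apply/loop_classP.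
Qed.
End LoopWinding.

Section Torus.
Variables (R : realType) (X : topologicalType) (x : X).
Local Notation I := (unit_interval R).

(** Both products are homotopic to the diagonal of the torus. *)
Lemma torus_commute (T : I * I -> X) (g : {path I from x to T (zero, zero)})
    (p q : {path I from T (zero, zero) to T (zero, zero)}) : continuous T ->
    (forall s, T (zero, s) = T (one, s)) -> (forall t, T (t, zero) = T (t, one)) ->
    (forall t, p t = T (t, zero)) -> (forall s, q s = T (zero, s)) ->
  (lasso g p g * lasso g q g = lasso g q g * lasso g p g)%g.
Proof.
move=> cT T1 T2 pE qE; rewrite !lassoM; apply: lasso_homotopic.
have h1 := diag_homotopic cT.
have cT' : continuous (fun z : I * I => T (z.2, z.1)).
  by apply: continuous_after cT; apply: continuous_paired => z; [exact: cvg_snd|exact: cvg_fst].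
have h2 := diag_homotopic cT'.
have e : T (one, one) = T (zero, zero) by rewrite -T1 T2.
rewrite /= e in h1 h2.
have ep : concat_fun p q = concat_fun (fun t => T (t, zero)) (fun t => T (one, t)).
  by apply/funext => t; rewrite /concat_fun pE qE T1.
have eq : concat_fun q p = concat_fun (fun t => T (zero, t)) (fun t => T (t, one)).
  by apply/funext => t; rewrite /concat_fun pE qE T2.
suff : path_homotopic (T (zero, zero)) (T (zero, zero)) (concat_fun p q) (concat_fun q p) by [].
rewrite ep eq; exact: path_homotopic_trans (path_homotopic_sym h1) h2.
Qed.
End Torus.

(** * Homomorphisms from the fundamental group to a field *)

Section HomDecomposition.
Variables (R : realType) (K : fieldType) (E : finType).
Local Notation I := (unit_interval R).
Local Notation C := R[i].
Local Notation C2 := (C * C)%type.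
Local Notation Re := (@complex.Re R).
Local Notation Im := (@complex.Im R).
Variables (l : E -> C * C * C) (S : set C2).
Hypothesis hS : forall z, S z <-> forall i, aff (l i) z != 0.

Hypothesis l_dir : forall i, (l i).1 != (0, 0).
Hypothesis l_distinct : forall i j, i != j -> ~ proportional (l i) (l j).

Local Notation L i := (fun z : S => aff (l i) (val z)).

Lemma L_continuous i : continuous (L i).
Proof. exact: continuous_after (@val_continuous _ S) (@continuous_aff R (l i)). Qed.

Lemma valS (z : S) : S (val z).
Proof. by have := valP z; rewrite inE. Qed.

Lemma L_neq0 i (z : S) : L i z != 0.
Proof. exact: (proj1 (hS (val z)) (valS z) i). Qed.

(** The complex line through the two points is punctured at finitely many
    points. *)
Lemma path_exists (y y' : S) : exists p : {path I from y to y'}, True.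
Proof.
have [tau [ct t0 t1 tn]] := @punctured_segment R E predT (fun j => L j y) (fun j => L j y')
  (fun j _ => L_neq0 j y) (fun j _ => L_neq0 j y').
have cf := continuous_combo (@cst_continuous _ _ (val y)) (@cst_continuous _ _ (val y')) ct.
have fS t : S (combo (val y) (val y') (tau t)).
  by apply/hS => i; rewrite aff_combo; exact: tn.
have [g [cg gE]] := corestrict cf fS.
have g0 : g zero = y by apply: val_inj; rewrite gE t0 combo0.
have g1 : g one = y' by apply: val_inj; rewrite gE t1 combo1.
by exists (path_of cg g0 g1).
Qed.

Lemma halfplane_S z : (forall i, exists w : C, 0 < Re (w * aff (l i) z)) -> S z.
Proof.
move=> h; apply/hS => i; have [w hw] := h i; apply/negP => /eqP e.
by move: hw; rewrite e mulr0 ltxx.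
Qed.

(** The straight-line homotopy stays in the complement. *)
Lemma halfplane_homotopic (y y' : S) (p q : {path I from y to y'}) :
    (forall i, exists w : C, forall t, 0 < Re (w * L i (p t)) /\ 0 < Re (w * L i (q t))) ->
  path_homotopic y y' p q.
Proof.
move=> h.
have cp : continuous (fun z : I * I => val (p z.1) : C2).
  apply: continuous_after (@val_continuous _ S);
    apply: continuous_after (@continuous_pathE _ _ _ _ p).
  by move=> ?; exact: cvg_fst.
have cq : continuous (fun z : I * I => val (q z.1) : C2).
  apply: continuous_after (@val_continuous _ S);
    apply: continuous_after (@continuous_pathE _ _ _ _ q).
  by move=> ?; exact: cvg_fst.
have cs : continuous (fun z : I * I => (ui_val z.2)%:C%C : C).
  by apply: continuous_after (@continuous_of_real R); exact: continuous_val2.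
have cf := continuous_combo cp cq cs.
have fS z : S (combo (val (p z.1)) (val (q z.1)) (ui_val z.2)%:C%C).
  apply: halfplane_S => i; have [w hw] := h i; exists w; rewrite aff_combo.
  by apply: Re_combo; [exact: ui_itv|case: (hw z.1)..].
have [g [cg gE]] := corestrict cf fS.
exists g; split=> //.
- by split=> t; apply: val_inj; rewrite gE /= ?val_zero ?val_one ?combo0 ?combo1.
- by split=> t; apply: val_inj; rewrite gE /= ?path_zero ?path_one combo_same.
Qed.

Definition straight (y y' : S) (q : I -> S) :=
  forall t, val (q t) = combo (val y) (val y') (ui_val t)%:C%C.

Lemma straight_exists (y y' : S) :
    (forall i, exists w : C, 0 < Re (w * L i y) /\ 0 < Re (w * L i y')) ->
  exists q : {path I from y to y'}, straight y y' q.
Proof.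
move=> h.
have cf := continuous_combo (@cst_continuous _ _ (val y)) (@cst_continuous _ _ (val y'))
  (continuous_after (@continuous_ui_val R) (@continuous_of_real R)).
have fS t : S (combo (val y) (val y') (ui_val t)%:C%C).
  apply: halfplane_S => i; have [w [h1 h2]] := h i; exists w; rewrite aff_combo.
  by apply: Re_combo => //; exact: ui_itv.
have [g [cg gE]] := corestrict cf fS.
have g0 : g zero = y by apply: val_inj; rewrite gE val_zero combo0.
have g1 : g one = y' by apply: val_inj; rewrite gE val_one combo1.
by exists (path_of cg g0 g1).
Qed.

Lemma straight_half y y' (q : I -> S) (w : C) i : straight y y' q ->
  0 < Re (w * L i y) -> 0 < Re (w * L i y') -> forall t, 0 < Re (w * L i (q t)).
Proof. by move=> sq h h' t; rewrite /= sq aff_combo; apply: Re_combo => //; exact: ui_itv. Qed.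

Variables (x : S) (f : fundamental_group R x -> K).
Hypothesis fM : forall a b, f (a * b)%g = f a + f b.

Let to_point (y : S) : {path I from x to y} := projT1 (cid (path_exists x y)).

Definition seg_val (z z' : C2) (k : K) := exists (y y' : S) (q : {path I from y to y'}),
  [/\ val y = z, val y' = z', straight y y' q & k = f (lasso (to_point y) q (to_point y'))].

Lemma seg_val_unique z z' k k' : seg_val z z' k -> seg_val z z' k' -> k = k'.
Proof.
move=> [y [y' [q [<- <- sq ->]]]] [y1 [y1' [q1 [e e' sq1 ->]]]].
move/val_inj: e => e; move/val_inj: e' => e'; subst y1 y1'.
congr (f _); apply: lasso_homotopic.
have -> : (q1 : I -> S) = q.
  by apply/funext => t; apply: val_inj; rewrite sq sq1.
exact: path_homotopic_refl.
Qed.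

(** The additive cocycle of the homomorphism f: the segment from z to z' is
    closed up by the chosen paths from the base point.  The value is 0 if the
    segment meets the arrangement. *)
Definition seg (z z' : C2) : K :=
  if pselect (exists k, seg_val z z' k) is left h then projT1 (cid h) else 0.

Lemma segE (y y' : S) (q : {path I from y to y'}) : straight y y' q ->
  seg (val y) (val y') = f (lasso (to_point y) q (to_point y')).
Proof.
move=> sq; have h : seg_val (val y) (val y') (f (lasso (to_point y) q
  (to_point y'))) by exists y, y', q.
rewrite /seg; case: pselect => [h'|[]]; last by eexists; exact: h.
by case: (cid h') => k hk /=; exact: seg_val_unique hk h.
Qed.

(** The triangle with these vertices lies in the complement. *)
Lemma seg_cocycle (P : set C2) : together l P -> forall y y' y'',
  P y -> P y' -> P y'' -> seg y y' + seg y' y'' = seg y y''.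
Proof.
move=> tP.
have PS z : P z -> exists y : S, val y = z.
  move=> Pz; have Sz : S z by apply: halfplane_S => i; have [w hw] := tP i; exists w; exact: hw.
  by exists (exist _ z (mem_set Sz)).
move=> z z' z'' Pz Pz' Pz''.
have [y ey] := PS z Pz; have [y' ey'] := PS z' Pz'; have [y'' ey''] := PS z'' Pz''.
subst z z' z''.
have st (a b : S) : P (val a) -> P (val b) -> exists q : {path I from a to b}, straight a b q.
  by move=> Pa Pb; apply: straight_exists => i; have [w hw] := tP i; exists w; split; exact: hw.
have [q sq] := st y y' Pz Pz'; have [q' sq'] := st y' y'' Pz' Pz''.
have [r sr] := st y y'' Pz Pz''.
rewrite (segE sq) (segE sq') (segE sr) -fM lassoM; congr (f _); apply: lasso_homotopic.
apply: halfplane_homotopic => i; have [w hw] := tP i; exists w => t.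
split; last exact: (straight_half sr (hw _ Pz) (hw _ Pz'')).
rewrite /concat /= /concat_fun; case: ifP => _.
  exact: (straight_half sq (hw _ Pz) (hw _ Pz')).
exact: (straight_half sq' (hw _ Pz') (hw _ Pz'')).
Qed.

Definition between (s t r : I) : I := clamp (ui_val s + ui_val r * (ui_val t - ui_val s)).

Lemma between_continuous s t : continuous (between s t).
Proof.
apply: continuous_clamp; apply: continuousR_add; first exact: cst_continuous.
by apply: continuousR_mul; [exact: continuous_ui_val|exact: cst_continuous].
Qed.
Lemma between0 s t : between s t zero = s.
Proof. by rewrite /between val_zero mul0r addr0 clampK. Qed.
Lemma between1 s t : between s t one = t.
Proof. by rewrite /between val_one mul1r addrC subrK clampK. Qed.

Lemma between_near (t s s' u : I) (e : R) : `|ui_val t - ui_val s| < e ->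
  `|ui_val t - ui_val s'| < e -> `|ui_val t - ui_val (between s s' u)| < e.
Proof.
rewrite /between; have := ui_itv u; have := ui_itv s; have := ui_itv s'.
move: (ui_val s) (ui_val s') (ui_val t) (ui_val u) =>
  a b m r /andP[b0 b1] /andP[a0 a1] /andP[r0 r1].
have [h1 h2] : Num.min a b <= a + r * (b - a) /\ a + r * (b - a) <= Num.max a b.
  have [ab|/ltW ab] := leP a b.
    have : 0 <= r * (b - a) <= b - a by rewrite mulr_ge0 ?ler_piMl ?subr_ge0.
    by move=> /andP[? ?]; split; lra.
  have : 0 <= r * (a - b) <= a - b by rewrite mulr_ge0 ?ler_piMl ?subr_ge0.
  by move=> /andP[? ?]; split; lra.
rewrite !ltr_norml => /andP[? ?] /andP[? ?].
move: h1 h2; rewrite ge_min le_max => h1 h2.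
have mid : 0 <= a + r * (b - a) <= 1.
  by case/orP: h1 => ?; case/orP: h2 => ?; apply/andP; split; lra.
by rewrite val_clampE//; case/orP: h1 => ?; case/orP: h2 => ?; apply/andP; split; lra.
Qed.

Lemma subpath_exists (p : I -> S) (s t : I) (y y' : S) : continuous p -> p s = y -> p t = y' ->
  exists q : {path I from y to y'}, (q : I -> S) = p \o between s t.
Proof.
move=> cp ps pt; have cq : continuous (p \o between s t) :=
  continuous_after (@between_continuous s t) cp.
have q0 : (p \o between s t) zero = y by rewrite /= between0.
have q1 : (p \o between s t) one = y' by rewrite /= between1.
by exists (path_of cq q0 q1).
Qed.

Lemma subpath_concat (p : I -> S) (s t r : I) (y y' y'' : S) (q : {path I from y to y'})
    (q' : {path I from y' to y''}) (q'' : {path I from y to y''}) : continuous p ->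
    p s = y -> p r = y'' ->
    (q : I -> S) = p \o between s t -> (q' : I -> S) = p \o between t r ->
    (q'' : I -> S) = p \o between s r ->
  path_homotopic y y'' (concat q q') q''.
Proof.
move=> cp ps pr qE qE' qE''.
pose a := path_of (@between_continuous s t) (between0 s t) (between1 s t).
pose b := path_of (@between_continuous t r) (between0 t r) (between1 t r).
have cphi : continuous (concat a b : I -> I) by exact: continuous_pathE.
have := reparametrize_homotopic cp cphi (@between_continuous s r).
rewrite !path_zero !path_one between0 between1 => /(_ erefl erefl).
have -> : p \o concat a b = concat q q'.
  by apply/funext => u; rewrite /= /concat_fun qE qE'; case: ifP.
by rewrite -qE'' ps pr.
Qed.

Lemma f1 : f 1%g = 0.
Proof. by apply: (addrI (f 1%g)); rewrite -fM mul1g addr0. Qed.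

Lemma f_lasso (q : {path I from x to x}) (g : {path I from x to x}) :
  f (lasso g q g) = f (loop_class q).
Proof.
have e : lasso g q g = (loop_class g * loop_class q * loop_class (reverse g))%g.
  have -> : (loop_class g * loop_class q)%g = loop_class (concat g q) := pi1_mulE g q.
  exact: (esym (pi1_mulE (concat g q) (reverse g))).
have e' : (loop_class g * loop_class (reverse g) = 1)%g.
  apply: etrans (pi1_mulE g (reverse g)) _; apply/loop_classP; exact: concatpV.
by rewrite e !fM addrAC -fM e' f1 add0r.
Qed.

(** The initial part of p up to time t, closed up by the chosen path, is a
    section of the cocycle along p. *)
Lemma hom_section (p : {path I from x to x}) : exists psi : I -> K,
  [/\ parallel (translate seg) (val \o p) psi, psi zero = 0 & psi one = f (loop_class p)].
Proof.
have cp : continuous p by exact: continuous_pathE.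
have subP t : exists q : {path I from x to p t}, (q : I -> S) = p \o between zero t.
  by apply: subpath_exists => //; exact: path_zero.
pose sub t := projT1 (cid (subP t)).
have subE t : (sub t : I -> S) = p \o between zero t := projT2 (cid (subP t)).
exists (fun t => f (lasso (to_point x) (sub t) (to_point (p t)))); split.
- move=> t.
  have nc : nbhs t [set s | cell l (val (p t)) (val (p s))].
    have := @nbhs_cell R E l (val (p t)) (fun i => L_neq0 i (p t)).
    by move=> nb; apply: (continuous_after cp (@val_continuous _ S)).
  have [e e0 he] := nbhs_ui_ball nc.
  exists [set s : I | `|ui_val t - ui_val s| < e]; first exact: nbhs_ui.
  move=> s s' /= hs hs'.
  have [q qE] := @subpath_exists p s s' (p s) (p s') cp erefl erefl.
  have bt u : cell l (val (p t)) (val (p (between s s' u))).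
    by apply: he; exact: between_near.
  have Vs : cell l (val (p t)) (val (p s)) by have := bt zero; rewrite between0.
  have Vs' : cell l (val (p t)) (val (p s')) by have := bt one; rewrite between1.
  have tV := cell_together (fun i => L_neq0 i (p t)).
  have [r sr] : exists r : {path I from p s to p s'}, straight (p s) (p s') r.
    by apply: straight_exists => i; have [w hw] := tV i; exists w; split; exact: hw.
  rewrite /translate /= (segE sr) -fM lassoM; congr (f _); apply: lasso_homotopic.
  apply: path_homotopic_sym; apply: path_homotopic_trans _ (subpath_concat cp _ _
    (subE s) qE (subE s')) => //.
    apply: concat_homotopic; first exact: path_homotopic_refl.
    apply: halfplane_homotopic => i; have [w hw] := tV i; exists w => u; split.
      exact: (straight_half sr (hw _ Vs) (hw _ Vs')).
    by rewrite qE; apply: hw; exact: bt.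
  exact: path_zero.
- have : forall y (e : p zero = y) (q : {path I from x to y}), (q : I ->
  S) = p \o between zero zero ->
     f (lasso (to_point x) (sub zero) (to_point (p zero))) = f (lasso (to_point x) q (to_point y)).
    move=> y; case: y / => q qE; congr (f _); apply: lasso_homotopic.
    by rewrite subE -qE; exact: path_homotopic_refl.
  move=> /(_ x (path_zero : p zero = x) (constant_path R x)) ->.
    rewrite f_lasso; exact: f1.
  apply/funext => t; rewrite /= /between val_zero subr0 mulr0 addr0.
  by rewrite clamp_le0// path_zero.
- have : forall y (e : p one = y) (q : {path I from x to y}), (q : I ->
  S) = p \o between zero one ->
     f (lasso (to_point x) (sub one) (to_point (p one))) = f (lasso (to_point x) q (to_point y)).
    move=> y; case: y / => q qE; congr (f _); apply: lasso_homotopic.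
    by rewrite subE -qE; exact: path_homotopic_refl.
  move=> /(_ x (path_one : p one = x) p) ->; first exact: f_lasso.
  apply/funext => t; rewrite /= /between val_zero val_one subr0 mulr1 add0r.
  by rewrite clampK.
Qed.

(** Each form is divided by the value of its linear part on a generic direction.
    Multiplying this direction by a generic complex number keeps the cuts of parallel lines
    disjoint. *)
Lemma normalize : exists (v : C2) (u : E -> C), [/\ forall i, u i != 0,
  forall i, (rescale (u i) (l i)).1.1 * v.1 + (rescale (u i) (l i)).1.2 * v.2 = 1 &
  forall i j, i != j -> (rescale (u i) (l i)).1 = (rescale (u j) (l j)).1 ->
    Im ((rescale (u i) (l i)).2 - (rescale (u j) (l j)).2) != 0].
Proof.
have [d hd] := generic_direction l_dir.
pose m i := (l i).1.1 * d.1 + (l i).1.2 * d.2.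
pose e (ij : E * E) := (l ij.1).2 / m ij.1 - (l ij.2).2 / m ij.2.
have ab ij : (if e ij == 0 then 1 else Im (e ij)) != 0 \/ (if e ij == 0 then 0 else Re (e ij)) != 0.
  by case: (eqVneq (e ij) 0) => [_|/complex_neq0 []]; [left; exact: oner_neq0|right|left].
have [s hs] := affine_avoid ab.
pose r : C := (1 +i* s)%C.
have r0 : r != 0 by rewrite eq_complex /= oner_eq0.
exists (r^-1 * d.1, r^-1 * d.2), (fun i => r / m i); split=> [i|i|i j ij].
- by rewrite mulf_neq0 ?invr_eq0 ?r0 ?(hd i).
- rewrite /rescale /=.
  have -> : r / m i * (l i).1.1 * (r^-1 * d.1) + r / m i * (l i).1.2 * (r^-1 * d.2) =
     (r / r) * (m i / m i) by rewrite {3}/m; ring.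
  by rewrite (divff r0) (divff (hd i : m i != 0)) mulr1.
have [m0 m0'] : m i != 0 /\ m j != 0 by split; exact: hd.
rewrite /rescale /= => -[e1 e2].
have eE : r / m i * (l i).2 - r / m j * (l j).2 = r * e (i, j) by rewrite /e /=; ring.
rewrite eE; have := hs (i, j); case: (eqVneq (e (i, j)) 0) => [e0 _|_].
  exfalso; apply: (l_distinct ij); exists (m j / m i).
  have sol (a b : C) : r / m i * a = r / m j * b -> b = m j / m i * a.
    move=> h; have : r / m j * b * (m j / r) = r / m i * a * (m j / r) by rewrite h.
    have -> : r / m j * b * (m j / r) = (r / r) * (m j / m j) * b by ring.
    have -> : r / m i * a * (m j / r) = (r / r) * (m j / m i * a) by ring.
    by rewrite (divff r0) (divff m0') !mul1r.
  have e3 : r / m i * (l i).2 = r / m j * (l j).2.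
    by apply: subr0_eq; rewrite eE e0 mulr0.
  rewrite /rescale -(sol _ _ e1) -(sol _ _ e2) -(sol _ _ e3).
  by case: (l j) => [[? ?] ?].
by case: (e (i, j)) => a b /=; rewrite mul1r mulrC.
Qed.

(** The winding numbers about the lines span the first cohomology of the group:
    [cocycle_decomposition] is summed along a loop. *)
Theorem hom_decomposition : exists k : E -> K, forall a : fundamental_group R x,
  f a = \sum_i k i * loop_winding K (L i) a.
Proof.
have [v [u [u0 uv upar]]] := normalize.
have coc (P : set C2) : together (fun i => rescale (u i) (l i)) P -> forall y y' y'',
    P y -> P y' -> P y'' -> seg y y' + seg y' y'' = seg y y''.
  move=> tP; apply: seg_cocycle => i; have [w hw] := tP i; exists (w * u i) => y /hw.
  by rewrite aff_rescale mulrA.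
have [m [d md]] := cocycle_decomposition uv upar coc.
exists m => a; rewrite -[a in LHS](loop_reprK a); set p := loop_repr a.
have [psi [ppsi psi0 <-]] := hom_section p.
have cp : continuous p by exact: continuous_pathE.
pose l' i := rescale (u i) (l i).
have l'0 i (z : S) : aff (l' i) (val z) != 0.
  by rewrite aff_rescale mulf_neq0//; exact: L_neq0.
pose g i (t : I) := aff (l' i) (val (p t)).
have cg i : continuous (g i).
  exact: continuous_after (continuous_after cp (@val_continuous _ S)) (@continuous_aff R (l' i)).
have sec i : exists w, [/\ parallel (translate (slit K)) (g i) w,
  w zero = 0 & w one = winding K (g i)].
  by apply: holonomy_section => // t; apply: slit_cocycle; exact: l'0.
have /choice[w hw] := sec.
pose psi' t := d (val (p zero)) - d (val (p t)) + \sum_i m i * w i t.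
have ppsi' : parallel (translate seg) (val \o p) psi'.
  move=> t.
  have /choice[V hV] i : exists V : set I, nbhs t V /\
      forall s s', V s -> V s' -> w i s' = translate (slit K) (g i s) (g i s') (w i s).
    by have [pw _ _] := hw i; have [V Vt h] := pw t; exists V.
  have nV : nbhs t [set s | forall i, V i s].
    have nVi i : nbhs t (V i) by case: (hV i).
    exact: filter_forall nVi.
  have nc : nbhs t [set s | cell l' (val (p t)) (val (p s))].
    have := @nbhs_cell R E l' (val (p t)) (fun i => l'0 i (p t)).
    by move=> nb; apply: (continuous_after cp (@val_continuous _ S)).
  exists ([set s | forall i, V i s] `&` [set s | cell l' (val (p t)) (val (p s))]);
    first exact: filterI.
  move=> s s' [Vs cs] [Vs' cs'].
  rewrite /translate /psi' /= (md _ (fun i => l'0 i (p t)) _ _ cs cs').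
  have -> : \sum_i m i * w i s' = \sum_i m i * w i s +
      \sum_i m i * slit K (aff (l' i) (val (p s))) (aff (l' i) (val (p s'))).
    rewrite -big_split /=; apply: eq_bigr => i _; rewrite -mulrDr.
    by case: (hV i) => _ h; rewrite (h s s').
  ring.
have psi'0 : psi zero = psi' zero.
  rewrite psi0 /psi' subrr add0r big1// => i _.
  by case: (hw i) => _ -> _; rewrite mulr0.
rewrite (parallel_unique ppsi ppsi' psi'0) /psi' path_zero path_one subrr add0r.
apply: eq_bigr => i _; case: (hw i) => _ _ ->; congr (_ * _).
rewrite -(loop_winding_scale K a (u0 i) (@L_continuous i) (L_neq0 i)).
by congr winding; apply/funext => t; rewrite /g aff_rescale.
Qed.
End HomDecomposition.

(** * Commuting loops *)

Section Tori.
Variables (R : realType) (K : fieldType) (E : finType).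
Local Notation I := (unit_interval R).
Local Notation C := R[i].
Local Notation C2 := (C * C)%type.
Local Notation Re := (@complex.Re R).
Local Notation Im := (@complex.Im R).

Lemma bounded_turn (t : I) : bounded_by 2 (turn t).
Proof.
have /andP[/andP[? ?] /andP[? ?]] := turn_lt2 t.
by split; rewrite ler_norml; apply/andP; split; lra.
Qed.

Variables (l : E -> C * C * C) (S : set C2).
Hypothesis hS : forall z, S z <-> forall i, aff (l i) z != 0.
Hypothesis l_dir : forall i, (l i).1 != (0, 0).
Hypothesis l_distinct : forall i j, i != j -> ~ proportional (l i) (l j).
Local Notation L i := (fun z : S => aff (l i) (val z)).
Variable x : S.
Local Notation w := (fun i (a : fundamental_group R x) => loop_winding K (L i) a).
Local Notation lin i q := ((l i).1.1 * q.1 + (l i).1.2 * q.2).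

Definition det2 (p q : C * C * C) := p.1.1 * q.1.2 - q.1.1 * p.1.2.

Lemma parallel_scale i j : det2 (l i) (l j) = 0 ->
  exists2 u : C, u != 0 & (l j).1 = (u * (l i).1.1, u * (l i).1.2).
Proof.
move=> /subr0_eq d0; have := l_dir i; have := l_dir j.
case: (l i) (l j) d0 => [[a b] c] [[a' b'] c'] /= d0.
rewrite !xpair_eqE !negb_and => hj hi.
have [a0|a0] := eqVneq a 0.
  move: hi; rewrite a0 eqxx /= => b0; move: d0 => /esym/eqP;
    rewrite a0 mul0r mulf_eq0 (negbTE b0) orbF => /eqP a'0.
  exists (b' / b); last by rewrite a'0 mulr0 divfK.
  by move: hj; rewrite a'0 eqxx /= => ?; rewrite mulf_neq0// invr_eq0.
have eb : b' = a' / a * b.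
  by apply: (mulfI a0); rewrite d0 mulrA mulrCA mulfV// mulr1.
exists (a' / a); last by rewrite divfK// -eb.
rewrite mulf_neq0 ?invr_eq0//; apply/negP => /eqP a'0; move: hj.
by rewrite eb a'0 !mul0r eqxx.
Qed.

Lemma concurrent_transverse i j (p : C2) : i != j -> aff (l i) p = 0 -> aff (l j) p = 0 ->
  det2 (l i) (l j) != 0.
Proof.
move=> ij ip jp; apply/negP => /eqP /parallel_scale [u u0 e].
apply: (l_distinct ij); exists u; move: e ip jp; rewrite /aff /rescale.
case: (l j) (l i) => [[a' b'] c'] [[a b] c] /= [-> ->] ip jp; congr (_, _, _).
apply/subr0_eq.
have -> : c' - u * c = (u * a * p.1 + u * b * p.2 + c') - u * (a * p.1 + b * p.2 + c) by ring.
by rewrite ip jp mulr0 subr0.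
Qed.

Lemma affL i : continuous (L i). Proof. exact: L_continuous. Qed.
Lemma affL0 i : forall z : S, L i z != 0. Proof. exact: (L_neq0 hS). Qed.

(** After rescaling, the sum of the two forms is a nonzero constant, whose
    winding number is 0. *)
Lemma commute_parallel i j a b : i != j -> det2 (l i) (l j) = 0 -> (a * b = b * a)%g ->
  w i a * w j b - w i b * w j a = 0.
Proof.
move=> ij d0 ab; have [u u0 e] := parallel_scale d0.
pose c := (l j).2 - u * (l i).2.
have c0 : c != 0.
  apply/negP => /eqP /subr0_eq c0; apply: (l_distinct ij); exists u; rewrite /rescale.
  by move: e c0; case: (l j) => [[? ?] ?] /= [-> ->] ->.
have nu0 : - u != 0 by rewrite oppr_eq0.
have FGH (z : S) : - u * L i z + L j z = c.
  by rewrite /c; move: e; rewrite /aff; case: (l j) => [[? ?] ?] /= [-> ->]; ring.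
have := commuting_relation K (continuousC_mul (@cst_continuous _ C (- u)) (@affL i))
  (@affL j) (@cst_continuous _ C c)
  (fun z => mulf_neq0 nu0 (affL0 i z)) (affL0 j) (fun=> c0) FGH ab.
rewrite !(loop_winding_scale K _ nu0 (@affL i) (affL0 i)) !loop_winding_cst// !subr0 => ->.
exact: subrr.
Qed.

(** By Cramer's rule there is a linear relation between three concurrent forms,
    with nonzero coefficients. *)
Lemma commute_concurrent i j k (p : C2) a b : i != j -> i != k -> j != k ->
    aff (l i) p = 0 -> aff (l j) p = 0 -> aff (l k) p = 0 -> (a * b = b * a)%g ->
  w i a * w j b - w i b * w j a =
  (w i a * w k b - w i b * w k a) + (w k a * w j b - w k b * w j a).
Proof.
move=> ij ik jk ip jp kp ab.
have d1 := concurrent_transverse jk jp kp.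
have d2 : det2 (l k) (l i) != 0 by apply: (concurrent_transverse _ kp ip); rewrite eq_sym.
have d3 : - det2 (l i) (l j) != 0 by rewrite oppr_eq0; exact: (concurrent_transverse ij ip jp).
have FGH (z : S) : det2 (l j) (l k) * L i z + det2 (l k) (l i) * L j z = - det2 (l i) (l j) * L k z.
  have dif m : aff (l m) p = 0 -> L m z = (l m).1.1 * ((val z).1 - p.1) + (l m).1.2 *
    ((val z).2 - p.2).
    by move=> h; rewrite -[LHS]subr0 -h /aff; ring.
  by rewrite (dif i ip) (dif j jp) (dif k kp) /det2; ring.
have := commuting_relation K (continuousC_mul (@cst_continuous _ C _) (@affL i))
  (continuousC_mul (@cst_continuous _ C _) (@affL j))
  (continuousC_mul (@cst_continuous _ C _) (@affL k))
  (fun z => mulf_neq0 d1 (affL0 i z)) (fun z => mulf_neq0 d2 (affL0 j z))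
  (fun z => mulf_neq0 d3 (affL0 k z)) FGH ab.
rewrite !(loop_winding_scale K _ d1 (@affL i) (affL0 i)).
rewrite !(loop_winding_scale K _ d2 (@affL j) (affL0 j)).
rewrite !(loop_winding_scale K _ d3 (@affL k) (affL0 k)).
move: (w i a) (w j a) (w k a) (w i b) (w j b) (w k b) => ia ja ka ib jb kb h.
have -> : ia * jb - ib * ja = ((ia - ka) * (jb - kb) - (ib - kb) * (ja - ka)) +
  ((ia * kb - ib * ka) + (ka * jb - kb * ja)) by ring.
by rewrite h subrr add0r.
Qed.

Lemma loop_realize (h : I -> C2) : continuous h -> h zero = h one -> (forall t, S (h t)) ->
  exists a : fundamental_group R x, forall i, w i a = winding K (fun t => aff (l i) (h t)).
Proof.
move=> ch h01 hSt; have [g [cg gE]] := corestrict ch hSt.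
have g1 : g one = g zero by apply: val_inj; rewrite !gE.
have [r _] := path_exists hS x (g zero).
exists (lasso r (path_of cg erefl g1) r) => i.
rewrite loop_winding_lasso; [|exact: affL|exact: affL0].
by congr winding; apply/funext => t; rewrite /= path_ofE gE.
Qed.

Lemma winding_turn_scale (u : C) : u != 0 -> winding K (fun t => u * turn t) = 1.
Proof.
move=> u0; rewrite (winding_scale K u0 (@turn_continuous R) (@turn_neq0 R) (@turn01 R)).
exact: winding_turn.
Qed.

Lemma generic_point i : exists p : C2, aff (l i) p = 0 /\ forall j, j != i -> aff (l j) p != 0.
Proof.
have [p0 hp0] : exists p0 : C2, aff (l i) p0 = 0.
  have := l_dir i; rewrite /aff; case: (l i) => [[a b] c] /=;
    rewrite xpair_eqE negb_and => /orP[h|h].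
    by exists (- c / a, 0) => /=; rewrite mulr0 addr0 mulrC divfK// addNr.
  by exists (0, - c / b) => /=; rewrite mulr0 add0r mulrC divfK// addNr.
pose q : C2 := (- (l i).1.2, (l i).1.1).
have linq j : lin j q = det2 (l i) (l j) by rewrite /q /det2 /=; ring.
have ab j : (if j == i then 1 else aff (l j) p0) != 0 \/ (if j == i then 1 else lin j q) != 0.
  have [_|ji] := eqVneq j i; first by left; exact: oner_neq0.
  have [e|e] := eqVneq (aff (l j) p0) 0; last by left.
  by right; rewrite linq; apply: (concurrent_transverse _ hp0 e); rewrite eq_sym.
have [s hs] := affine_avoidC ab.
exists (p0.1 + s%:C%C * q.1, p0.2 + s%:C%C * q.2).
have e j : aff (l j) (p0.1 + s%:C%C * q.1, p0.2 + s%:C%C * q.2) = aff (l j) p0 + lin j q * s%:C%C.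
  by rewrite /aff /=; ring.
split=> [|j ji]; rewrite e; last by have := hs j; rewrite (negbTE ji).
by rewrite hp0 linq /det2 mulrC subrr mulr0 addr0.
Qed.

Lemma transverse i : exists u : C2, lin i u != 0.
Proof. by have [u hu] := generic_direction l_dir; exists u. Qed.

Lemma halfplane_neq0 (v z : C) : 0 < Re (v * z) -> z != 0.
Proof. by move=> h; apply/negP => /eqP e; move: h; rewrite e mulr0 ltxx. Qed.

(** A small circle around a point of line i which is on no other line. *)
Lemma meridian i : exists a, forall j, w j a = (j == i)%:R.
Proof.
have [p [pi pj]] := generic_point i; have [u ui] := transverse i.
have [e e0 he] : exists2 e0, 0 < e0 & forall e, 0 < e -> e < e0 -> forall j, j != i ->
    exists v : C, forall t : I, 0 < Re (v * (aff (l j) p + e%:C%C * (turn t * lin j u))).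
  apply: small_forall => j; have [ji|ji] := boolP (j != i); last by exists 1.
  have [v [e0 e00 h]] := small_perturb (2 * (`|Re (lin j u)| + `|Im (lin j u)|) +
     2 * (`|Re (lin j u)| + `|Im (lin j u)|)) (pj j ji).
  exists e0 => // e ep el _; exists v => t; apply: h => //.
  exact: bounded_mul (bounded_turn t) (bounded_self _).
have e2 : 0 < e / 2 by rewrite divr_gt0.
have e2e : e / 2 < e by lra.
have {he}he := he _ e2 e2e.
set d := e / 2 in e2 he.
pose h (t : I) : C2 := (p.1 + d%:C%C * turn t * u.1, p.2 + d%:C%C * turn t * u.2).
have hE j t : aff (l j) (h t) = aff (l j) p + d%:C%C * (turn t * lin j u).
  by rewrite /aff /h /=; ring.
have hEi t : aff (l i) (h t) = (d%:C%C * lin i u) * turn t.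
  by rewrite hE pi add0r; ring.
have d0 : d%:C%C * lin i u != 0.
  by rewrite mulf_neq0// eq_complex /= eqxx andbT gt_eqF.
have ct := @turn_continuous R.
have ch : continuous h.
  apply: continuous_paired.
    exact: (continuousC_add (@cst_continuous _ C p.1) (continuousC_mul (continuousC_mul
      (@cst_continuous _ C _) ct) (@cst_continuous _ C u.1))).
  exact: (continuousC_add (@cst_continuous _ C p.2) (continuousC_mul (continuousC_mul
    (@cst_continuous _ C _) ct) (@cst_continuous _ C u.2))).
have h01 : h zero = h one by rewrite /h turn01.
have [|a ha] := loop_realize ch h01.
  move=> t; apply/hS => j; have [->|ji] := eqVneq j i.
    by rewrite hEi mulf_neq0// turn_neq0.
  by have [v hv] := he j ji; rewrite hE; exact: halfplane_neq0 (hv t).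
exists a => j; rewrite ha; have [->|ji] := eqVneq j i.
  rewrite -(winding_turn_scale d0); congr winding.
  by apply/funext => t; rewrite hEi.
have [v hv] := he j ji; apply: (winding_halfplane K (w := v)).
- exact: continuous_after ch (@continuous_aff R (l j)).
- by rewrite h01.
- by move=> t; rewrite hE.
Qed.

(** In a small ball around p the outer circle multiplies the vector from p by a
    nonzero complex number, so it turns once about each line through p; the inner circle
    is a small circle around line i in a punctured line transverse to it. *)
Lemma torus i k (p : C2) : i != k -> aff (l i) p = 0 -> aff (l k) p = 0 ->
  exists a b, [/\ (a * b = b * a)%g, forall j, w j a = (aff (l j) p == 0)%:R &
    forall j, w j b = (j == i)%:R].
Proof.
move=> ik ip kp; have [u ui] := transverse i.
(* the direction of line i *)
pose q : C2 := (- (l i).1.2, (l i).1.1).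
have linq j : lin j q = det2 (l i) (l j) by rewrite /q /det2 /=; ring.
have linqi : lin i q = 0 by rewrite linq /det2 mulrC subrr.
have linqj j : j != i -> aff (l j) p = 0 -> lin j q != 0.
  by move=> ji jp; rewrite linq; apply: (concurrent_transverse _ ip jp); rewrite eq_sym.
have bt := bounded_turn.
have [e e0 he] : exists2 e0, 0 < e0 & forall e, 0 < e -> e < e0 -> forall j, j != i ->
  aff (l j) p = 0 ->
    exists v : C, forall t : I, 0 < Re (v * (lin j q + e%:C%C * (turn t * lin j u))).
  apply: small_forall => j; have [ji|ji] := boolP (j != i); last by exists 1.
  have [jp|jp] := eqVneq (aff (l j) p) 0; last by exists 1 => // ? _ _ _ e; move: jp;
    rewrite e eqxx.
  have [v [e0 e00 h]] := small_perturb (2 * (`|Re (lin j u)| + `|Im (lin j u)|) +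
     2 * (`|Re (lin j u)| + `|Im (lin j u)|)) (linqj j ji jp).
  exists e0 => // e ep el _ _; exists v => t; apply: h => //.
  exact: bounded_mul (bounded_turn t) (bounded_self _).
have e2 : 0 < e / 2 by rewrite divr_gt0.
have e2e : e / 2 < e by lra.
have {he}he := he _ e2 e2e.
set r := e / 2 in e2 he.
(* the linear part of form j along the inner circle *)
pose nu j s := lin j q + r%:C%C * (turn s * lin j u).
have [f f0 hf] : exists2 e0, 0 < e0 & forall e, 0 < e -> e < e0 -> forall j, aff (l j) p != 0 ->
    exists v : C, forall t s : I, 0 < Re (v * (aff (l j) p + e%:C%C * (turn t * nu j s))).
  apply: small_forall => j; have [jp|jp] := boolP (aff (l j) p != 0); last by exists 1.
  have bnu s := bounded_add (bounded_self (lin j q))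
    (bounded_mul (bounded_self r%:C%C) (bounded_mul (bt s) (bounded_self (lin j u)))).
  have [B hB] : exists B, forall t s, bounded_by B (turn t * nu j s).
    by eexists => t s; exact: bounded_mul (bt t) (bnu s).
  have [v [e0' e00 h]] := small_perturb B jp.
  by exists e0' => // x0 xp xl _; exists v => t s; apply: h => //; exact: hB.
have f2 : 0 < f / 2 by rewrite divr_gt0.
have f2f : f / 2 < f by lra.
have {hf}hf := hf _ f2 f2f.
set d := f / 2 in f2 hf.
(* d is the radius of the outer circle and r that of the inner one, relative to it *)
pose T (z : I * I) : C2 := (p.1 + d%:C%C * turn z.1 * (q.1 + r%:C%C * turn z.2 * u.1),
   p.2 + d%:C%C * turn z.1 * (q.2 + r%:C%C * turn z.2 * u.2)).
have TE j z : aff (l j) (T z) = aff (l j) p + d%:C%C * (turn z.1 * nu j z.2).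
  by rewrite /aff /T /nu /=; ring.
have TEp j z : aff (l j) p = 0 -> aff (l j) (T z) = d%:C%C * turn z.1 * nu j z.2.
  by move=> jp; rewrite TE jp add0r mulrA.
have nui s : nu i s = r%:C%C * lin i u * turn s by rewrite /nu linqi add0r; ring.
have d0 : d%:C%C != 0 by rewrite eq_complex /= eqxx andbT gt_eqF.
have r0 : r%:C%C * lin i u != 0.
  by rewrite mulf_neq0// eq_complex /= eqxx andbT gt_eqF.
have nu0 j s : aff (l j) p = 0 -> nu j s != 0.
  move=> jp; have [->|ji] := eqVneq j i; first by rewrite nui mulf_neq0// turn_neq0.
  by have [v hv] := he j ji jp; exact: halfplane_neq0 (hv s).
have ct := @turn_continuous R.
have ct1 : continuous (fun z : I * I => turn z.1) by apply: continuous_after ct => ?;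
  exact: cvg_fst.
have ct2 : continuous (fun z : I * I => turn z.2) by apply: continuous_after ct => ?;
  exact: cvg_snd.
have cT : continuous T.
  have cc (p1 q1 u1 : C) : continuous (fun z : I * I =>
    p1 + d%:C%C * turn z.1 * (q1 + r%:C%C * turn z.2 * u1)).
    exact: (continuousC_add (@cst_continuous _ C p1) (continuousC_mul (continuousC_mul
      (@cst_continuous _ C _) ct1)
      (continuousC_add (@cst_continuous _ C q1) (continuousC_mul (continuousC_mul
        (@cst_continuous _ C _) ct2) (@cst_continuous _ C u1))))).
  by apply: continuous_paired; exact: cc.
have cT1 : continuous (fun t => T (t, zero)).
  exact: (continuous_after (continuous_paired (@continuous_identity _)
    (@cst_continuous _ _ zero)) cT).
have cT2 : continuous (fun t => T (zero, t)).
  exact: (continuous_after (continuous_paired (@cst_continuous _ _ zero)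
    (@continuous_identity _)) cT).
have TS z : S (T z).
  apply/hS => j; have [jp|jp] := eqVneq (aff (l j) p) 0.
    by rewrite TEp// mulf_neq0 ?nu0// mulf_neq0// turn_neq0.
  by have [v hv] := hf j jp; rewrite TE; exact: halfplane_neq0 (hv z.1 z.2).
have [G [cG GE]] := corestrict cT TS.
have G1 s : G (zero, s) = G (one, s) by apply: val_inj; rewrite !GE /T /= turn01.
have G2 t : G (t, zero) = G (t, one) by apply: val_inj; rewrite !GE /T /= turn01.
have c1 : continuous (fun t => G (t, zero)).
  exact: (continuous_after (continuous_paired (@continuous_identity _)
    (@cst_continuous _ _ zero)) cG).
have c2 : continuous (fun t => G (zero, t)).
  exact: (continuous_after (continuous_paired (@cst_continuous _ _ zero)
    (@continuous_identity _)) cG).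
pose P := path_of c1 erefl (esym (G1 zero)).
pose Q := path_of c2 erefl (esym (G2 zero)).
have [g _] := path_exists hS x (G (zero, zero)).
exists (lasso g P g), (lasso g Q g); split.
- exact: (@torus_commute R _ x G g P Q).
- move=> j; rewrite loop_winding_lasso; [|exact: affL|exact: affL0].
  have -> : L j \o P = (fun t => aff (l j) (T (t, zero))) by apply/funext => t;
    rewrite /= path_ofE GE.
  have [jp|jp] := eqVneq (aff (l j) p) 0.
    rewrite -(winding_turn_scale (mulf_neq0 d0 (nu0 j zero jp))); congr winding.
    by apply/funext => t; rewrite TEp//= mulrAC.
  have [v hv] := hf j jp; apply: (winding_halfplane K (w := v)).
  + exact: (continuous_after cT1 (@continuous_aff R (l j))).
  + by rewrite /T /= turn01.
  + by move=> t; rewrite TE.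
- move=> j; rewrite loop_winding_lasso; [|exact: affL|exact: affL0].
  have -> : L j \o Q = (fun t => aff (l j) (T (zero, t))) by apply/funext => t;
    rewrite /= path_ofE GE.
  have cj : continuous (fun t => aff (l j) (T (zero, t))).
    exact: (continuous_after cT2 (@continuous_aff R (l j))).
  have [->|ji] := eqVneq j i.
    rewrite -(winding_turn_scale (mulf_neq0 (mulf_neq0 d0 (turn_neq0 zero)) r0)); congr winding.
    by apply/funext => t; rewrite TEp//= nui mulrA.
  have [jp|jp] := eqVneq (aff (l j) p) 0.
    have dt : d%:C%C * turn (zero : I) != 0 by rewrite mulf_neq0// turn_neq0.
    have [v hv] := he j ji jp; apply: (winding_halfplane K (w :=
      v / (d%:C%C * turn (zero : I)))) => //.
      by rewrite /T /= turn01.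
    move=> t; rewrite (TEp j (zero, t) jp) mulrA divfK; [exact: hv|exact: dt].
  have [v hv] := hf j jp; apply: (winding_halfplane K (w := v)) => //.
    by rewrite /T /= turn01.
  by move=> t; rewrite TE.
Qed.
End Tori.

(** * The rank inequality *)

(** If J were smaller than T, the rows X t would satisfy a nontrivial linear
    relation on J.  It would then hold for the diagonal matrix D, whose diagonal
    entries are not zero. *)
Lemma triangular_rank (K : fieldType) (V T : finType) (J : {set V}) (X : T -> V -> K)
    (D : T -> T -> K) (s : T -> K) :
    (forall c : T -> K, (forall v, v \in J -> \sum_t c t * X t v = 0) ->
       forall t', \sum_t c t * D t t' = 0) ->
    (forall t t', D t t' = if t == t' then s t else 0) -> (forall t, s t != 0) ->
  (#|T| <= #|J|)%N.
Proof.
move=> vanish De s0; rewrite leqNgt; apply/negP => lt.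
pose M : 'M[K]_(#|T|, #|J|) := \matrix_(i, j) X (enum_val i) (enum_val j).
have : kermx M != 0.
  rewrite kermx_eq0 /row_free; apply: contraTneq lt => e.
  by rewrite -leqNgt -e; exact: rank_leq_col.
move=> /rowV0Pn [v vk vn0].
pose c t := v 0 (enum_rank t).
have vc (F : T -> K) : \sum_t c t * F t = \sum_i v 0 i * F (enum_val i).
  rewrite (reindex (enum_val (A := T))) /=; last exact: (onW_bij _ (enum_val_bij T)).
  by apply: eq_bigr => i _; rewrite /c enum_valK.
have cX u : u \in J -> \sum_t c t * X t u = 0.
  move=> uJ; rewrite vc; have /sub_kermxP := vk.
  move=> /matrixP /(_ 0 (enum_rank_in uJ u)); rewrite !mxE => e.
  by rewrite -[RHS]e; apply: eq_bigr => i _; rewrite mxE enum_rankK_in.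
have c0 t : c t = 0.
  have := vanish c cX t; rewrite (bigD1 t)//= big1 ?addr0.
    by rewrite De eqxx => /eqP; rewrite mulf_eq0 (negbTE (s0 t)) orbF => /eqP.
  by move=> t' tt; rewrite De (negbTE tt) mulr0.
case/eqP: vn0; apply/rowP => i; rewrite mxE.
by have := c0 (enum_val i); rewrite /c enum_valK.
Qed.

Section Points.
Variable R : realType.
Local Notation C := R[i].

Definition meet_point (p q : C * C * C) : C * C :=
  ((q.2 * p.1.2 - p.2 * q.1.2) / det2 p q, (p.2 * q.1.1 - q.2 * p.1.1) / det2 p q).

Lemma meet_pointP p q : det2 p q != 0 -> aff p (meet_point p q) = 0 /\ aff q (meet_point p q) = 0.
Proof.
rewrite /meet_point /aff /=; case: p q => [[a b] c] [[a' b'] c'] /=.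
set d := det2 _ _ => d0.
split.
  have -> : a * ((c' * b - c * b') / d) + b * ((c * a' - c' * a) / d) + c =
    - (c * (d / d)) + c by rewrite {3}/d /det2 /=; ring.
  by rewrite divff// mulr1 addNr.
have -> : a' * ((c' * b - c * b') / d) + b' * ((c * a' - c' * a) / d) + c' =
  - (c' * (d / d)) + c' by rewrite {3}/d /det2 /=; ring.
by rewrite divff// mulr1 addNr.
Qed.

Lemma meet_point_unique p q z : det2 p q != 0 -> aff p z = 0 -> aff q z = 0 -> z = meet_point p q.
Proof.
rewrite /meet_point /aff; case: p q z => [[a b] c] [[a' b'] c'] [z1 z2] /=.
set d := det2 _ _ => d0 h h'.
congr (_, _); apply: (mulIf d0); rewrite divfK//.
  rewrite /d /det2 /=.
  have -> : z1 * (a * b' - a' * b) = (a * z1 + b * z2 + c) * b' - (a' * z1 + b' * z2 + c') * b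
    + (c' * b - c * b') by ring.
  by rewrite h h' !mul0r subrr add0r.
rewrite /d /det2 /=.
have -> : z2 * (a * b' - a' * b) = (a' * z1 + b' * z2 + c') * a - (a * z1 + b * z2 + c) * a'
    + (c * a' - c' * a) by ring.
by rewrite h h' !mul0r subrr add0r.
Qed.
End Points.

Section Families.
Variables (R : realType) (U : finType).
Local Notation C := R[i].
Local Notation C2 := (C * C)%type.
Variables (l : U -> C * C * C) (rk : U -> nat).
Hypothesis l_dir : forall i, (l i).1 != (0, 0).
Hypothesis l_distinct : forall i j, i != j -> ~ proportional (l i) (l j).

Local Notation pt ik := (meet_point (l ik.1) (l ik.2)).

(** For each intersection point p, one pair for each line through p other than
    the line of least rank through p.  Their number is the second Betti number
    of the complement. *)
Definition basic_pairs (B : {set U}) : {set U * U} :=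
  [set ik | [&& ik.1 \in B, ik.2 \in B, ik.1 != ik.2, det2 (l ik.1) (l ik.2) != 0 &
     [forall j in B, (aff (l j) (pt ik) == 0) ==> (rk ik.2 <= rk j)%N]]].

Lemma basic_pairsP (B : {set U}) i k : reflect
  [/\ i \in B, k \in B, i != k, det2 (l i) (l k) != 0 &
    forall j, j \in B -> aff (l j) (pt (i, k)) = 0 -> (rk k <= rk j)%N]
  ((i, k) \in basic_pairs B).
Proof.
rewrite inE /=; apply: (iffP and5P) => -[h1 h2 h3 h4 h5]; split=> //.
  by move=> j jB jp; have /forall_inP/(_ j jB)/implyP := h5; apply; apply/eqP.
by apply/forall_inP => j jB; apply/implyP => /eqP; exact: h5.
Qed.

(** Two lines through p are compared through the line k of least rank through p,
    for which Z i j = Z i k + Z k j. *)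
Lemma basic_determine (K : fieldType) (B : {set U}) (Z : U -> U -> K) :
    (forall i j, i \in B -> j \in B -> Z j i = - Z i j) ->
    (forall i j, i \in B -> j \in B -> i != j -> det2 (l i) (l j) = 0 -> Z i j = 0) ->
    (forall i j k p, i \in B -> j \in B -> k \in B -> i != j -> i != k -> j != k ->
      aff (l i) p = 0 -> aff (l j) p = 0 -> aff (l k) p = 0 -> Z i j = Z i k + Z k j) ->
    (forall ik, ik \in basic_pairs B -> Z ik.1 ik.2 = 0) ->
  forall i j, i \in B -> j \in B -> i != j -> Z i j = 0.
Proof.
move=> anti par conc basic i j iB jB ij.
have [d0|d0] := eqVneq (det2 (l i) (l j)) 0; first exact: par.
have [ip jp] := meet_pointP d0; set p := meet_point _ _ in ip jp.
pose Q := [pred k | (k \in B) && (aff (l k) p == 0)].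
have Qi : Q i by rewrite /= iB ip eqxx.
case: (arg_minnP rk Qi) => k /andP[kB /eqP kp] kmin.
have basick m : m \in B -> aff (l m) p = 0 -> m != k -> Z m k = 0.
  move=> mB mp mk; apply: (basic (m, k)).
  have dm : det2 (l m) (l k) != 0 by exact: (concurrent_transverse l_dir l_distinct mk mp kp).
  apply/basic_pairsP; split=> // r rB; rewrite /= -(meet_point_unique dm mp kp) => rp.
  by apply: kmin; rewrite /= rB rp eqxx.
have [ik|ik] := eqVneq i k.
  by rewrite -[LHS]opprK -anti// ik basick ?oppr0// eq_sym -ik.
have [jk|jk] := eqVneq j k; first by rewrite jk basick.
rewrite (conc i j k p)// basick// add0r -[LHS]opprK -anti// basick ?oppr0//.
Qed.
End Families.

Section RankInequality.
Variables (R : realType) (K : fieldType) (U : finType).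
Local Notation C := R[i].
Local Notation C2 := (C * C)%type.
Variables (l : U -> C * C * C) (rk : U -> nat).
Hypothesis l_dir : forall i, (l i).1 != (0, 0).
Hypothesis l_distinct : forall i j, i != j -> ~ proportional (l i) (l j).
Hypothesis rk_inj : injective rk.
Variables (S S1 S2 : set C2) (B1 B2 : {set U}).
Hypothesis hS : forall z, S z <-> forall i, aff (l i) z != 0.
Hypothesis hS1 : forall z, S1 z <-> forall i, i \in B1 -> aff (l i) z != 0.
Hypothesis hS2 : forall z, S2 z <-> forall i, i \in B2 -> aff (l i) z != 0.
Variables (x : S) (x1 : S1) (x2 : S2).
Local Notation G := (fundamental_group R x).
Local Notation G1 := (fundamental_group R x1).
Local Notation G2 := (fundamental_group R x2).
Variables (f : G -> (G1 * G2)%type) (g : (G1 * G2)%type -> G).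
Hypothesis fM : forall a b, f (a * b)%g = (f a * f b)%g.
Hypothesis fK : cancel f g.
Hypothesis gK : cancel g f.

Definition turns (T : set C2) (y : T) (u : U) (a : fundamental_group R y) : K :=
  loop_winding K (fun z : T => aff (l u) (val z)) a.

Lemma sub_dir (B : {set U}) (i : {i | i \in B}) : (l (val i)).1 != (0, 0).
Proof. exact: l_dir. Qed.
Lemma sub_distinct (B : {set U}) (i j : {i | i \in B}) : i != j ->
  ~ proportional (l (val i)) (l (val j)).
Proof. by move=> ij; apply: l_distinct. Qed.
Lemma sub_complement (B : {set U}) (T : set C2) :
    (forall z, T z <-> forall i, i \in B -> aff (l i) z != 0) ->
  forall z, T z <-> forall i : {i | i \in B}, aff (l (val i)) z != 0.
Proof.
move=> hT z; split=> [/hT h i|h]; first exact: h (valP i).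
by apply/hT => i iB; exact: (h (exist _ i iB)).
Qed.

Lemma turnsM (B : {set U}) (T : set C2) (y : T) u (a b : fundamental_group R y) :
    (forall z, T z <-> forall i, i \in B -> aff (l i) z != 0) -> u \in B ->
  turns u (a * b)%g = turns u a + turns u b.
Proof.
move=> hT uB; apply: loop_windingM.
  exact: continuous_after (@val_continuous _ T) (@continuous_aff R (l u)).
by move=> z; apply: (proj1 (hT (val z))) => //; exact: valS.
Qed.

Lemma turns1 (B : {set U}) (T : set C2) (y : T) u :
    (forall z, T z <-> forall i, i \in B -> aff (l i) z != 0) -> u \in B ->
  turns u (1%g : fundamental_group R y) = 0.
Proof.
move=> hT uB; apply: (addrI (turns u (1%g : fundamental_group R y))).
by rewrite -(turnsM _ _ hT uB) mul1g addr0.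
Qed.

Lemma gM a b : g (a * b)%g = (g a * g b)%g.
Proof. by apply: (can_inj fK); rewrite fM !gK. Qed.

Let h1 (u : U) (a : G) : K := turns u (f a).1.
Let h2 (u : U) (a : G) : K := turns u (f a).2.

Lemma hom_span (h : G -> K) : (forall a b, h (a * b)%g = h a + h b) ->
  exists k : U -> K, forall a, h a = \sum_u k u * turns u a.
Proof. exact: (hom_decomposition hS l_dir l_distinct). Qed.

Let t1 : finType := {ik : U * U | ik \in basic_pairs l rk B1}.
Let t2 : finType := {ik : U * U | ik \in basic_pairs l rk B2}.
Let t3 : finType := {ik : U * U | ik \in finset.setX B2 B1}.
Let T : finType := (t1 + t2 + t3)%type.

Let coord (t : T) : (G -> K) * (G -> K) :=
  match t with
  | inl (inl ik) => (h1 (val ik).1, h1 (val ik).2)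
  | inl (inr ik) => (h2 (val ik).1, h2 (val ik).2)
  | inr ik => (h2 (val ik).1, h1 (val ik).2)
  end.

Let wedge (h h' : G -> K) (a b : G) : K := h a * h' b - h b * h' a.

Lemma coord_hom t : (forall a b, (coord t).1 (a * b)%g = (coord t).1 a + (coord t).1 b) /\
  (forall a b, (coord t).2 (a * b)%g = (coord t).2 a + (coord t).2 b).
Proof.
have e1 u : u \in B1 -> forall a b, h1 u (a * b)%g = h1 u a + h1 u b.
  by move=> uB a b; rewrite /h1 fM; exact: turnsM hS1 uB.
have e2 u : u \in B2 -> forall a b, h2 u (a * b)%g = h2 u a + h2 u b.
  by move=> uB a b; rewrite /h2 fM; exact: turnsM hS2 uB.
case: t => [[[[i k] h]|[[i k] h]]|[[i k] h]] /=.
- by have /basic_pairsP[iB kB _ _ _] := h; split; exact: e1.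
- by have /basic_pairsP[iB kB _ _ _] := h; split; exact: e2.
- by have := h; rewrite inE /= => /andP[iB kB]; split; [exact: e2|exact: e1].
Qed.

Let sgn (t : T) : K := match t with inr _ => 1 | _ => -1 end.

(** The tori attached to the basic pairs are dual to the coordinates at the basic
    pairs, up to sign. *)
Lemma torus_in (B : {set U}) (V : set C2) (y : V) ik :
    (forall z, V z <-> forall i, i \in B -> aff (l i) z != 0) -> ik \in basic_pairs l rk B ->
  exists a b : fundamental_group R y, (a * b = b * a)%g /\
    forall ik', ik' \in basic_pairs l rk B ->
    turns ik'.1 a * turns ik'.2 b - turns ik'.1 b * turns ik'.2 a = if ik == ik' then -1 else 0.
Proof.
case: ik => i k hV /basic_pairsP[iB kB ik d0 kmin].
have [ip kp] := meet_pointP d0; set p := meet_point _ _ in ip kp.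
pose i' : {i | i \in B} := exist _ i iB; pose k' : {i | i \in B} := exist _ k kB.
have ik' : i' != k' by [].
have [a [b [ab ha hb]]] := torus K (sub_complement hV) (@sub_dir B) (@sub_distinct B) y ik' ip kp.
have {}ha j : j \in B -> turns j a = (aff (l j) p == 0)%:R by move=> jB; exact: (ha (exist _ j jB)).
have {}hb j : j \in B -> turns j b = (j == i)%:R by move=> jB; exact: (hb (exist _ j jB)).
exists a, b; split=> // -[m n] /basic_pairsP[mB nB mn dmn nmin] /=.
rewrite !ha// !hb//.
have [[<- <-]|ne] := eqVneq (i, k) (m, n).
  by rewrite ip kp !eqxx (negbTE (_ : k != i)) 1?eq_sym// mulr0 mulr1 sub0r.
have [mp|mp] := eqVneq (aff (l m) p) 0; last first.
  have [mi|mi] := eqVneq m i; first by move: mp; rewrite mi ip eqxx.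
  by rewrite /= !mul0r subrr.
have [np|np] := eqVneq (aff (l n) p) 0; last first.
  have [ni|ni] := eqVneq n i; first by move: np; rewrite ni ip eqxx.
  by rewrite /= !mulr0 subrr.
have nk : n = k.
  apply: rk_inj; apply/eqP; rewrite eqn_leq.
  have pE := meet_point_unique dmn mp np.
  by rewrite nmin ?kmin//= -pE.
move: ne; rewrite nk xpair_eqE eqxx andbT eq_sym => mi.
by rewrite (negbTE mi) (negbTE (_ : k != i)) 1?eq_sym// !mulr0 mul0r subrr.
Qed.

Lemma meridian_in (B : {set U}) (V : set C2) (y : V) i :
    (forall z, V z <-> forall i, i \in B -> aff (l i) z != 0) -> i \in B ->
  exists a : fundamental_group R y, forall j, j \in B -> turns j a = (j == i)%:R.
Proof.
move=> hV iB.
have [a ha] := meridian K (sub_complement hV) (@sub_dir B) (@sub_distinct B) y (exist _ i iB).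
by exists a => j jB; exact: (ha (exist _ j jB)).
Qed.

(** The tori of the two factors, together with the pairs formed by a meridian in
    one factor and a meridian in the other, are dual to the chosen coordinates. *)
Lemma commuting_witness (t : T) : exists ab : G * G, (ab.1 * ab.2 = ab.2 * ab.1)%g /\
  forall t', wedge (coord t').1 (coord t').2 ab.1 ab.2 = if t == t' then sgn t else 0.
Proof.
have w1 u : u \in B1 -> turns u (1%g : G1) = 0 by move=> uB; exact: turns1 hS1 uB.
have w2 u : u \in B2 -> turns u (1%g : G2) = 0 by move=> uB; exact: turns1 hS2 uB.
have in1 (ik : t1) : (val ik).1 \in B1 /\ (val ik).2 \in B1.
  by case: ik => -[i k] h /=; have /basic_pairsP[? ? _ _ _] := h.
have in2 (ik : t2) : (val ik).1 \in B2 /\ (val ik).2 \in B2.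
  by case: ik => -[i k] h /=; have /basic_pairsP[? ? _ _ _] := h.
have in3 (ik : t3) : (val ik).1 \in B2 /\ (val ik).2 \in B1.
  by case: ik => -[i k] h /=; have := h; rewrite inE /= => /andP[].
case: t => [[ik|ik]|ik].
- have [a [b [ab hab]]] := torus_in x1 hS1 (valP ik).
  exists (g (a, 1%g), g (b, 1%g)); split=> /=.
    by rewrite -!gM; congr g; apply/eqP; rewrite xpair_eqE; apply/andP; split; apply/eqP.
  rewrite /wedge; case=> [[ik'|ik']|ik'] /=; rewrite /h1 /h2 !gK /=.
  + by rewrite (hab _ (valP ik')).
  + by have [? ?] := in2 ik'; rewrite !w2// !mul0r subrr.
  + by have [? ?] := in3 ik'; rewrite !w2// !mul0r subrr.
- have [a [b [ab hab]]] := torus_in x2 hS2 (valP ik).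
  exists (g (1%g, a), g (1%g, b)); split=> /=.
    by rewrite -!gM; congr g; apply/eqP; rewrite xpair_eqE; apply/andP; split; apply/eqP.
  rewrite /wedge; case=> [[ik'|ik']|ik'] /=; rewrite /h1 /h2 !gK /=.
  + by have [? ?] := in1 ik'; rewrite !w1// !mul0r subrr.
  + by rewrite (hab _ (valP ik')).
  + by have [? ?] := in3 ik'; rewrite !w1// !mulr0 subrr.
- have [iB kB] := in3 ik.
  have [a ha] := meridian_in x2 hS2 iB; have [b hb] := meridian_in x1 hS1 kB.
  exists (g (1%g, a), g (b, 1%g)); split=> /=.
    rewrite -!gM; congr g; apply/eqP; rewrite xpair_eqE.
    by apply/andP; split; apply/eqP; rewrite /= ?mul1g ?mulg1.
  rewrite /wedge; case=> [[ik'|ik']|ik'] /=; rewrite /h1 /h2 !gK /=.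
  + by have [? ?] := in1 ik'; rewrite !w1// mul0r mulr0 subrr.
  + by have [? ?] := in2 ik'; rewrite !w2// mul0r mulr0 subrr.
  + have [? ?] := in3 ik'; rewrite !w1// !w2// mul0r subr0 ha// hb// -natrM mulnb.
    rewrite -[inr ik == inr ik']/(ik == ik') -val_eqE -pair_eqE /pair_eq [in RHS]eq_sym.
    rewrite [X in _ = if _ && X then _ else _]eq_sym; by case: ifP.
Qed.

(** The isomorphism expresses the winding numbers of the factors through those of
    G by [hom_span]; so the forms of the commuting pairs of the product are
    determined by forms of G, and these by their values at its basic pairs. *)
Theorem rank_inequality :
  (#|basic_pairs l rk B1| + #|basic_pairs l rk B2| +
    #|B2| * #|B1| <= #|basic_pairs l rk finset.setT|)%N.
Proof.
have /choice[ab hab] := commuting_witness.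
pose w (u : U) (a : G) : K := turns u a.
pose X (t : T) (uv : U * U) := wedge (w uv.1) (w uv.2) (ab t).1 (ab t).2.
pose D t t' := wedge (coord t').1 (coord t').2 (ab t).1 (ab t).2.
have := @triangular_rank K (U * U)%type T (basic_pairs l rk finset.setT) X D sgn.
rewrite !card_sum !card_sig /= => tr.
have cardE (A : {set U * U}) : #|[pred ik | ik \in A]| = #|A| by apply: eq_card.
rewrite -cardsX; move: tr; rewrite !cardE; apply.
- move=> c cX t'.
  pose Z u v := \sum_t c t * X t (u, v).
  have Z0 u v : Z u v = 0.
    have [<-|uv] := eqVneq u v.
      by apply: big1 => t _; rewrite /X /wedge /= [Y in Y - _]mulrC subrr mulr0.
    apply: (basic_determine (rk := rk) l_dir l_distinct (B := finset.setT)) => //.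
    + move=> i j _ _; rewrite /Z -sumrN; apply: eq_bigr => t _.
      by rewrite /X /wedge /=; ring.
    + move=> i j _ _ ij d0; apply: big1 => t _; have [ct _] := hab t.
      by rewrite /X /wedge /= (commute_parallel K hS l_dir l_distinct ij d0 ct) mulr0.
    + move=> i j k p _ _ _ ij ik jk ip jp kp; rewrite /Z -big_split /=; apply: eq_bigr => t _.
      have [ct _] := hab t.
      by rewrite -mulrDr /X /wedge /=
        (commute_concurrent K hS l_dir l_distinct ij ik jk ip jp kp ct).
  have [hom1 hom2] := coord_hom t'.
  have [k1 e1] := hom_span hom1; have [k2 e2] := hom_span hom2.
  have DE t : D t t' = \sum_u \sum_v k1 u * k2 v * X t (u, v).
    rewrite /D /wedge !e1 !e2 !big_distrlr /= -sumrB; apply: eq_bigr => u _.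
    rewrite -sumrB; apply: eq_bigr => v _; rewrite /X /wedge /w /=; ring.
  transitivity (\sum_u \sum_v k1 u * k2 v * Z u v).
    under eq_bigr do rewrite DE big_distrr /=.
    rewrite exchange_big /=; apply: eq_bigr => u _.
    under eq_bigr do rewrite big_distrr /=.
    rewrite exchange_big /=; apply: eq_bigr => v _.
    by rewrite /Z big_distrr /=; apply: eq_bigr => t _; ring.
  by apply: big1 => u _; apply: big1 => v _; rewrite Z0 mulr0.
- by move=> t t'; have [_ h] := hab t; exact: h.
- by move=> [[?|?]|?] /=; rewrite ?oppr_eq0 oner_eq0.
Qed.
End RankInequality.

(** * Counting intersection points *)

Section Transversal.
Variables (R : realType) (U : finType).
Local Notation C := R[i].
Variables (l : U -> C * C * C) (rk : U -> nat) (B1 B2 : {set U}).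
Hypothesis l_dir : forall i, (l i).1 != (0, 0).
Hypothesis l_distinct : forall i j, i != j -> ~ proportional (l i) (l j).
Hypothesis rk_inj : injective rk.
Hypothesis B12 : forall i, (i \in B1) || (i \in B2).
Hypothesis rk_sep : forall i j, i \in B1 -> j \notin B1 -> (rk i < rk j)%N.
Hypothesis rank_le : (#|basic_pairs l rk B1| + #|basic_pairs l rk B2| + #|B2| * #|B1| <=
  #|basic_pairs l rk finset.setT|)%N.

(** The lines of B1 have the smaller ranks.  So if k has least rank at a point and
    is not in B1, no line through this point is in B1.  This gives one inclusion, and
    the rank inequality turns it into an equality. *)
Lemma basic_pairs_split : basic_pairs l rk finset.setT =
  basic_pairs l rk B1 :|: basic_pairs l rk B2 :|: finset.setX B2 B1.
Proof.
apply/eqP; rewrite eqEcard; apply/andP; split; last first.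
  apply: leq_trans rank_le; rewrite -cardsX.
  apply: leq_trans (leq_card_setU _ _) _; rewrite leq_add2r.
  exact: leq_card_setU.
apply/fintype.subsetP => -[i k] /basic_pairsP[_ _ ik d0 kmin].
rewrite !finset.in_setU finset.in_setX /=.
have [ip kp] := meet_pointP d0.
have [kB|kB] := boolP (k \in B1).
  have [iB|iB] := boolP (i \in B1).
    apply/orP; left; apply/orP; left; apply/basic_pairsP; split=> // j jB; exact: kmin.
  by have := B12 i; rewrite (negbTE iB) /= => ->; rewrite orbT.
have kB2 : k \in B2 by have := B12 k; rewrite (negbTE kB).
have iB : i \notin B1.
  by apply/negP => iB; have := rk_sep iB kB; rewrite ltnNge kmin.
have iB2 : i \in B2 by have := B12 i; rewrite (negbTE iB).
apply/orP; left; apply/orP; right; apply/basic_pairsP; split=> // j jB; exact: kmin.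
Qed.

(** Every pair in B2 x B1 is basic, so k has least rank at the point and is its
    only line in B1.  A second line of B2 through the point would give a basic
    pair of B2, hence of the whole, whose second line is in B2 and also has
    least rank there; it would be equal to k, but (k, k) is not basic. *)
Lemma transversal i k : i \in B2 -> k \in B1 -> [/\ i != k, det2 (l i) (l k) != 0 &
  forall j, aff (l j) (meet_point (l i) (l k)) = 0 -> j = i \/ j = k].
Proof.
move=> iB kB.
have inX m n : m \in B2 -> n \in B1 -> (m, n) \in basic_pairs l rk finset.setT.
  by move=> mB nB; rewrite basic_pairs_split !finset.in_setU finset.in_setX /= mB nB orbT.
have /basic_pairsP[_ _ ik d0 kmin] := inX i k iB kB; split=> // j jp.
have [ip kp] := meet_pointP d0; set p := meet_point _ _ in ip kp jp.
have [->|ji] := eqVneq j i; first by left.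
have [jB|jB] := boolP (j \in B1).
  right; have /basic_pairsP[_ _ ij dij jmin] := inX i j iB jB.
  apply: rk_inj; apply/eqP; rewrite eqn_leq kmin// jmin//.
  by rewrite /= -(meet_point_unique dij ip jp).
have jB2 : j \in B2 by have := B12 j; rewrite (negbTE jB).
exfalso.
pose Q := [pred m | (m \in B2) && (aff (l m) p == 0)].
have Qi : Q i by rewrite /= iB ip eqxx.
case: (arg_minnP rk Qi) => k0 /andP[k0B /eqP k0p] k0min.
have [i0 [i0B i0p i0k]] : exists i0, [/\ i0 \in B2, aff (l i0) p = 0 & i0 != k0].
  have [e|ne] := eqVneq i k0; last by exists i.
  by exists j; rewrite -e.
have d : det2 (l i0) (l k0) != 0 := concurrent_transverse l_dir l_distinct i0k i0p k0p.
have pE := meet_point_unique d i0p k0p.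
have : (i0, k0) \in basic_pairs l rk finset.setT.
  rewrite basic_pairs_split !finset.in_setU; apply/orP; left; apply/orP; right.
  apply/basic_pairsP; split=> // m mB; rewrite /= -pE => mp.
  by apply: k0min; rewrite /= mB mp eqxx.
move=> /basic_pairsP[_ _ _ _ gmin].
have ek : k0 = k.
  by apply: rk_inj; apply/eqP; rewrite eqn_leq gmin ?kmin//= -pE.
have /basic_pairsP[_ _] := inX k0 k k0B kB.
by rewrite ek eqxx.
Qed.
End Transversal.

Section Lines.
Variable R : realType.
Local Notation C := R[i].
Local Notation C2 := (C * C)%type.

Lemma line_equation (H : set C2) : exists p : C * C * C,
  is_line H -> p.1 != (0, 0) /\ H = [set z | aff p z = 0].
Proof.
have [[a [b [c [ab ->]]]]|n] := pselect (is_line H); last by exists (0, 0, 0).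
exists (a, b, - c) => _; split; first exact/eqP.
apply/seteqP; split=> z /=; rewrite /aff /= => h; first by rewrite h subrr.
by apply/eqP; rewrite -subr_eq0; apply/eqP.
Qed.

Lemma proportional_zeros (p q : C * C * C) z : q.1 != (0, 0) -> proportional p q ->
  (aff q z == 0) = (aff p z == 0).
Proof.
move=> q0 [u e]; have u0 : u != 0.
  by apply: contraNneq q0 => u0; rewrite e u0 /= !mul0r.
by rewrite e aff_rescale mulf_eq0 (negbTE u0).
Qed.
End Lines.

Local Open Scope card_scope.

Theorem theorem2 (R : realType) (A1 A2 : {fset set (R[i] * R[i])})
    (arrA1 : line_arrangement A1) (arrA2 : line_arrangement A2)
    (A1_neq0 : A1 <> fset0) (A2_neq0 : A2 <> fset0)
    (x : complement (A1 `|` A2)%fset) (x1 : complement A1) (x2 : complement A2)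
    (pi1_iso : group_isomorphic (fundamental_group R x)
       (fundamental_group R x1 * fundamental_group R x2)%type) :
  (curve A1 `&` curve A2) #= `I_(#|` A1| * #|` A2|)%N /\
  (forall z, (curve A1 `&` curve A2) z ->
     multiplicity (A1 `|` A2)%fset z = 2%N).
Proof.
have [f [g fK gK]] := pi1_iso.
have fM a b : f (a * b)%g = (f a * f b)%g by exact: gmulfM.
have /choice[eqn eqnP] := @line_equation R.
pose A := (A1 `|` A2)%fset.
have inA (H : set (R[i] * R[i])) : (H \in A) = (H \in A1) || (H \in A2) by rewrite in_fsetU.
pose U : finType := A.
have linU (i : U) : is_line (val i).
  by have := fsvalP i; rewrite inA => /orP[/arrA1|/arrA2].
pose l (i : U) := eqn (val i).
have l_dir i : (l i).1 != (0, 0) by have [] := eqnP _ (linU i).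
have lE (i : U) z : (val i) z <-> aff (l i) z = 0.
  by have [_ e] := eqnP _ (linU i); rewrite {1}e.
have l_distinct i j : i != j -> ~ proportional (l i) (l j).
  move=> ij pr; case/eqP: ij; apply: val_inj; apply/seteqP; split=> z /lE h; apply/lE/eqP.
    by rewrite (proportional_zeros z (l_dir j) pr) h.
  by rewrite -(proportional_zeros z (l_dir j) pr) h.
pose s : seq (set (R[i] * R[i])) := enum_fset A1 ++ enum_fset A2.
have ins (i : U) : val i \in s by have := fsvalP i; rewrite inA /s mem_cat.
(* the lines of A1 come first *)
pose rk (i : U) := index (val i) s.
have rk_inj : injective rk.
  by move=> i j e; apply: val_inj;
    rewrite -(nth_index set0 (ins i)) -[RHS](nth_index set0 (ins j)); congr nth.
pose B1 : {set U} := [set i : U | val i \in A1]%SET.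
pose B2 : {set U} := [set i : U | val i \in A2]%SET.
have B12 i : (i \in B1) || (i \in B2) by rewrite !inE -inA; exact: fsvalP.
have rk_sep i j : i \in B1 -> j \notin B1 -> (rk i < rk j)%N.
  rewrite !inE /rk !index_cat => iA /negbTE ->; rewrite iA.
  by apply: leq_trans (leq_addr _ _); rewrite index_mem.
have lift (B : {fset set (R[i] * R[i])}) : (B `<=` A)%fset -> forall H, H \in B ->
    exists2 i : U, val i = H & val i \in B.
  by move=> BA H HB; exists [` fsubsetP BA H HB]%fset.
have A1A : (A1 `<=` A)%fset by exact: fsubsetUl.
have A2A : (A2 `<=` A)%fset by exact: fsubsetUr.
have compl (B : {fset set (R[i] * R[i])}) : (B `<=` A)%fset -> forall z, complement B z <->
    forall i, i \in [set i : U | val i \in B]%SET -> aff (l i) z != 0.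
  move=> BA z; split=> [h i|h [H /= HB Hz]].
    by rewrite inE => iB; apply/negP => /eqP /lE iz; apply: h; exists (val i).
  have [i iH iB] := lift B BA H HB.
  have := h i; rewrite inE iB => /(_ isT) /eqP; apply; apply/lE; by rewrite iH.
have hS z : complement A z <-> forall i, aff (l i) z != 0.
  split=> [/(compl _ (fsubset_refl _)) h i|h].
    by apply: h; rewrite inE; exact: fsvalP.
  by apply/(compl _ (fsubset_refl _)) => i _.
have rank := @rank_inequality R rat U l rk l_dir l_distinct rk_inj _ _ _ B1 B2 hS
  (compl A1 A1A) (compl A2 A2A) x x1 x2 f g fM fK gK.
have tr := transversal l_dir l_distinct rk_inj B12 rk_sep rank.
pose pt (ik : U * U) := meet_point (l ik.1) (l ik.2).
have meet z : (curve A1 `&` curve A2) z <-> exists2 ik, ik \in finset.setX B2 B1 & pt ik = z.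
  split=> [[[H1 H1A H1z] [H2 H2A H2z]]|[[i k]]].
    have [k kH kB] := lift A1 A1A H1 H1A; have [i iH iB] := lift A2 A2A H2 H2A.
    have iB2 : i \in B2 by rewrite inE.
    have kB1 : k \in B1 by rewrite inE.
    have [ik d0 _] := tr i k iB2 kB1.
    exists (i, k); first by rewrite finset.in_setX iB2.
    by symmetry; apply: meet_point_unique => //; apply/lE; rewrite ?iH ?kH.
  rewrite finset.in_setX !inE /= => /andP[iB kB] <-.
  have [ik d0 _] := tr i k ltac:(by rewrite inE) ltac:(by rewrite inE).
  have [ip kp] := meet_pointP d0.
  by split; [exists (val k) => //; apply/lE|exists (val i) => //; apply/lE].
have pt_inj : {in finset.setX B2 B1 &, injective pt}.
  move=> [i k] [i' k']; rewrite !finset.in_setX /= => /andP[iB kB] /andP[iB' kB'] e.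
  have [ik d0 only] := tr i k iB kB; have [ik' d0' only'] := tr i' k' iB' kB'.
  have [ip kp] := meet_pointP d0'.
  move: ip kp; rewrite -[meet_point _ _]/(pt (i', k')) -e => /only oi /only ok.
  have [ip kp] := meet_pointP d0.
  move: ip kp; rewrite -[meet_point _ _]/(pt (i, k)) e => /only' oi' /only' ok'.
  have nB m n : m \in B2 -> n \in B1 -> m <> n.
    by move=> mB nB mn; have [] := tr m n mB nB; rewrite mn eqxx.
  case: oi => [->|ei]; last by case: (nB _ _ iB' kB).
  by case: ok => [ek|->//]; case: (nB _ _ iB kB').
have cardB (B : {fset set (R[i] * R[i])}) : (B `<=` A)%fset ->
    #|` B| = #|[set i : U | val i \in B]%SET|.
  move=> BA; pose Bs := [set i : U | val i \in B]%SET.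
  have eB : B = [fset val i | i in Bs]%fset.
    apply/fsetP => H; apply/idP/imfsetP => [HB|[i /=]]; last by rewrite inE => iB ->.
    by have [i iH iB] := lift B BA H HB; exists i; rewrite ?inE//= inE.
  by rewrite {1}eB card_imfset; [rewrite -cardE|exact: val_inj].
split.
  have -> : curve A1 `&` curve A2 = [set` [fset pt ik | ik in finset.setX B2 B1]%fset].
    apply/seteqP; split=> z.
      by move=> /meet [ik ikX <-]; apply/imfsetP; exists ik.
    by move=> /imfsetP [ik /= ikX ->]; apply/meet; exists ik.
  apply/card_eq_fsetP; rewrite card_in_imfset//.
  by rewrite -cardE cardsX mulnC (cardB _ A1A) (cardB _ A2A).
move=> z /meet [[i k]]; rewrite finset.in_setX /= => /andP[iB kB] <-.
have [ik d0 only] := tr i k iB kB; have [ip kp] := meet_pointP d0.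
rewrite /multiplicity.
have -> : [fset H in A | pt (i, k) \in H]%fset = [fset val i; val k]%fset.
  apply/fsetP => H; rewrite !inE; apply/idP/idP => [/andP[HA Hz]|/orP[/eqP ->|/eqP ->]].
  - have [j jH _] := lift A (fsubset_refl _) H (etrans (inA H) HA).
    move: Hz; rewrite -jH inE => /lE /only [->|->]; by rewrite eqxx ?orbT.
  - by rewrite -inA fsvalP/= inE; apply/lE.
  - by rewrite -inA fsvalP/= inE; apply/lE.
by rewrite cardfs2 (inj_eq val_inj) ik.
Qed.
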